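(* Let $\mathcal P_4$ be the family of all 3-uniform minimal 4-paths. For every integer $n\ge 9$, the second order Turán number $\mathrm{ex}_3^{(2)}(n;\mathcal P_4)$ and the corresponding family $\mathrm{Ex}_3^{(2)}(n;\mathcal P_4)$ of 2-extremal 3-graphs (up to isomorphism) are as follows: \begin{itemize} \item for $9\le n\le 11$: $\mathrm{ex}_3^{(2)}(n;\mathcal P_4)=5n-18$ and $\mathrm{Ex}_3^{(2)}(n;\mathcal P_4)=\{SP_n\}$; \item for $n\ge 12$: $\mathrm{ex}_3^{(2)}(n;\mathcal P_4)=\binom{n-3}2+7$ and $\mathrm{Ex}_3^{(2)}(n;\mathcal P_4)=\{CB_n\}$. \end{itemize}
   Context: A 3-graph $H$ consists of a finite vertex set $V(H)$ and a set $E(H)\subseteq\binom{V(H)}3$ of edges. A (3-uniform) minimal 4-path is a 3-graph (without isolated vertices) with edge set $\{a_0,a_1,a_2,a_3\}$ such that $a_i\cap a_j\ne\emptyset$ if and only if $|i-j|\le 1$; $\mathcal P_4$ is the family of all of them. For 3-graphs, $F\subseteq H$ means that $H$ has a sub-3-graph isomorphic to $F$; $H$ is $\mathcal F$-free if $F\nsubseteq H$ for all $F\in\mathcal F$. Turán numbers of higher order. $\mathrm{ex}_3^{(1)}(n;\mathcal F)$ is the maximum number of edges of an $\mathcal F$-free 3-graph on $n$ vertices, and $\mathrm{Ex}_3^{(1)}(n;\mathcal F)$ is the family of $n$-vertex $\mathcal F$-free 3-graphs attaining it. For $s\ge 1$, $\mathrm{ex}_3^{(s+1)}(n;\mathcal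 F)$ is the maximum of $|E(H)|$ over all $n$-vertex $\mathcal F$-free 3-graphs $H$ such that $H\nsubseteq H'$ for every $H'\in \mathrm{Ex}_3^{(1)}(n;\mathcal F)\cup\dots\cup \mathrm{Ex}_3^{(s)}(n;\mathcal F)$ (if such an $H$ exists), and $\mathrm{Ex}_3^{(s+1)}(n;\mathcal F)$ is the family of all such $H$ attaining the maximum. Special 3-graphs. The full star $S_m$ is the 3-graph on $m$ vertices consisting of all triples containing a fixed vertex (the center). $SP_n$: let $P$ be the 5-vertex 3-graph consisting of two edges sharing exactly one vertex; $SP_n$ is the 3-graph on a vertex set $V\supset V(P)$, $|V|=n$, with a distinguished vertex $v\in V\setminus V(P)$, whose edges are the two edges of $P$ together with all triples of $V$ containing $v$ and at least one vertex of $V(P)$. The compact balloon $CB_n$ ($n\ge 8$) is the 3-graph on $n$ vertices obtained from the full star $S_{n-2}$ with center $x$ by selecting two vertices $y_1,y_2\in V(S_{n-2})\setminus\{x\}$, adding two new vertices $z_1,z_2$, and adding seven new edges: $\{y_1,y_2,z_1\}$, $\{y_1,y_2,z_2\}$, the four edges $\{x,y_i,z_j\}$, $i,j=1,2$, and $\{x,z_1,z_2\}$. *)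

(* Defs.v *)
From mathcomp Require Import all_boot.

Set Implicit Arguments.
Unset Strict Implicit.
Unset Printing Implicit Defensive.

Record graph3 := Graph3 {
  vertex :> finType;
  edges : {set {set vertex}};
  edges_card3 : forall e, e \in edges -> #|e| = 3
}.

(* [F] is contained in [H]: the image of [F] under [f] is the sub-3-graph of
   [H] isomorphic to [F]. *)
Definition contained (F H : graph3) : Prop :=
  exists2 f : F -> H, injective f &
    forall e : {set F}, e \in edges F -> f @: e \in edges H.

Definition isomorphic (G H : graph3) : Prop :=
  exists2 f : G -> H, bijective f &
    forall e : {set G}, (e \in edges G) = (f @: e \in edges H).

Definition family := graph3 -> Prop.

Definition is_free (F : family) (H : graph3) : Prop :=
  forall G, F G -> ~ contained G H.

(* [i <= j.+1] and [j <= i.+1] together say [|i - j| <= 1].  The condition on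
   intersections forces the four edges [a i] to be distinct. *)
Definition minimal_4path : family := fun H =>
  (forall x : H, exists2 e, e \in edges H & x \in e) /\
  exists2 a : 'I_4 -> {set H}, edges H = [set a i | i : 'I_4] &
    forall i j : 'I_4, a i :&: a j != set0 <-> (i <= j.+1) && (j <= i.+1).

Section Turan.

Variables (F : family) (n : nat).

Definition admissible (L : family) (H : graph3) : Prop :=
  [/\ #|H| = n, is_free F H & forall H', L H' -> ~ contained H H'].

Definition max_edges (L : family) (m : nat) : Prop :=
  (exists2 H, admissible L H & #|edges H| = m) /\
  (forall H, admissible L H -> #|edges H| <= m).

Definition extremal (L : family) : family := fun H =>
  admissible L H /\ max_edges L #|edges H|.

(* The union of the families [Ex^(1)], ..., [Ex^(s)]. *)
Fixpoint extremal_upto (s : nat) : family :=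
  if s is t.+1 then
    fun H => extremal_upto t H \/ extremal (extremal_upto t) H
  else fun=> False.

(* [turan_number s m] says that [ex^(s)(n; F)] is defined and equal to [m]; it
   is a relation because the maximum may range over no 3-graph at all.  Orders
   start at 1. *)
Definition turan_number (s m : nat) : Prop :=
  if s is t.+1 then max_edges (extremal_upto t) m else False.

Definition turan_family (s : nat) : family :=
  if s is t.+1 then extremal (extremal_upto t) else fun=> False.

End Turan.

Section SpecialEdges.

Variable T : finType.

(* The full star with center [x] and vertex set [A]. *)
Definition star_edges (A : {set T}) (x : T) : {set {set T}} :=
  [set e : {set T} | [&& #|e| == 3, e \subset A & x \in e]].

(* [P] has the edges [p0 p1 p2] and [p2 p3 p4]. *)
Definition SP_edges (p0 p1 p2 p3 p4 v : T) : {set {set T}} :=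
  [set [set p0; p1; p2]; [set p2; p3; p4]] :|:
  [set e in star_edges setT v | e :&: [set p0; p1; p2; p3; p4] != set0].

Definition CB_edges (x y1 y2 z1 z2 : T) : {set {set T}} :=
  star_edges (~: [set z1; z2]) x :|:
  [set [set y1; y2; z1]; [set y1; y2; z2];
       [set x; y1; z1]; [set x; y1; z2]; [set x; y2; z1]; [set x; y2; z2];
       [set x; z1; z2]].

End SpecialEdges.

Fact cards3_inord m a b c : a <= m -> b <= m -> c <= m -> uniq [:: a; b; c] ->
  #|[set inord a; inord b; inord c] : {set 'I_m.+1}| = 3.
Proof.
move=> am bm cm; rewrite /= !inE negb_or andbT => /andP[/andP[ab ac] bc].
by rewrite -setUA !cardsU1 cards1 !inE -!val_eqE /= !inordK // (negPf ab)
  (negPf ac) (negPf bc).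
Qed.

Fact SP_card3 n (e : {set 'I_(n - 6).+2.+4}) :
  e \in SP_edges (inord 0) (inord 1) (inord 2) (inord 3) (inord 4) (inord 5) ->
  #|e| = 3.
Proof.
rewrite !inE => /orP[/orP[]/eqP-> | /andP[/andP[/eqP-> _] _] //];
  exact: cards3_inord.
Qed.

(* The vertex type has [n] elements as soon as [6 <= n]. *)
Definition SP (n : nat) : graph3 := Graph3 (@SP_card3 n).

Fact CB_card3 n (e : {set 'I_(n - 8).+4.+4}) :
  e \in CB_edges (inord 0) (inord 1) (inord 2) (inord 3) (inord 4) ->
  #|e| = 3.
Proof.
rewrite !inE => /orP[/andP[/eqP-> _] // | ].
by do ![case/orP]; move=> /eqP->; apply: cards3_inord.
Qed.

(* The vertex type has [n] elements as soon as [8 <= n]. *)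
Definition CB (n : nat) : graph3 := Graph3 (@CB_card3 n).

(* Main.v *)
(* Let [H] be a [P4]-free triple system on [n >= 9] vertices.  If its edges pairwise meet, then
   either all but one of them share a vertex or there are few of them.  Otherwise choose nonempty
   parts [C] and [D] of [H], no edge of [C] meeting an edge of [D], of largest total size: by
   [P4]-freeness and maximality every edge outside [C :|: D] meets every edge of [C] and of [D],
   and at most [3 n - 6] triples can do that.  An edge of the rest missing the kernel (common
   intersection) of [C] consists of a pair covering [C] and a vertex of the kernel of [D].
   Comparing [C] and [D] with their kernels, by induction on [n], leaves as large systems only
   those with a vertex [x] on all but at most four edges.  Two of the other edges [e] and [f]
   that meet force the link of [x] either to consist of pairs meeting [e :|: f], or to consist of
   pairs that meet [e] if and only if they meet [f]; the first option is best for
   [#|e :&: f| = 1], giving [SP], and the second for [#|e :&: f| = 2], giving [CB].  Systems with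
   a vertex on all but at most one edge are exactly the subsystems of the 1-extremal ones. *)

Require Import Defs.
From mathcomp Require Import all_boot zify.

Set Implicit Arguments.
Unset Strict Implicit.
Unset Printing Implicit Defensive.

(** * A certified search for families of triples without minimal 4-paths *)

(** The bound [3 n - 6] rests on two finite searches, since the edges meeting two disjoint triples
    are themselves [P4]-free: at most 18 of them fit on 8 vertices, and at most 11 are transversals
    of these triples and a third one. Hence beyond 8 vertices some vertex lies on at most three of
    them and can be deleted.

    The induction does not use the classification of smaller systems, only the resulting bound on
    their number of edges. So vertex sets of size at most 8, for which no classification is claimed,
    need only a crude bound.

    The case [n = 9] shapes the proof. There the target is [5 * 9 - 18 = 27], and two of the counts
    that suffice for larger [n] fail, both when one part is a single edge. One is replaced by a
    third search, over triples and covering pairs on the remaining six vertices, the other by a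
    study of the link of the centre of the other part. *)

(* Conditionals replace [&&] and [||] in this section so that the virtual machine stays lazy. *)
Fixpoint meets (s t : bitseq) : bool :=
  match s, t with
  | a :: s', b :: t' => if a then (if b then true else meets s' t') else meets s' t'
  | _, _ => false
  end.

Definition p4path (a b c d : bitseq) : bool :=
  if meets a b then if meets b c then if meets c d then
    if meets a c then false else if meets a d then false else ~~ meets b d
  else false else false else false.

(** Reversing a path keeps [p4path], so twelve of the 24 orders of four sets represent them all. *)
Definition p4 (a b c d : bitseq) : bool := has (fun p => p)
 [:: p4path a b c d; p4path a b d c; p4path a c b d; p4path a c d b; p4path a d b c; p4path a d c b;
     p4path b a c d; p4path b a d c; p4path c a b d; p4path c a d b; p4path d a b c; p4path d a c b].

Fixpoint diff_mask (u m : bitseq) : bitseq :=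
  match u, m with
  | a :: u', b :: m' => (if b then false else a) :: diff_mask u' m'
  | _, _ => u
  end.

Fixpoint forbid_row (d : bitseq) (r : seq bitseq) (u : bitseq) : bitseq :=
  match d, r with
  | b :: d', m :: r' => forbid_row d' r' (if b then diff_mask u m else u)
  | _, _ => u
  end.

Fixpoint forbid (d : bitseq) (r : seq (seq bitseq)) (u : bitseq) : bitseq :=
  match d, r with
  | b :: d', m :: r' => forbid d' r' (if b then forbid_row d' m u else u)
  | _, _ => u
  end.

Fixpoint at_most (k : nat) (u : bitseq) {struct u} : bool :=
  match u with
  | [::] => true
  | false :: u' => at_most k u'
  | true :: u' => if k is k'.+1 then at_most k' u' else false
  end.

(* [dec] holds the decisions taken so far, latest first, [und] the undecided sets that are not
   yet forbidden, and [rows] tabulates, for each undecided set [v] and each pair of decided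
   sets [a], [b], the later sets [w] for which [p4 a b v w] holds. *)
Fixpoint search (rows : seq (seq (seq bitseq))) (dec und : bitseq) (k : nat) : bool :=
  if at_most k und then true else
  match rows, und with
  | row :: rows', u :: und' =>
     if search rows' (false :: dec) und' k then
       if u then
         if k is k'.+1 then search rows' (true :: dec) (forbid dec row und') k' else false
       else true
     else false
  | _, _ => false
  end.

Fixpoint path_row (prev : seq bitseq) v xs :=
  if prev is b :: p' then [seq [seq p4 a b v w | w <- xs] | a <- p'] :: path_row p' v xs else [::].

Fixpoint path_rows prev xs :=
  if xs is v :: xs' then path_row prev v xs' :: path_rows (v :: prev) xs' else [::].

Definition bits n (t : nat * nat * nat) : bitseq :=
  let: (a, b, c) := t in [seq (i == a) || (i == b) || (i == c) | i <- iota 0 n].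

Definition run n k l :=
  let xs := map (bits n) l in search (path_rows [::] xs) [::] (nseq (size xs) true) k.

(* The triples in {0, ..., 7} meeting {0, 1, 2} and {3, 4, 5}, in an order, found by
   experiment, that keeps the search small. *)
Definition pair_triples := [::
  (2,4,7); (0,3,7); (2,4,6); (1,3,7); (1,5,7); (0,5,7); (1,3,6); (0,5,6); (1,5,6); (2,3,6);
  (0,4,6); (0,4,7); (2,3,7); (0,3,6); (1,4,6); (2,5,7); (0,2,5); (1,4,7); (1,2,4); (2,5,6);
  (1,2,3); (1,4,5); (0,1,3); (2,3,4); (0,3,4); (2,3,5); (1,3,5); (0,1,5); (1,3,4); (0,4,5);
  (0,2,4); (1,2,5); (2,4,5); (0,3,5); (0,1,4); (0,2,3)].

(* The triples meeting {0, 1, 2}, {3, 4, 5} and {6, 7, 8}, again in a favourable order. *)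
Definition transversals := [::
  (1,5,7); (2,3,7); (0,5,8); (1,4,6); (1,5,6); (0,4,8); (2,3,6); (1,4,7); (2,5,8); (0,3,6);
  (0,3,7); (2,4,8); (1,3,8); (0,5,7); (2,4,6); (2,5,7); (0,4,6); (0,3,8); (2,5,6); (1,3,7);
  (1,4,8); (0,4,7); (1,3,6); (1,5,8); (2,4,7); (0,5,6); (2,3,8)].

Section SearchSound.
Variable S : pred bitseq.
Hypothesis S_p4 : forall a b v w, S a -> S b -> S v -> S w -> ~~ p4 a b v w.

Let fits (xs : seq bitseq) (und : bitseq) := all2 (fun x (u : bool) => S x ==> u) xs und.

Lemma fits_diff_mask xs (m : bitseq -> bool) und :
  (forall w, S w -> ~~ m w) -> fits xs und -> fits xs (diff_mask und (map m xs)).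
Proof.
move=> Sm; elim: xs und => [|x xs IH] [|u und] //= /andP[xu /IH ->].
by rewrite andbT; apply/implyP=> Sx; rewrite (negPf (Sm x Sx)) (implyP xu).
Qed.

Lemma fits_forbid_row prev b v xs und : S b -> S v -> fits xs und ->
  fits xs (forbid_row (map S prev) [seq [seq p4 a b v w | w <- xs] | a <- prev] und).
Proof.
move=> Sb Sv; elim: prev und => [|a prev IH] und //= und_ok; apply: IH.
by case: ifP => // Sa; apply: fits_diff_mask => // w; apply: S_p4.
Qed.

Lemma fits_forbid prev v xs und : S v -> fits xs und ->
  fits xs (forbid (map S prev) (path_row prev v xs) und).
Proof.
move=> Sv; elim: prev und => [|b prev IH] und //= und_ok; apply: IH.
by case: ifP => // Sb; apply: fits_forbid_row.
Qed.

Lemma at_most_count k u : at_most k u -> count id u <= k.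
Proof. by elim: u k => [|[] u IH] [|k] //= /IH. Qed.

Lemma fits_count xs und : fits xs und -> count S xs <= count id und.
Proof.
elim: xs und => [|x xs IH] [|u und] //= /andP[xu /IH {}IH].
by apply: leq_add => //; case: (S x) xu => //= ->.
Qed.

(** The invariant [fits] says that every member of [S] still to come is allowed by [und]. Taking [x]
    preserves it: a set removed by [forbid] would form a 4-path with [x] and two sets taken before.
    At a leaf the allowed sets are few enough by themselves. *)
Lemma searchP prev xs und k : search (path_rows prev xs) (map S prev) und k ->
  fits xs und -> count S xs <= k.
Proof.
elim: xs prev und k => [|x xs IH] prev und k; first by [].
rewrite [search _ _ _ _]/=; case: ifP => [/at_most_count fk _ /fits_count|_]; first lia.
case: und => [|u und] //=.
case: ifP => // out_ok; case: (boolP (S x)) => Sx.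
- case: u => //=; case: k out_ok => // k _ in_ok und_ok; rewrite add1n ltnS.
  by apply: (IH (x :: prev)); [rewrite /= Sx; exact: in_ok | exact: fits_forbid].
- move=> _ und_ok; rewrite add0n; move: und_ok; rewrite /= => und_ok.
  by apply: (IH (x :: prev)) und_ok; rewrite /= (negPf Sx).
Qed.

Lemma search_count xs k :
  search (path_rows [::] xs) [::] (nseq (size xs) true) k -> count S xs <= k.
Proof.
move=> ok; apply: (@searchP [::] xs _ _ ok); elim: xs {ok} => //= x xs IH.
by rewrite implybT.
Qed.

End SearchSound.

(** * Splitting a triple system into two separated parts *)

(* Cardinals that are only convertible, not syntactically equal, are identified
   before calling [lia]. *)
Ltac card_lia :=
  repeat match goal with |- context [@card.body ?U ?m] =>
    let k := fresh "k" in set k := (@card.body U m); clearbody k end;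
  clear; lia.

Section Families.
Variable T : finType.
Implicit Types (A B V W : {set T}) (a b c d e f g h : {set T}) (C D E : {set {set T}}).

Definition ksub V k := [set e : {set T} | e \subset V & #|e| == k].

Definition meet A B := A :&: B != set0.

Definition p4free E := forall a b c d, a \in E -> b \in E -> c \in E -> d \in E ->
  meet a b -> meet b c -> meet c d -> ~~ meet a c -> ~~ meet a d -> ~~ meet b d -> False.

Lemma ksubP V k e : reflect (e \subset V /\ #|e| = k) (e \in ksub V k).
Proof. by rewrite inE; apply: (iffP andP) => -[-> /eqP]. Qed.

Lemma card_ksub V k : #|ksub V k| = 'C(#|V|, k).
Proof. by rewrite -cards_draws; apply: eq_card => e; rewrite !inE. Qed.

Lemma meetP A B : reflect (exists2 x, x \in A & x \in B) (meet A B).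
Proof.
apply: (iffP (set0Pn _)) => [[x /setIP[]]|[x xA xB]]; first by exists x.
by exists x; rewrite inE xA.
Qed.

Lemma meetC A B : meet A B = meet B A.
Proof. by rewrite /meet setIC. Qed.

Lemma meetPn A B : reflect (forall x, x \in A -> x \in B -> False) (~~ meet A B).
Proof.
apply: (iffP idP) => [/meetP AB x xA xB|AB]; first by apply: AB; exists x.
by apply/meetP=> -[x xA xB]; exact: AB xB.
Qed.

Lemma p4freeS C E : C \subset E -> p4free E -> p4free C.
Proof. by move=> /subsetP CE pE a b c d aC bC cC dC; apply: pE; exact: CE. Qed.

Definition sep C D := [forall c in C, forall d in D, ~~ meet c d].

Lemma sepP C D : reflect (forall c d, c \in C -> d \in D -> ~~ meet c d) (sep C D).
Proof.
apply: (iffP forall_inP) => [CD c d cC dD|CD c cC]; last by apply/forall_inP => d; apply: CD.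
by move/forall_inP: (CD c cC) => /(_ d dD).
Qed.

Lemma sepC C D : sep C D = sep D C.
Proof. by apply/sepP/sepP => CD c d cC dD; rewrite meetC; exact: CD. Qed.

Let splits E C D := [&& C != set0, D != set0, C :|: D \subset E & sep C D].

Let split_swap E C D : splits E C D = splits E D C.
Proof. by rewrite /splits sepC [D :|: C]setUC; do 3!case: (_ != _) => //=. Qed.

(** Suppose [b] misses [c]. It meets some [d] in [D], since otherwise [b] could join [C]. Let [S] be
    the set of edges of [C] that meet [b]. If no edge of [S] met one of [C :\: S], then moving [S]
    together with [b] to the side of [D] would enlarge the split, with [c] keeping the other side
    nonempty. So some [x] in [S] meets some [y] in [C :\: S], and [y], [x], [b], [d] is a minimal
    4-path. *)
Let max_split_meet E C D b c : p4free E -> set0 \notin E -> splits E C D ->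
    (forall C' D', splits E C' D' -> #|C'| + #|D'| <= #|C| + #|D|) ->
  b \in E -> b \notin C :|: D -> c \in C -> meet b c.
Proof.
move=> pE E0 sCD maxCD bE; rewrite inE negb_or => /andP[bC bD] cC.
have [C0 D0 sE /sepP CD] := and4P sCD.
have CE x : x \in C -> x \in E by move=> xC; apply: (subsetP sE); rewrite inE xC.
have DE x : x \in D -> x \in E by move=> xD; apply: (subsetP sE); rewrite inE xD orbT.
have notCD x : x \in C -> x \notin D.
  move=> xC; apply/negP=> xD; have := CD _ _ xC xD; rewrite /meet setIid negbK => /eqP x0.
  by move: (CE x xC); rewrite x0 (negPf E0).
apply: contraT => bc; exfalso.
have [d dD bd] : exists2 d, d \in D & meet b d.
  apply/exists_inP; apply: contraT => /exists_inPn bD'.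
  have := maxCD (b |: C) D; rewrite cardsU1 bC add1n addSn ltnn; apply; apply/and4P; split=> //.
  - by apply/set0Pn; exists b; rewrite !inE eqxx.
  - by rewrite -setUA subUset sub1set bE.
  - by apply/sepP => x y /setU1P[->|xC] yD; [exact: bD' | exact: CD].
pose S := [set x in C | meet b x].
have [/sepP SS'|] := boolP (sep S (C :\: S)).
  have := maxCD (C :\: S) (b |: (S :|: D)).
  have SC : S \subset C by apply/subsetP => x; rewrite inE => /andP[].
  have SD : [disjoint S & D].
    by rewrite disjoint_subset; apply/subsetP => x /(subsetP SC) /notCD.
  rewrite cardsU1 !inE !negb_or negb_and bC bD /= cardsU disjoint_setI0 // cards0 cardsD.
  rewrite (setIidPr SC) subn0; have := subset_leq_card SC => leSC.
  move=> le; suff /le : splits E (C :\: S) (b |: (S :|: D)) by move: leSC; card_lia.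
  apply/and4P; split.
  - by apply/set0Pn; exists c; rewrite !inE cC (negPf bc).
  - by apply/set0Pn; exists b; rewrite !inE eqxx.
  - apply/subsetP => x; rewrite !inE => /or3P[/andP[_ /CE]|/eqP->|/orP[/andP[/CE]|/DE]] //.
  - apply/sepP => x y; rewrite !inE => /andP[nS xC].
    move=> /or3P[/eqP->|yS|yD]; last exact: CD.
      by move: nS; rewrite xC meetC.
    rewrite meetC; apply: SS'; first by rewrite inE.
    by rewrite !inE nS.
case/forall_inPn => x xS /forall_inPn[y yS' /negPn xy].
move: xS yS'; rewrite !inE => /andP[xC bx] /andP[nS yC]; rewrite yC /= in nS.
by apply: (pE y x b d (CE _ yC) (CE _ xC) bE (DE _ dD)); rewrite 1?meetC // meetC ?CD.
Qed.

Lemma p4free_split E e f : p4free E -> set0 \notin E -> e \in E -> f \in E -> ~~ meet e f ->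
  exists C D : {set {set T}}, [/\ C != set0, D != set0, C :|: D \subset E, sep C D
    & forall b c, b \in E -> b \notin C :|: D -> c \in C :|: D -> meet b c].
Proof.
move=> pE E0 eE fE ef; pose P (p : {set {set T}} * {set {set T}}) := splits E p.1 p.2.
have P0 : P ([set e], [set f]).
  apply/and4P; split; rewrite /= ?subUset ?sub1set ?eE //; first by apply/set0Pn; exists e; rewrite inE.
    by apply/set0Pn; exists f; rewrite inE.
  by apply/sepP => c d /set1P-> /set1P->.
case: (@arg_maxnP _ _ P (fun p => #|p.1| + #|p.2|) P0) => -[C D] /= PCD maxCD.
have max1 C' D' : splits E C' D' -> #|C'| + #|D'| <= #|C| + #|D|.
  by move=> s; exact: (maxCD (C', D')).
exists C, D; have [C0 D0 sE sCD] := and4P PCD; split=> // b c bE nb /setUP[cC|cD].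
  exact: (max_split_meet pE E0 PCD).
apply: (max_split_meet pE E0 (C := D) (D := C)) => //; rewrite 1?split_swap 1?setUC //.
by move=> C' D'; rewrite split_swap addnC [#|D| + _]addnC; exact: max1.
Qed.

End Families.

(** * Transfer of the search results to triples of a finite type *)

Fixpoint bitseqs n : seq bitseq :=
  if n is n'.+1 then map (cons true) (bitseqs n') ++ map (cons false) (bitseqs n') else [:: [::]].

Lemma mem_bitseqs s : s \in bitseqs (size s).
Proof.
by elim: s => //= -[] s IH; rewrite mem_cat map_f // orbT.
Qed.

Section Codes.
Variables (T : finType) (vs : seq T).
Hypothesis vs_uniq : uniq vs.
Implicit Types (b e f : {set T}) (s t : bitseq) (B C P : {set {set T}}).

Definition decode s : {set T} := [set x in mask s vs].
(** Padding with [false] lets a search on [n] positions serve ground sets with fewer than [n]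
    vertices; [short] singles out the sequences whose padding is empty. *)
Definition code n b : bitseq := [seq x \in b | x <- vs] ++ nseq (n - size vs) false.
Definition short s := all negb (drop (size vs) s).

Lemma meets_decode s t : short s -> meets s t = meet (decode s) (decode t).
Proof.
move=> short_s; transitivity (has [in mask t vs] (mask s vs)); last first.
  apply/hasP/meetP => -[x]; rewrite ?inE => xs xt; first by exists x; rewrite inE.
  by exists x; rewrite -?topredE.
move: short_s vs_uniq; rewrite /short; elim: vs s t => [|v ws IH] s t.
  rewrite drop0 !mask0 /= => short_s _.
  by elim: s t short_s => [|[] s IH] [|b t] //= /IH.
case: s => [|a s]; first by rewrite mask0s; case: t.
case: t => [|b t]; first by rewrite mask0s has_pred0; case: a.
rewrite /=; move=> short_s /andP[vw uw]; rewrite (IH _ t short_s uw).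
have notv r : v \notin mask r ws by apply: contra vw; exact: mem_mask.
have tail r : has [in v :: mask r ws] (mask s ws) = has [in mask r ws] (mask s ws).
  apply: eq_in_has => x xs; rewrite inE; case: eqP => // xv; move: xs.
  by rewrite xv (negPf (notv s)).
by case: a; case: b => //=; rewrite ?inE ?eqxx ?tail ?(negPf (notv _)).
Qed.

Lemma size_code n b : size vs <= n -> size (code n b) = n.
Proof. by move=> le; rewrite size_cat size_map size_nseq subnKC. Qed.

Lemma short_code n b : short (code n b).
Proof. by rewrite /short drop_size_cat ?size_map // all_nseq orbT. Qed.

Lemma codeK n b : {subset b <= vs} -> decode (code n b) = b.
Proof.
move=> b_vs; apply/setP=> x; rewrite inE -[in mask _ vs](cats0 vs) mask_cat ?size_map //.
rewrite mask0 cats0 -filter_mask mem_filter; case: (boolP (x \in b)) => //= /b_vs ->.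
by [].
Qed.

Lemma count_code n b : {subset b <= vs} -> count id (code n b) = #|b|.
Proof.
move=> b_vs; rewrite count_cat count_nseq addn0 count_map -size_filter cardE.
apply/perm_size/uniq_perm => [||x]; [exact: filter_uniq | exact: enum_uniq |].
by rewrite mem_filter mem_enum /=; case: (boolP (x \in b)) => //= /b_vs.
Qed.

Lemma code_inj n B : (forall b, b \in B -> {subset b <= vs}) -> {in B &, injective (code n)}.
Proof. by move=> B_vs b c bB cB bc; rewrite -(codeK n (B_vs b bB)) bc codeK //; exact: B_vs. Qed.

Lemma card_code n B (S : pred bitseq) xs : (forall b, b \in B -> {subset b <= vs}) ->
  (forall b, b \in B -> S (code n b) && (code n b \in xs)) -> #|B| <= count S xs.
Proof.
move=> B_vs BS; rewrite cardE -(size_map (code n)) -size_filter; apply: uniq_leq_size.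
  rewrite map_inj_in_uniq ?enum_uniq // => b c; rewrite !mem_enum; exact: code_inj.
by move=> s /mapP[b]; rewrite mem_enum => /BS /andP[Sb xb] ->; rewrite mem_filter Sb.
Qed.

(** The search is applied to the sequences that decode into [B]. The condition [short] is imposed
    because two sequences could otherwise share a position beyond [vs], and [meets] would not
    describe the intersection of the decoded sets. *)
Lemma run_bound n k l B : run n k l -> p4free B -> size vs <= n ->
  (forall b, b \in B -> {subset b <= vs} /\ code n b \in map (bits n) l) -> #|B| <= k.
Proof.
move=> runl pB le B_l; pose S s := short s && (decode s \in B).
have B_vs b : b \in B -> {subset b <= vs} by case/B_l.
apply: leq_trans (card_code (S := S) (n := n) (xs := map (bits n) l) B_vs _) _.
  by move=> b bB; rewrite /S short_code codeK ?bB ?(B_l b bB).2 //; exact: B_vs.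
apply: search_count => // a b c d /andP[sa aB] /andP[sb bB] /andP[sc cB] /andP[sd dB].
have nopath x y z w : decode x \in B -> decode y \in B -> decode z \in B -> decode w \in B ->
  short x -> short y -> short z -> short w -> p4path x y z w = false.
  move=> xB yB zB wB sx sy sz sw; rewrite /p4path !meets_decode //.
  case: ifP => // xy; case: ifP => // yz; case: ifP => // zw; case: ifP => // xz.
  case: ifP => // xw; apply/negbTE/negP => yw; by apply: (pB _ _ _ _ xB yB zB wB) => //; apply/negbT.
by rewrite /p4 /= !nopath.
Qed.

End Codes.

Definition blocks (bs : seq nat) (s : bitseq) :=
  (count id s == 3) && all (fun i => has id (take 3 (drop i s))) bs.

(** The list comes in an experimental order, so its completeness is verified against all bit
    sequences with three members that hit the prescribed blocks of three positions. *)
Lemma pair_triples_complete : all (fun s => blocks [:: 0; 3] s ==> (s \in map (bits 8) pair_triples)) (bitseqs 8).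
Proof. by vm_compute. Qed.

Lemma transversals_complete : all (fun s => blocks [:: 0; 3; 6] s ==> (s \in map (bits 9) transversals)) (bitseqs 9).
Proof. by vm_compute. Qed.

Lemma run_pair_triples : run 8 18 pair_triples. Proof. by vm_compute. Qed.
Lemma run_transversals : run 9 11 transversals. Proof. by vm_compute. Qed.

Section Cross.
Variable T : finType.
Implicit Types (b e f R : {set T}) (B : {set {set T}}).

Lemma has_block (vs vs1 vs2 : seq T) e i n b : vs = vs1 ++ enum e ++ vs2 -> size vs1 = i ->
  #|e| = 3 -> meet b e -> has id (take 3 (drop i (code vs n b))).
Proof.
move=> -> <- e3 /meetP[x xb xe]; rewrite /code !map_cat -!catA.
rewrite drop_size_cat ?size_map // take_size_cat ?size_map -?cardE //.
by apply/hasP; exists true => //; apply/mapP; exists x; rewrite ?mem_enum.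
Qed.

Lemma enum_cat_uniq e f : [disjoint e & f] -> uniq (enum e ++ enum f).
Proof.
move=> ef; rewrite cat_uniq !enum_uniq andbT; apply/hasPn => x; rewrite !mem_enum => xf.
by apply/negP => xe; move/pred0P: ef => /(_ x) /=; rewrite xe xf.
Qed.

Lemma cross_pair_triples e f R B : #|e| = 3 -> #|f| = 3 -> [disjoint e & f] -> [disjoint e :|: f & R] ->
    #|R| <= 2 -> p4free B ->
  (forall b, b \in B -> [/\ #|b| = 3, b \subset e :|: f :|: R, meet b e & meet b f]) -> #|B| <= 18.
Proof.
move=> e3 f3 ef efR R2 pB B_ok; pose vs := enum e ++ enum f ++ enum R.
have efR' : [disjoint f & R] by apply: disjointWl efR; exact: subsetUr.
have eR : [disjoint e & f :|: R].
  rewrite disjoint_sym disjoints_subset subUset -!disjoints_subset disjoint_sym ef.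
  by rewrite disjoint_sym; apply: disjointWl efR; exact: subsetUl.
have uvs : uniq vs.
  rewrite /vs cat_uniq enum_uniq enum_cat_uniq // andbT; apply/hasPn => x.
  rewrite mem_cat !mem_enum => x_fR; apply/negP => xe.
  by move/pred0P: eR => /(_ x) /=; rewrite xe inE x_fR.
have svs : size vs <= 8 by rewrite !size_cat -!cardE e3 f3.
apply: (run_bound uvs run_pair_triples pB svs) => b bB; have [b3 bs be bf] := B_ok b bB.
have b_vs : {subset b <= vs}.
  by move=> x /(subsetP bs); rewrite !inE !mem_cat !mem_enum orbA.
split=> //; have sc := size_code b svs.
have mb : code vs 8 b \in bitseqs 8 by have := mem_bitseqs (code vs 8 b); rewrite sc.
have /allP/(_ _ mb) := pair_triples_complete.
move/implyP; apply; rewrite /blocks count_code // b3 eqxx /= andbT.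
rewrite (@has_block vs [::] (enum f ++ enum R) e 0) //=.
by rewrite (@has_block vs (enum e) (enum R) f 3) // -cardE.
Qed.

Lemma cross_transversals e f R B : #|e| = 3 -> #|f| = 3 -> #|R| = 3 -> [disjoint e & f] ->
    [disjoint e :|: f & R] -> p4free B ->
  (forall b, b \in B -> [/\ #|b| = 3, b \subset e :|: f :|: R, meet b e, meet b f & meet b R]) ->
  #|B| <= 11.
Proof.
move=> e3 f3 R3 ef efR pB B_ok; pose vs := enum e ++ enum f ++ enum R.
have efR' : [disjoint f & R] by apply: disjointWl efR; exact: subsetUr.
have eR : [disjoint e & f :|: R].
  rewrite disjoint_sym disjoints_subset subUset -!disjoints_subset disjoint_sym ef.
  by rewrite disjoint_sym; apply: disjointWl efR; exact: subsetUl.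
have uvs : uniq vs.
  rewrite /vs cat_uniq enum_uniq enum_cat_uniq // andbT; apply/hasPn => x.
  rewrite mem_cat !mem_enum => x_fR; apply/negP => xe.
  by move/pred0P: eR => /(_ x) /=; rewrite xe inE x_fR.
have svs : size vs <= 9 by rewrite !size_cat -!cardE e3 f3 R3.
apply: (run_bound uvs run_transversals pB svs) => b bB; have [b3 bs be bf bR] := B_ok b bB.
have b_vs : {subset b <= vs}.
  by move=> x /(subsetP bs); rewrite !inE !mem_cat !mem_enum orbA.
split=> //; have sc := size_code b svs.
have mb : code vs 9 b \in bitseqs 9 by have := mem_bitseqs (code vs 9 b); rewrite sc.
have /allP/(_ _ mb) := transversals_complete.
move/implyP; apply; rewrite /blocks count_code // b3 eqxx /= andbT.
rewrite (@has_block vs [::] (enum f ++ enum R) e 0) //=.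
rewrite (@has_block vs (enum e) (enum R) f 3) -?cardE //=.
rewrite (@has_block vs (enum e ++ enum f) [::] R) // ?cats0 -?catA //.
by rewrite size_cat -!cardE e3 f3.
Qed.

End Cross.

(* [common cs acc]: some position of [acc] belongs to all members of [cs]. *)
Fixpoint common (cs : seq bitseq) (acc : bitseq) : bool :=
  match cs with
  | c :: cs' => common cs' [seq p.1 && p.2 | p <- zip acc c]
  | [::] => has id acc
  end.

(* Branches over the pairs of [ps]; [cs] are the triples meeting the [p] pairs chosen so far. *)
Fixpoint covers (ps cs : seq bitseq) (p : nat) : bool :=
  if size cs + minn (3 * (p + size ps)) 21 <= 25 then true else
  if common cs (nseq 6 true) then true else
  match ps with
  | q :: ps' => if covers ps' cs p then covers ps' (filter (meets q) cs) p.+1 else false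
  | [::] => false
  end.

Lemma covers6 : covers [seq s <- bitseqs 6 | count id s == 2] [seq s <- bitseqs 6 | count id s == 3] 0.
Proof. by vm_compute. Qed.

Lemma size_bitseqs n s : s \in bitseqs n -> size s = n.
Proof.
elim: n s => [|n IH] s /=; first by rewrite inE => /eqP->.
by rewrite mem_cat => /orP[] /mapP[t /IH <- ->].
Qed.

Lemma commonP cs acc : common cs acc -> (forall c, c \in cs -> size c = size acc) ->
  exists i, [/\ i < size acc, nth false acc i & forall c, c \in cs -> nth false c i].
Proof.
elim: cs acc => [|c cs IH] acc /=.
  move=> /(has_nthP false)[i lt_i acci] _; by exists i.
move=> /IH{}IH sz; have sc : size c = size acc by apply: sz; rewrite inE eqxx.
have szz : size (zip acc c) = size acc by rewrite size_zip sc minnn.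
case: IH => [d dcs|i [lt_i nth_i cs_i]].
  by rewrite size_map szz sz // inE dcs orbT.
rewrite size_map szz in lt_i; move: nth_i; rewrite (nth_map (false, false)) ?szz // nth_zip //=.
case/andP => acci ci; exists i; split=> // d; rewrite inE => /orP[/eqP->//|]; exact: cs_i.
Qed.

(** [C] stays inside the candidates [cs], so a position common to all of [cs] would be common to
    [C], which is excluded; the search may stop there. The other stopping rule bounds the pairs
    still to be chosen by [size ps]. *)
Lemma coversP (P : pred bitseq) (C : seq bitseq) ps cs p : uniq C ->
    (forall c q, c \in C -> P q -> meets q c) -> (forall i, i < 6 -> has (fun c => ~~ nth false c i) C) ->
  (forall c, c \in cs -> size c = 6) -> {subset C <= cs} -> covers ps cs p ->
  size C + minn (3 * (p + count P ps)) 21 <= 25.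
Proof.
move=> uC CP C0.
have no_common ds : (forall c, c \in ds -> size c = 6) -> {subset C <= ds} ->
    common ds (nseq 6 true) = false.
  move=> cs6 Ccs; apply/negP => /commonP[c /cs6|i [lt_i _ cs_i]]; first by rewrite size_nseq.
  by rewrite size_nseq in lt_i; have /hasP[c /Ccs /cs_i ->] := C0 i lt_i.
elim: ps cs p => [|q ps IH] cs p cs6 Ccs; rewrite [covers _ _ _]/= no_common //.
  by case: ifP => // le _; have := uniq_leq_size uC Ccs; move: le; rewrite /=; lia.
case: ifP => [le _|_].
  have := uniq_leq_size uC Ccs; have := count_size P (q :: ps); move: le; rewrite /=; lia.
case: ifP => // out_ok in_ok; rewrite [count _ _]/=; case: (boolP (P q)) => Pq; last first.
  by rewrite add0n; exact: (IH cs).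
rewrite add1n -addSnnS; apply: IH in_ok => [c|c cC]; first by rewrite mem_filter => /andP[_ /cs6].
by rewrite mem_filter CP ?Ccs.
Qed.

Section CoverSix.
Variable T : finType.
Implicit Types (A c : {set T}) (C P : {set {set T}}).

(** The constants belong to nine vertices with a single edge opposite [C]: the rest then has at most
    [3 * #|P|] and at most [3 * 9 - 6 = 21] edges, and [25 + 1] stays below [5 * 9 - 18 = 27]. *)
Lemma cover_six A C P : #|A| = 6 -> C \subset ksub A 3 -> P \subset ksub A 2 ->
    (forall c q, c \in C -> q \in P -> meet c q) -> (forall x, exists2 c, c \in C & x \notin c) ->
  #|C| + minn (3 * #|P|) 21 <= 25.
Proof.
move=> A6 CA PA CP C0; pose vs := enum A.
have uvs : uniq vs by exact: enum_uniq.
have svs : size vs = 6 by rewrite -cardE.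
have sub_vs k (D : {set {set T}}) b : D \subset ksub A k -> b \in D -> {subset b <= vs} /\ #|b| = k.
  move=> /subsetP DA /DA /ksubP[/subsetP bA bk]; split=> // x /bA; by rewrite mem_enum.
have size6 b : size (code vs 6 b) = 6 by apply: size_code; rewrite svs.
have mem6 k (D : {set {set T}}) b : D \subset ksub A k -> b \in D ->
    code vs 6 b \in [seq s <- bitseqs 6 | count id s == k].
  move=> DA bD; have [b_vs bk] := sub_vs k D b DA bD.
  rewrite mem_filter count_code // bk eqxx /=.
  by have := mem_bitseqs (code vs 6 b); rewrite size6.
pose PS s := (s \in map (code vs 6) (enum P)).
have C_vs b : b \in C -> {subset b <= vs} by move/(sub_vs 3 C _ CA) => [].
have P_vs b : b \in P -> {subset b <= vs} by move/(sub_vs 2 P _ PA) => [].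
have := @coversP PS (map (code vs 6) (enum C)) [seq s <- bitseqs 6 | count id s == 2]
   [seq s <- bitseqs 6 | count id s == 3] 0.
rewrite size_map -cardE add0n => le.
apply: (leq_trans (n := #|C| + minn (3 * count PS [seq s <- bitseqs 6 | count id s == 2]) 21)).
  rewrite leq_add2l leq_min geq_minr andbT; apply: leq_trans (geq_minl _ _) _.
  apply: leq_mul => //; apply: (card_code (n := 6) P_vs) => b bP.
  by rewrite (mem6 2 P) // andbT; apply/mapP; exists b; rewrite ?mem_enum.
apply: le covers6.
- by rewrite map_inj_in_uniq ?enum_uniq // => b c; rewrite !mem_enum; apply: code_inj.
- move=> c q /mapP[b]; rewrite mem_enum => bC -> /mapP[d]; rewrite mem_enum => dP ->.
  rewrite (meets_decode uvs) ?short_code // !codeK; [|exact: C_vs|exact: P_vs].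
  by rewrite meetC; exact: CP.
- move=> i lt_i; have [x0 _] : exists x, x \in A by apply/set0Pn; rewrite -card_gt0 A6.
  have [c cC xc] := C0 (nth x0 vs i); apply/hasP; exists (code vs 6 c).
    by apply/mapP; exists c; rewrite ?mem_enum.
  by rewrite nth_cat size_map svs lt_i (nth_map x0) ?svs.
- by move=> c; rewrite mem_filter => /andP[_ /size_bitseqs].
- by move=> s /mapP[b]; rewrite mem_enum => bC ->; exact: mem6 bC.
Qed.

End CoverSix.

(** * Triples meeting two disjoint triples *)

Section CrossBound.
Variable T : finType.
Implicit Types (A V R b e f : {set T}) (B E : {set {set T}}).

Lemma set0_ksub V k : 0 < k -> set0 \notin ksub V k.
Proof. by rewrite inE cards0 eq_sym; case: k => // k _; rewrite andbF. Qed.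

Definition at_ E x := [set e in E | x \in e].
Definition off_ E x := [set e in E | x \notin e].

Lemma card_at_off E x : #|at_ E x| + #|off_ E x| = #|E|.
Proof.
rewrite -(cardsID [set e : {set T} | x \in e] E).
by congr (_ + _); apply: eq_card => e; rewrite !inE // andbC.
Qed.

Lemma ksub_setD1 V x k e : e \in ksub V k -> x \notin e -> e \in ksub (V :\ x) k.
Proof. by rewrite !inE => /andP[eV ->] xe; rewrite subsetD1 eV xe. Qed.

Lemma cross_bound8 V e f B : e \in ksub V 3 -> f \in ksub V 3 -> ~~ meet e f -> #|V| <= 8 ->
  B \subset ksub V 3 -> p4free B -> (forall b, b \in B -> meet b e /\ meet b f) -> #|B| <= 18.
Proof.
move=> /ksubP[eV e3] /ksubP[fV f3] ef V8 /subsetP BV pB B_ef.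
have def : [disjoint e & f] by rewrite -setI_eq0 -[_ == _]negbK.
have efV : e :|: f \subset V by rewrite subUset eV.
have VE : e :|: f :|: V :\: (e :|: f) = V by rewrite -{1}(setIidPr efV) setID.
apply: (@cross_pair_triples _ e f (V :\: (e :|: f))) => //.
- by apply/pred0P => x; rewrite /= !inE; case: (x \in e); case: (x \in f).
- by rewrite cardsD (setIidPr efV) cardsU disjoint_setI0 // cards0 e3 f3 subn0; move: V8; card_lia.
by move=> b bB; have /ksubP[bV b3] := BV b bB; have [be bf] := B_ef b bB; rewrite VE.
Qed.

(* Of three vertices outside [e :|: f] one lies on at most three edges of [B], since the edges
   through them form a family of transversals; delete that vertex. *)
Lemma cross_bound V e f B : e \in ksub V 3 -> f \in ksub V 3 -> ~~ meet e f -> 8 <= #|V| ->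
  B \subset ksub V 3 -> p4free B -> (forall b, b \in B -> meet b e /\ meet b f) ->
  #|B| + 6 <= 3 * #|V|.
Proof.
move: {2}#|V| (erefl #|V|) => n; elim: n V B => [|n IH] V B Vn; first by rewrite Vn.
move=> eV fV ef V8 BV pB B_ef.
have [V8'|V9] := leqP #|V| 8.
  by have := cross_bound8 eV fV ef V8' BV pB B_ef; move: V8; card_lia.
have [[esV e3] [fsV f3]] := (ksubP _ _ _ eV, ksubP _ _ _ fV).
have def : [disjoint e & f] by rewrite -setI_eq0 -[_ == _]negbK.
pose R := V :\: (e :|: f).
have cR : 3 <= #|R|.
  by rewrite cardsD; have := subset_leq_card (subsetIr V (e :|: f));
     rewrite [in X in _ <= X]cardsU e3 f3; move: V9; card_lia.
have [r1 r1R] : exists r, r \in R by apply/set0Pn; rewrite -card_gt0; move: cR; card_lia.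
have [r2 r2R] : exists r, r \in R :\ r1.
  by apply/set0Pn; rewrite -card_gt0; move: cR; rewrite (cardsD1 r1) r1R; card_lia.
have [r3 r3R] : exists r, r \in R :\ r1 :\ r2.
  apply/set0Pn; rewrite -card_gt0; move: cR.
  by rewrite (cardsD1 r1) r1R (cardsD1 r2 (R :\ r1)) r2R; card_lia.
move: r2R r3R; rewrite !in_setD1 => /andP[r21 r2R] /and3P[r32 r31 r3R].
have offef r : r \in R -> [/\ r \in V, r \notin e & r \notin f].
  by rewrite !inE negb_or => /andP[/andP[-> ->] ->].
(* An edge through [r] and [s] would have four vertices: these two, one in [e] and one in [f]. *)
have disj r s : r \in R -> s \in R -> r != s -> [disjoint at_ B r & at_ B s].
  move=> /offef[rV re rf] /offef[sV se sf] rs; rewrite -setI_eq0; apply/eqP/setP => b.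
  rewrite !inE; apply/negP => /andP[/andP[bB rb] /andP[_ sb]].
  have [/meetP[u ub ue] /meetP[v vb vf]] := B_ef b bB.
  have /ksubP[_ b3] := subsetP BV b bB.
  have : [set u; v; r; s] \subset b by rewrite !subUset !sub1set ub vb rb sb.
  move/subset_leq_card; rewrite b3 -!setUA !cardsU1 cards1 !inE (negPf rs).
  have -> : (u == v) = false by apply/negP => /eqP uv; move/pred0P: def => /(_ u) /=; rewrite ue uv vf.
  have -> : (u == r) = false by apply/negP => /eqP ur; rewrite -ur ue in re.
  have -> : (u == s) = false by apply/negP => /eqP us; rewrite -us ue in se.
  have -> : (v == r) = false by apply/negP => /eqP vr; rewrite -vr vf in rf.
  by have -> : (v == s) = false by apply/negP => /eqP vs; rewrite -vs vf in sf.
have le11 : #|at_ B r1| + #|at_ B r2| + #|at_ B r3| <= 11.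
  have d12 := disj r1 r2 r1R r2R ltac:(by rewrite eq_sym).
  have d3 : [disjoint at_ B r1 :|: at_ B r2 & at_ B r3].
    rewrite -setI_eq0 setIUl setU_eq0 !setI_eq0 !disj // eq_sym //.
  have cU : #|at_ B r1| + #|at_ B r2| + #|at_ B r3| = #|at_ B r1 :|: at_ B r2 :|: at_ B r3|.
    by rewrite [RHS]cardsU (disjoint_setI0 d3) cardsU (disjoint_setI0 d12) !cards0 !subn0.
  rewrite cU; apply: (@cross_transversals _ e f [set r1; r2; r3]) => //.
  - by rewrite -setUA !cardsU1 cards1 !inE eq_sym (negPf r21) eq_sym (negPf r31) eq_sym (negPf r32).
  - rewrite -setI_eq0; apply/eqP/setP => x; rewrite !inE; apply/negP => /andP[xef].
    by case/orP=> [/orP[]|] /eqP xr; move: xef; rewrite xr; [move: r1R|move: r2R|move: r3R];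
      rewrite !inE => /andP[/negPf->].
  - by apply: p4freeS pB; apply/subsetP => b; rewrite !inE -!andb_orr => /andP[].
  move=> b; rewrite !inE -!andb_orr => /andP[bB rb].
  have [[be bf] /ksubP[bV b3]] := (B_ef b bB, subsetP BV b bB).
  have [r [rb' rR rR3]] : exists r, [/\ r \in b, r \in R & r \in [set r1; r2; r3]].
    by case/orP: rb => [/orP[]|] rb'; [exists r1|exists r2|exists r3]; split=> //; rewrite !inE eqxx ?orbT.
  split=> //; last by apply/meetP; exists r.
  have [/meetP[u ub ue] /meetP[v vb vf]] := (be, bf).
  have [_ re rf] := offef r rR.
  have uvr : [set u; v; r] \subset b by rewrite !subUset !sub1set ub vb rb'.
  have := subset_leqif_cards uvr; rewrite b3 -setUA !cardsU1 cards1 !inE.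
  have -> : (u == v) = false by apply/negP => /eqP uv; move/pred0P: def => /(_ u) /=; rewrite ue uv vf.
  have -> : (u == r) = false by apply/negP => /eqP ur; rewrite -ur ue in re.
  have -> : (v == r) = false by apply/negP => /eqP vr; rewrite -vr vf in rf.
  case=> _; rewrite eqxx => /esym/eqP bE; apply/subsetP => x; rewrite -bE !inE.
  by case/or3P => /eqP->; rewrite ?ue ?vf ?orbT //; move: rR3; rewrite !inE => ->; rewrite orbT.
have [r rR le3] : exists2 r, r \in R & #|at_ B r| <= 3.
  have [h1|h1] := leqP #|at_ B r1| 3; first by exists r1.
  have [h2|h2] := leqP #|at_ B r2| 3; first by exists r2.
  by exists r3 => //; move: h1 h2 le11; card_lia.
have [rV re rf] := offef r rR.
have cV : #|V| = #|V :\ r|.+1 by rewrite (cardsD1 r) rV.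
have := IH (V :\ r) (off_ B r) _ (ksub_setD1 eV re) (ksub_setD1 fV rf) ef.
rewrite -(card_at_off B r) => le.
suff : #|off_ B r| + 6 <= 3 * #|V :\ r| by move: cV le3; card_lia.
apply: le.
- by move: Vn; rewrite cV => -[].
- by move: V9; rewrite cV.
- by apply/subsetP => b; rewrite inE => /andP[/(subsetP BV) bV rb]; exact: ksub_setD1.
- by apply: p4freeS pB; apply/subsetP => b; rewrite inE => /andP[].
- by move=> b; rewrite inE => /andP[/B_ef].
Qed.

End CrossBound.

(** * Links, degrees and inclusion-exclusion *)

Section Counting.
Variable T : finType.
Implicit Types (x y s t u v : T) (S V W : {set T}) (b c e f g h l p q : {set T}) (B C D E G L P Q : {set {set T}}).

Definition link E x := [set g : {set T} | x \notin g & x |: g \in E].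

Lemma card_link E x : #|link E x| = #|at_ E x|.
Proof.
have inj : {in link E x &, injective (fun g => x |: g)}.
  by move=> g h; rewrite !inE => /andP[xg _] /andP[xh _] /= /(congr1 (fun e => e :\ x)); rewrite !setU1K.
rewrite -(card_in_imset inj); apply: eq_card => e; rewrite !inE.
apply/imsetP/andP => [[g]|[eE xe]]; first by rewrite !inE => /andP[_ gE] ->; rewrite gE setU11.
by exists (e :\ x); rewrite ?inE ?setD1K // eqxx.
Qed.

Lemma link_ksub E V k x : E \subset ksub V k.+1 -> link E x \subset ksub (V :\ x) k.
Proof.
move=> /subsetP EV; apply/subsetP => g; rewrite inE => /andP[xg /EV/ksubP[gV]].
rewrite cardsU1 xg => -[gk]; apply/ksubP; split=> //.
by rewrite subsetD1 xg (subset_trans _ gV) // subsetUr.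
Qed.

Lemma missE W S k : [set g in ksub W k | ~~ meet g S] = ksub (W :\: S) k.
Proof.
apply/setP => g; rewrite !inE subsetD /meet negbK setI_eq0.
by case: (g \subset W); case: (#|g| == k); case: [disjoint g & S].
Qed.

Lemma meetU g e f : meet g (e :|: f) = meet g e || meet g f.
Proof. by rewrite /meet setIUr setU_eq0 negb_and. Qed.

Lemma card_hit W S k :
  #|[set g in ksub W k | meet g S]| + 'C(#|W :\: S|, k) = 'C(#|W|, k).
Proof.
rewrite -!card_ksub -missE -(cardsID [set g | meet g S] (ksub W k)).
by congr (_ + _); apply: eq_card => g; rewrite !inE // andbC.
Qed.

Lemma card_hit2 W e f k :
  #|[set g in ksub W k | meet g e & meet g f]| + 'C(#|W :\: e|, k) + 'C(#|W :\: f|, k)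
  = 'C(#|W|, k) + 'C(#|W :\: (e :|: f)|, k).
Proof.
have := card_hit W (e :|: f) k; have := card_hit W e k; have := card_hit W f k.
set He := [set g in ksub W k | meet g e]; set Hf := [set g in ksub W k | meet g f].
have -> : [set g in ksub W k | meet g (e :|: f)] = He :|: Hf.
  by apply/setP => g; rewrite !inE meetU andb_orr.
have -> : [set g in ksub W k | meet g e & meet g f] = He :&: Hf.
  apply/setP => g; rewrite !inE.
  by case: (g \subset W); case: (#|g| == k); case: (meet g e); case: (meet g f).
by have := cardsUI He Hf; card_lia.
Qed.

(** A pair through [u] is determined by its other vertex, which has to lie in [S]. *)
Lemma at_le P u S : (forall p, p \in P -> #|p| = 2) ->
  (forall p, p \in P -> u \in p -> meet (p :\ u) S) -> #|at_ P u| <= #|S|.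
Proof.
move=> P2 PS; apply: leq_trans (leq_imset_card (fun s => [set u; s]) S).
apply/subset_leq_card/subsetP => p; rewrite inE => /andP[pP up].
have /meetP[s] := PS p pP up; rewrite !inE => /andP[su sp] sS; apply/imsetP; exists s => //.
apply/esym/eqP; rewrite eqEcard subUset !sub1set up sp P2 //=.
by rewrite cards2 eq_sym su.
Qed.

Lemma at2_le D s t S : s != t -> (forall e, e \in D -> [/\ #|e| = 3, s \in e, t \in e & meet (e :\: [set s; t]) S]) ->
  #|D| <= #|S|.
Proof.
move=> st DS; apply: leq_trans (leq_imset_card (fun v => [set s; t; v]) S).
apply/subset_leq_card/subsetP => e /DS[e3 se te /meetP[v]]; rewrite !inE negb_or.
move=> /andP[/andP[vs vt] ve] vS; apply/imsetP; exists v => //.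
apply/esym/eqP; rewrite eqEcard !subUset !sub1set se te ve e3 /=.
by rewrite -setUA !cardsU1 cards1 !inE (negPf st) eq_sym (negPf vs) eq_sym (negPf vt).
Qed.

Lemma hit_le P c k : (forall p, p \in P -> meet p c) -> (forall u, u \in c -> #|at_ P u| <= k) ->
  #|P| <= #|c| * k.
Proof.
move=> Pc ck; apply: (@leq_trans (\sum_(u in c) #|at_ P u|)); last first.
  by rewrite -sum_nat_const; apply: leq_sum.
rewrite -sum1_card (eq_bigr (fun u => \sum_(p in P) (u \in p : nat))); last first.
  by move=> u _; rewrite -sum1_card -big_mkcondr /=; apply: eq_bigl => p; rewrite inE.
rewrite exchange_big /=; apply: leq_sum => p /Pc/meetP[u up uc].
by rewrite (bigD1 u) //= up.
Qed.

Lemma card2P p : #|p| = 2 -> exists s t, s != t /\ p = [set s; t].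
Proof. by move/eqP/cards2P => [s [t]]; exists s, t. Qed.

Lemma meet2 p s t : meet p [set s; t] = (s \in p) || (t \in p).
Proof.
have meet1 x : meet p [set x] = (x \in p).
  by apply/meetP/idP => [[y yp /set1P<-]|xp] //; exists x; rewrite ?set11.
by rewrite meetU !meet1.
Qed.

Lemma meet_setD1 p l u : meet p l -> u \notin l -> meet (p :\ u) l.
Proof.
move=> /meetP[x xp xl] ul; apply/meetP; exists x => //; rewrite !inE xp andbT.
by apply: contraNneq ul => <-.
Qed.

Lemma meet_at_le P u l : (forall p, p \in P -> #|p| = 2) -> (forall p, p \in P -> meet p l) ->
  u \notin l -> #|at_ P u| <= #|l|.
Proof. by move=> P2 Pl ul; apply: at_le => // p pP _; apply: meet_setD1; rewrite ?Pl. Qed.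

End Counting.

(** Vandermonde's identity for pairs. It reduces binomials with shifted arguments to one base, after
    which the comparisons are plain arithmetic. *)
Lemma bin2_add j k : 'C(j + k, 2) = 'C(k, 2) + j * k + 'C(j, 2).
Proof. by elim: j => [|j IH]; rewrite ?addn0 // addSn !binS !bin1 IH; lia. Qed.

Lemma bin2_sub w j : j <= w -> 'C(w, 2) = 'C(w - j, 2) + j * (w - j) + (j * j.-1)./2.
Proof. by move=> jw; rewrite -bin2 -bin2_add subnKC. Qed.

(** * Cross-intersecting families of pairs and triples *)

Section CrossPairs.
Variable T : finType.
Implicit Types (x y s t u v : T) (S V W : {set T}) (b c e f g h l p q : {set T}) (B C D E G L P Q : {set {set T}}).

Definition cross L Q := forall l q, l \in L -> q \in Q -> meet l q.

Lemma crossC L Q : cross L Q -> cross Q L.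
Proof. by move=> LQ q l qQ lL; rewrite meetC; exact: LQ. Qed.

Definition kernel_free L := forall x, exists2 l, l \in L & x \notin l.

Definition pairwise2 L := forall l, l \in L -> #|l| = 2.

Lemma pair_cap l1 l2 : #|l1| = 2 -> #|l2| = 2 -> l1 != l2 -> #|l1 :&: l2| <= 1.
Proof.
move=> c1 c2; rewrite leqNgt; apply: contra => gt1.
have /eqP e : l1 :&: l2 == l1 by rewrite eqEcard subsetIl c1.
by rewrite eqEcard -{1}e subsetIr c1 c2.
Qed.

(** If [l1] and [l2] are disjoint, only the four pairs joining them meet both. If they share a
    vertex, the pairs meeting both are the [#|W| - 1] pairs through it and the pair of the two other
    ends. *)
Lemma cover2 W Q l1 l2 : l1 \in ksub W 2 -> l2 \in ksub W 2 -> l1 != l2 -> Q \subset ksub W 2 ->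
  (forall q, q \in Q -> meet q l1 && meet q l2) -> #|Q| <= maxn 4 #|W|.
Proof.
move=> /ksubP[l1W c1] /ksubP[l2W c2] l12 /subsetP QW Ql.
have leQ : #|Q| <= #|[set g in ksub W 2 | meet g l1 & meet g l2]|.
  by apply/subset_leq_card/subsetP => q qQ; rewrite inE QW ?Ql.
have c12 : #|l1 :|: l2| + #|l1 :&: l2| = 4 by rewrite cardsUI c1 c2.
have c12' : #|l1 :&: l2| <= 1 by exact: pair_cap.
have cW : #|l1 :|: l2| <= #|W| by rewrite subset_leq_card // subUset l1W.
have := card_hit2 W l1 l2 2; rewrite !cardsD (setIidPr l1W) (setIidPr l2W).
rewrite (_ : W :&: (l1 :|: l2) = l1 :|: l2); last by apply/setIidPr; rewrite subUset l1W.
rewrite c1 c2; move: leQ c12 c12' cW; move: #|_| => hit; case: (#|l1 :&: l2|) => [|[|//]].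
  rewrite addn0 => leQ -> _ cW; have := bin2_sub cW.
  by have := @bin2_sub #|W| 2 (ltac:(move: cW; card_lia)); move: leQ cW; card_lia.
rewrite addn1 => leQ [] -> _ cW; have := bin2_sub cW.
by have := @bin2_sub #|W| 2 (ltac:(move: cW; card_lia)); move: leQ cW; card_lia.
Qed.

Lemma cover1 W Q l : l \in ksub W 2 -> Q \subset ksub W 2 -> (forall q, q \in Q -> meet q l) ->
  #|Q| + 3 <= 2 * #|W|.
Proof.
move=> /ksubP[lW cl] /subsetP QW Ql.
have leQ : #|Q| <= #|[set g in ksub W 2 | meet g l]|.
  by apply/subset_leq_card/subsetP => q qQ; rewrite inE QW ?Ql.
have cW : 2 <= #|W| by rewrite -cl subset_leq_card.
have := card_hit W l 2; rewrite cardsD (setIidPr lW) cl; have := bin2_sub cW.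
by move: leQ cW; card_lia.
Qed.

Lemma at_pair_le Q s t : (forall q, q \in Q -> meet q [set s; t]) -> #|Q| <= #|at_ Q s| + #|at_ Q t|.
Proof.
move=> Qab; apply: leq_trans (leq_card_setU _ _); apply/subset_leq_card/subsetP => q qQ.
by rewrite !inE qQ /= -meet2 Qab.
Qed.

(** All pairs of [Q] pass through an end of a fixed [l = [set a; b]] in [L]. Some member of [L]
    misses [a], so at most two pairs of [Q] pass through [a]; likewise for [b]. *)
Lemma cross_le4 L Q : pairwise2 L -> pairwise2 Q -> cross L Q -> kernel_free L -> #|Q| <= 4.
Proof.
move=> L2 Q2 /crossC LQ L0; case: (set_0Vmem L) => [L_0|[l lL]].
  case: (set_0Vmem Q) => [->|[q qQ]]; first by rewrite cards0.
  have /card2P[s _] := Q2 q qQ; have [l] := L0 s; by rewrite L_0 inE.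
have /card2P[a [b [ab lE]]] := L2 l lL.
have [la laL al] := L0 a; have [lb lbL bl] := L0 b.
have := @at_pair_le Q a b _; rewrite -lE => /(_ (fun q qQ => LQ _ _ qQ lL)) le.
have := @meet_at_le _ Q a la Q2 (fun q qQ => LQ _ _ qQ laL) al.
have := @meet_at_le _ Q b lb Q2 (fun q qQ => LQ _ _ qQ lbL) bl.
by rewrite !L2 //; move: le; card_lia.
Qed.

Lemma cross_kernel L Q x : pairwise2 Q -> cross L Q -> kernel_free L ->
  pairwise2 L -> (forall q, q \in Q -> x \in q) -> #|Q| <= 2.
Proof.
move=> Q2 /crossC LQ L0 L2 Qx; have [l lL xl] := L0 x.
have <- : at_ Q x = Q by apply/setP => q; rewrite inE; case: (boolP (q \in Q)) => // /Qx.
by rewrite -(L2 l lL); apply: meet_at_le => // q qQ; exact: LQ.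
Qed.

Lemma card1_inj (A : {set T}) : #|A| = 1 -> {in A &, forall x y : T, x = y}.
Proof. by move/eqP/cards1P => [z ->] x y; rewrite !inE => /eqP-> /eqP->. Qed.

(** A vertex of [l1] on neither [l2] nor [l3] lies in at most one pair of [Q], as the other end must
    belong to both; any other vertex of [l1] lies in at most two. This leaves the case where each
    end of [l1] lies on exactly one of [l2] and [l3]. *)
Lemma cover3 Q l1 l2 l3 : #|l1| = 2 -> #|l2| = 2 -> #|l3| = 2 -> l1 != l2 -> l1 != l3 -> l2 != l3 ->
  (forall x, ~~ [&& x \in l1, x \in l2 & x \in l3]) -> pairwise2 Q ->
  (forall q, q \in Q -> [&& meet q l1, meet q l2 & meet q l3]) -> #|Q| <= 3.
Proof.
move=> c1 c2 c3 n12 n13 n23 no_x Q2 Ql; have /card2P[a [b [ab l1E]]] := c1.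
have Q1 q : q \in Q -> meet q l1 by move/Ql/and3P => [].
have Ql2 q : q \in Q -> meet q l2 by move/Ql/and3P => [].
have Ql3 q : q \in Q -> meet q l3 by move/Ql/and3P => [].
have leQ : #|Q| <= #|at_ Q a| + #|at_ Q b| by apply: at_pair_le; rewrite -l1E.
have le2 x : x \in l1 -> #|at_ Q x| <= 2.
  move=> x1; have := no_x x; rewrite x1 /= negb_and => /orP[] xl.
    by rewrite -c2; exact: meet_at_le xl.
  by rewrite -c3; exact: meet_at_le xl.
have le1 x : x \notin l2 -> x \notin l3 -> #|at_ Q x| <= 1.
  move=> x2 x3; apply: (@leq_trans #|l2 :&: l3|).
    apply: at_le => // q qQ xq; have /card1_inj q1 : #|q :\ x| = 1.
      by have := cardsD1 x q; rewrite xq Q2 // => -[].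
    have /meetP[y yq y2] := meet_setD1 (Ql2 q qQ) x2.
    have /meetP[z zq z3] := meet_setD1 (Ql3 q qQ) x3.
    by apply/meetP; exists y; rewrite // inE y2 (q1 y z yq zq).
  exact: pair_cap.
have al : a \in l1 by rewrite l1E !inE eqxx.
have bl : b \in l1 by rewrite l1E !inE eqxx orbT.
have [leA leB] := (le2 a al, le2 b bl).
case: (boolP ((a \notin l2) && (a \notin l3))) => [/andP[a2 a3]|Na].
  by have := le1 a a2 a3; move: leQ leB; card_lia.
case: (boolP ((b \notin l2) && (b \notin l3))) => [/andP[b2 b3]|Nb].
  by have := le1 b b2 b3; move: leQ leA; card_lia.
have not_l1 l : #|l| = 2 -> l1 != l -> ~~ ((a \in l) && (b \in l)).
  move=> cl; apply: contra => /andP[al' bl']; rewrite eqEcard c1 cl leqnn andbT l1E.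
  by rewrite subUset !sub1set al'.
have [nab2 nab3] := (not_l1 l2 c2 n12, not_l1 l3 c3 n13).
have [na nb] := (no_x a, no_x b); rewrite al bl /= in na nb.
(* [a] and [b] lie on different pairs, say [l] and [l'], so the second vertex of a cover through [b]
   avoiding [a] is the only element of [l :\ a]. *)
have main l l' : #|l| = 2 -> #|l'| = 2 -> (forall q, q \in Q -> meet q l) ->
    a \in l -> b \notin l -> #|Q| <= 3.
  move=> cl cl' Qlm alm blm; apply: leq_trans (_ : #|at_ Q a| + #|at_ (off_ Q a) b| <= 3).
    rewrite -(card_at_off Q a) leq_add2l; apply/subset_leq_card/subsetP => q.
    rewrite !inE => /andP[qQ aq]; rewrite qQ aq /=.
    by have := Q1 q qQ; rewrite l1E meet2 (negPf aq).
  have : #|at_ (off_ Q a) b| <= #|l :\ a|.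
    apply: at_le => [q|q]; first by rewrite inE => /andP[/Q2].
    rewrite inE => /andP[qQ aq] bq; have /meetP[y yq yl] := meet_setD1 (Qlm q qQ) blm.
    apply/meetP; exists y => //; rewrite !inE yl andbT; apply: contraNneq aq => <-.
    by move: yq; rewrite inE => /andP[].
  by have := cardsD1 a l; rewrite alm cl; move: leA; card_lia.
case: (boolP (a \in l2)) => a2.
  by apply: (main l2 l3) => //; rewrite a2 /= in nab2.
case: (boolP (a \in l3)) => a3; last by rewrite a2 a3 in Na.
by apply: (main l3 l2) => //; rewrite a3 /= in nab3.
Qed.

Lemma cross_le3 L Q : pairwise2 L -> pairwise2 Q -> cross L Q -> kernel_free L -> 3 <= #|L| -> #|Q| <= 3.
Proof.
move=> L2 Q2 /crossC LQ L0 L3.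
have [l1 l1L] : exists l, l \in L by apply/set0Pn; rewrite -card_gt0; move: L3; card_lia.
have /card2P[a [b [ab l1E]]] := L2 l1 l1L.
have [l2 l2L a2] := L0 a; have [l3 l3L b3] := L0 b.
have [[c1 c2] c3] := (L2 _ l1L, L2 _ l2L, L2 _ l3L).
have n12 : l1 != l2 by apply: contraNneq a2 => <-; rewrite l1E !inE eqxx.
have n13 : l1 != l3 by apply: contraNneq b3 => <-; rewrite l1E !inE eqxx orbT.
(* When one pair misses both [a] and [b], any third pair of [L] completes the three. *)
case: (eqVneq l2 l3) => [e23|n23]; last first.
  apply: (cover3 c1 c2 c3) => // [x|q qQ]; last by rewrite !LQ.
  by rewrite l1E !inE; apply/negP => /and3P[/orP[]/eqP-> x2 x3]; [move: a2; rewrite x2|move: b3; rewrite x3].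
subst l3; have [l lL] : exists l, l \in L :\ l1 :\ l2.
  apply/set0Pn; rewrite -card_gt0; move: L3 (cardsD1 l1 L) (cardsD1 l2 (L :\ l1)).
  by rewrite l1L in_setD1 eq_sym n12 l2L; card_lia.
move: lL; rewrite !inE => /and3P[nl2 nl1 lL].
apply: (cover3 c1 c2 (L2 l lL)) => //; [by rewrite eq_sym | by rewrite eq_sym | move=> x | move=> q qQ; by rewrite !LQ].
by rewrite l1E !inE; apply/negP => /and3P[/orP[]/eqP-> x2 x3]; [move: a2; rewrite x2|move: b3; rewrite x2].
Qed.

(** If the pairs of [Q] have no common vertex, the roles can be exchanged in [cross_le3]; if they
    have one, [Q] has at most two members. *)
Lemma cross_ge3 L Q : pairwise2 L -> pairwise2 Q -> cross L Q -> kernel_free L -> 3 <= #|Q| -> #|L| <= 3.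
Proof.
move=> L2 Q2 LQ L0 Q3; case: (boolP [forall x, [exists (q | q \in Q), x \notin q]]) => [Q0|].
  apply: (cross_le3 Q2 L2 (crossC LQ)) => // x.
  by move/forallP: Q0 => /(_ x) /exists_inP.
case/forallPn => x /exists_inPn Qx; have := @cross_kernel L Q x Q2 LQ L0 L2 _.
by rewrite leqNgt Q3 => /(_ (fun q qQ => negbNE (Qx q qQ))).
Qed.

End CrossPairs.

(** * Pairs covering a system of triples *)

Section CoverTriples.
Variable T : finType.
Implicit Types (x y s t u v : T) (S V W : {set T}) (e f g h l p q : {set T}) (E L P Q : {set {set T}}).

Lemma card3P e : #|e| = 3 -> exists x y z, [/\ x != y, x != z, y != z & e = [set x; y; z]].
Proof.
move=> e3; have [x xe] : exists x, x \in e by apply/set0Pn; rewrite -card_gt0 e3.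
have /card2P[y [z [yz ex]]] : #|e :\ x| = 2 by have := cardsD1 x e; rewrite xe e3; card_lia.
exists x, y, z; have : x \notin e :\ x by rewrite !inE eqxx.
by rewrite ex !inE negb_or => /andP[-> ->]; split=> //; rewrite -setUA -ex setD1K.
Qed.

Lemma at_bin E V k x : E \subset ksub V k.+1 -> x \in V -> #|at_ E x| <= 'C(#|V|.-1, k).
Proof.
move=> EV xV; rewrite -card_link (cardsD1 x V) xV -card_ksub.
exact/subset_leq_card/link_ksub.
Qed.

Section Covers.
Variables (V : {set T}) (C P : {set {set T}}).
Hypotheses (CV : C \subset ksub V 3) (PV : P \subset ksub V 2).
Hypotheses (CP : cross C P) (C0 : kernel_free C).

Let C3 c : c \in C -> #|c| = 3. Proof. by move/(subsetP CV)/ksubP => []. Qed.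
Let P2 p : p \in P -> #|p| = 2. Proof. by move/(subsetP PV)/ksubP => []. Qed.
Let CsV c : c \in C -> c \subset V. Proof. by move/(subsetP CV)/ksubP => []. Qed.
Let PC := crossC CP.

Lemma cover_deg u : #|at_ P u| <= 3.
Proof.
by have [c cC uc] := C0 u; rewrite -(C3 cC); apply: meet_at_le => // p pP; exact: PC.
Qed.

Lemma cover_le9 : #|P| <= 9.
Proof.
case: (set_0Vmem P) => [->|[p pP]]; first by rewrite cards0.
have /card2P[s _] := P2 pP; have [c cC _] := C0 s.
apply: leq_trans (hit_le (c := c) (k := 3) _ _) _; last by rewrite C3.
  by move=> q qP; exact: PC.
by move=> u _; exact: cover_deg.
Qed.

(** Let [s] be an end of [l] off [l']; at most two pairs of [P] contain it. The same bound holds for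
    the other end [t] if it is off [l']. If [t] is on [l'], at most three pairs contain [t], and a
    pair avoiding [t] must join [s] to the other end of [l']. *)
Lemma two_covers l l' : #|l| = 2 -> #|l'| = 2 -> l != l' -> (forall p, p \in P -> meet p l && meet p l') ->
  #|P| <= 4.
Proof.
move=> c c' ll' Pll'.
have Pl p : p \in P -> meet p l by move/Pll'/andP => [].
have Pl' p : p \in P -> meet p l' by move/Pll'/andP => [].
have [s sl sl'] : exists2 s, s \in l & s \notin l'.
  apply/exists_inP; apply: contraR ll' => /exists_inPn sub.
  by rewrite eqEcard c c' leqnn andbT; apply/subsetP => s /sub /negbNE.
have /cards1P[t lt] : #|l :\ s| == 1 by have := cardsD1 s l; rewrite sl c; card_lia.
have lE : l = [set s; t] by rewrite -lt setD1K.
have les := meet_at_le P2 Pl' sl'.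
have le : #|P| <= #|at_ P s| + #|at_ P t| by apply: at_pair_le; rewrite -lE.
case: (boolP (t \in l')) => [tl'|tl']; last first.
  by have := meet_at_le P2 Pl' tl'; move: les le; rewrite c'; card_lia.
have : #|at_ (off_ P t) s| <= #|l' :\ t|.
  apply: at_le => [p|p]; first by rewrite inE => /andP[/P2].
  rewrite inE => /andP[pP tp] sp; have /meetP[y yp yl'] := meet_setD1 (Pl' p pP) sl'.
  apply/meetP; exists y => //; rewrite !inE yl' andbT; apply: contraNneq tp => <-.
  by move: yp; rewrite inE => /andP[].
have -> : at_ (off_ P t) s = off_ P t.
  apply/setP => p; rewrite !inE; case: (boolP (p \in P)) => //= pP.
  by have := Pl p pP; rewrite lE meet2; do 2!case: (_ \in p).
have := cardsD1 t l'; rewrite tl' c'; have := card_at_off P t; have := cover_deg t; card_lia.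
Qed.

Lemma card_le_at2 s t S : s != t ->
  (forall e, e \in C -> s \in e -> t \in e -> meet (e :\: [set s; t]) S) -> #|at_ (at_ C s) t| <= #|S|.
Proof.
move=> st CS; apply: (at2_le st) => e; rewrite !inE => /andP[/andP[eC se] te].
by rewrite C3 //; split=> //; exact: CS.
Qed.

Lemma meet_setD2 e g s t : meet e g -> s \notin g -> t \notin g -> meet (e :\: [set s; t]) g.
Proof.
move=> /meetP[x xe xg] sg tg; apply/meetP; exists x => //; rewrite !inE xe andbT negb_or.
by apply/andP; split; [apply: contraNneq sg|apply: contraNneq tg] => <-.
Qed.

Lemma card_le_at2_V s t : s != t -> s \in V -> t \in V -> #|at_ (at_ C s) t| + 2 <= #|V|.
Proof.
move=> st sV tV; have : #|at_ (at_ C s) t| <= #|V :\: [set s; t]|.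
  apply: card_le_at2 => // e eC se te.
  have [x xe] : exists x, x \in e :\: [set s; t].
      apply/set0Pn; rewrite -card_gt0 cardsD C3 // (setIidPr _) ?subUset ?sub1set ?se //.
      by rewrite cards2 st.
    apply/meetP; exists x => //; move: xe; rewrite !inE => /andP[-> /(subsetP (CsV eC)) ->].
    by [].
have -> : #|V :\: [set s; t]| = #|V| - 2.
  by rewrite cardsD (setIidPr _) ?subUset ?sub1set ?sV // cards2 st.
have : 2 <= #|V|.
  have <- : #|[set s; t]| = 2 by rewrite cards2 st.
  by rewrite subset_leq_card // subUset !sub1set sV.
by card_lia.
Qed.

Lemma card_le_at2_g s t g : s != t -> g \in P -> s \notin g -> t \notin g -> #|at_ (at_ C s) t| <= 2.
Proof.
move=> st gP sg tg; rewrite -(P2 gP); apply: card_le_at2 => // e eC se te.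
by apply: meet_setD2 => //; exact: CP.
Qed.

Lemma card_le_at2_gg s t g h : s != t -> g \in P -> h \in P -> g != h -> ~~ meet g [set s; t] ->
  ~~ meet h [set s; t] -> #|at_ (at_ C s) t| <= 1.
Proof.
rewrite !meet2 !negb_or => st gP hP gh /andP[sg tg] /andP[sh th].
apply: leq_trans (pair_cap (P2 gP) (P2 hP) gh); apply: card_le_at2 => // e eC se te.
have /meetP[x xe xg] := meet_setD2 (CP eC gP) sg tg.
have /meetP[y ye yh] := meet_setD2 (CP eC hP) sh th.
have c1 : #|e :\: [set s; t]| = 1.
  by rewrite cardsD (setIidPr _) ?subUset ?sub1set ?se // cards2 st C3.
by apply/meetP; exists x => //; rewrite inE xg (card1_inj c1 xe ye).
Qed.

(** Pairwise meeting pairs form a triangle or a star, and a star has at most three members by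
    [cover_deg]. Two of them, [[set u; s]] and [[set u; t]], force every edge missing [u] to contain
    [s] and [t], which allows at most [#|V| - 3] edges beside the ['C(#|V|.-1, 2)] possible ones
    through [u]. *)
Lemma near_covers : (forall p q, p \in P -> q \in P -> meet p q) ->
  #|P| <= 3 /\ (2 <= #|P| -> #|C| + 3 <= 'C(#|V|.-1, 2) + #|V|).
Proof.
move=> PP; split.
  case: (boolP [forall x, [exists (q | q \in P), x \notin q]]) => [P0|]; last first.
    case/forallPn => x /exists_inPn Px; rewrite (_ : P = at_ P x) ?cover_deg //.
    by apply/setP => q; rewrite inE; case: (boolP (q \in P)) => // /Px /negbNE.
  have P0' : kernel_free P by move=> x; move/forallP: P0 => /(_ x) /exists_inP.
  by case: (leqP 3 #|P|) => [|/ltnW //]; exact: (cross_le3 P2 P2 PP P0').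
case/card_gt1P => p [q [pP qP pq]].
have /meetP[u up uq] := PP p q pP qP.
have /cards1P[s ps] : #|p :\ u| == 1 by have := cardsD1 u p; rewrite up P2 //; card_lia.
have /cards1P[t qt] : #|q :\ u| == 1 by have := cardsD1 u q; rewrite uq P2 //; card_lia.
have pE : p = [set u; s] by rewrite -ps setD1K.
have qE : q = [set u; t] by rewrite -qt setD1K.
have st : s != t by apply: contraNneq pq => st; rewrite pE qE st eqxx.
have su : s != u by have := set11 s; rewrite -ps !inE => /andP[].
have tu : t != u by have := set11 t; rewrite -qt !inE => /andP[].
have [/ksubP[psV _] /ksubP[qsV _]] := (subsetP PV p pP, subsetP PV q qP).
have uV : u \in V by apply: (subsetP psV).
have sV : s \in V by apply: (subsetP psV); rewrite pE !inE eqxx orbT.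
have tV : t \in V by apply: (subsetP qsV); rewrite qE !inE eqxx orbT.
have leat := at_bin CV uV.
have sub3 : [set u; s; t] \subset V by rewrite !subUset !sub1set uV sV tV.
have c3 : #|[set u; s; t]| = 3.
  by rewrite -setUA !cardsU1 cards1 !inE eq_sym (negPf su) eq_sym (negPf tu) st.
have : #|off_ C u| <= #|V :\: [set u; s; t]|.
  apply: (at2_le st) => e; rewrite inE => /andP[eC ue].
  have := CP eC pP; rewrite pE meet2 (negPf ue) => /= se.
  have := CP eC qP; rewrite qE meet2 (negPf ue) => /= te.
  rewrite C3 //; split=> //.
  have [x xe] : exists x, x \in e :\: [set s; t].
    apply/set0Pn; rewrite -card_gt0 cardsD C3 // (setIidPr _) ?subUset ?sub1set ?se //.
    by rewrite cards2 st.
  apply/meetP; exists x => //; move: xe; rewrite !inE !negb_or => /andP[/andP[-> ->] xe].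
  by rewrite (subsetP (CsV eC)) // !andbT; apply: contraNneq ue => <-.
rewrite cardsD (setIidPr sub3) c3; have := card_at_off C u; have := subset_leq_card sub3; rewrite c3.
by move: leat; card_lia.
Qed.

Section Far.
Variables p q : {set T}.
Hypotheses (pP : p \in P) (qP : q \in P) (pq : ~~ meet p q).

(** With [p = [set a; b]] and [q = [set c; d]], each edge of [C] contains one of the four pairs
    joining [p] to [q], so everything depends on how many edges can contain such a pair. *)
Lemma far_covers : [/\ #|C| + 12 <= 4 * #|V|, 5 <= #|P| -> (#|C| <= 8) || (#|C| <= #|V| + 4) && (#|P| <= 6)
  & 8 <= #|P| -> #|C| <= 4].
Proof.
have /card2P[a [b [ab pE]]] := P2 pP; have /card2P[c [d [cd qE]]] := P2 qP.
have [[aq bq] [cp dp]] : (a \notin q /\ b \notin q) /\ (c \notin p /\ d \notin p).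
  move/meetPn: pq => no; do !split; apply/negP => h; [apply: (no a)|apply: (no b)|apply: (no c)|apply: (no d)];
    by rewrite // ?pE ?qE !inE eqxx ?orbT.
have := aq; rewrite qE !inE negb_or => /andP[ac ad].
have := bq; rewrite qE !inE negb_or => /andP[bc bd].
have [/ksubP[psV _] /ksubP[qsV _]] := (subsetP PV p pP, subsetP PV q qP).
have [aV bV] : a \in V /\ b \in V by split; apply: (subsetP psV); rewrite pE !inE eqxx ?orbT.
have [cV dV] : c \in V /\ d \in V by split; apply: (subsetP qsV); rewrite qE !inE eqxx ?orbT.
have Cab e : e \in C -> (a \in e) || (b \in e) by move=> eC; rewrite -meet2 -pE CP.
have Ccd e : e \in C -> (c \in e) || (d \in e) by move=> eC; rewrite -meet2 -qE CP.
have leC : #|C| <= #|at_ (at_ C a) c| + #|at_ (at_ C a) d| + (#|at_ (at_ C b) c| + #|at_ (at_ C b) d|).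
  apply: leq_trans (at_pair_le (s := a) (t := b) _) _; first by move=> e /Cab; rewrite meet2.
  by apply: leq_add; apply: at_pair_le => e; rewrite inE => /andP[/Ccd]; rewrite meet2.
split.
(* The pairs [a], [c] and [b], [d] lie on at most [#|V| - 2] edges each; the edges left over are in
   [X] or [Y] and have their third vertex off [a], [b], [c], [d]. Together this is
   [2 * (#|V| - 2) + 2 * (#|V| - 4)]. *)
- pose X := [set e in C | [&& a \in e, d \in e, b \notin e & c \notin e]].
  pose Y := [set e in C | [&& b \in e, c \in e, a \notin e & d \notin e]].
  have CU : C \subset at_ (at_ C a) c :|: at_ (at_ C b) d :|: (X :|: Y).
    apply/subsetP => e eC; have := Cab e eC; have := Ccd e eC; rewrite !inE eC /=.
    by case: (a \in e); case: (b \in e); case: (c \in e); case: (d \in e).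
  pose S := [set a; b; c; d].
  have SV : S \subset V by rewrite !subUset !sub1set aV bV cV dV.
  have S4 : #|S| = 4.
    by rewrite /S -!setUA !cardsU1 cards1 !inE (negPf ab) (negPf ac) (negPf ad) (negPf bc) (negPf bd) cd.
  have other (s t : T) e : s != t -> e \in C -> s \in e -> t \in e ->
      (forall x, x \in e -> x \in S -> (x == s) || (x == t)) -> meet (e :\: [set s; t]) (V :\: S).
    move=> st eC se te eS.
    have [x] : exists x, x \in e :\: [set s; t].
      apply/set0Pn; rewrite -card_gt0 cardsD C3 // (setIidPr _) ?subUset ?sub1set ?se //.
      by rewrite cards2 st.
    move=> xe; apply/meetP; exists x => //; move: xe; rewrite in_setD in_set2 => /andP[nst xe].
    by rewrite in_setD (subsetP (CsV eC)) // andbT; apply: contra nst; exact: eS.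
  have leX : #|X| <= #|V :\: S|.
    apply: (at2_le ad) => e; rewrite inE => /andP[eC /and4P[ae de be ce]]; split=> //; first exact: C3.
    apply: other => // x xe; rewrite /S !inE -!orbA => /or4P[->//|/eqP xb|/eqP xc|->]; rewrite ?orbT //.
      by rewrite -xb xe in be.
    by rewrite -xc xe in ce.
  have leY : #|Y| <= #|V :\: S|.
    apply: (at2_le bc) => e; rewrite inE => /andP[eC /and4P[be ce ae de]]; split=> //; first exact: C3.
    apply: other => // x xe; rewrite /S !inE -!orbA => /or4P[/eqP xa|->//|->|/eqP xd]; rewrite ?orbT //.
      by rewrite -xa xe in ae.
    by rewrite -xd xe in de.
  move: leX leY; rewrite cardsD (setIidPr SV) S4 => leX leY.
  have := card_le_at2_V ac aV cV; have := card_le_at2_V bd bV dV.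
  have := subset_leq_card CU; have := (leq_card_setU (at_ (at_ C a) c :|: at_ (at_ C b) d) (X :|: Y)).1.
  have := (leq_card_setU (at_ (at_ C a) c) (at_ (at_ C b) d)).1; have := (leq_card_setU X Y).1.
  have := subset_leq_card SV; rewrite S4; move: leX leY; card_lia.
(* A joining pair that misses some member of [P] lies on at most two edges. By [two_covers] at most
   one of the four meets all of [P]: either none does and [#|C| <= 4 * 2], or one does, with
   [#|C| <= 3 * 2 + (#|V| - 2)] and [#|P| <= 3 + 3]. *)
- move=> P5; pose cov (s t : T) := [forall g in P, meet g [set s; t]].
  have ncov (s t : T) : s != t -> ~~ cov s t -> #|at_ (at_ C s) t| <= 2.
    by move=> st /forall_inPn[g gP]; rewrite meet2 negb_or => /andP[sg tg]; exact: card_le_at2_g gP sg tg.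
  have cov6 (s t : T) : cov s t -> #|P| <= 6.
    move=> /forall_inP Pst; have := at_pair_le Pst; have := cover_deg s; have := cover_deg t; card_lia.
  have no2 (s t s' t' : T) : s != t -> s' != t' -> [set s; t] != [set s'; t'] -> cov s t -> cov s' t' -> False.
    move=> st st' n /forall_inP h /forall_inP h'.
    have := @two_covers [set s; t] [set s'; t'] _ _ n _; rewrite !cards2 st st' => /(_ erefl erefl).
    by rewrite leqNgt P5 => /(_ (fun p pP' => introT andP (conj (h p pP') (h' p pP')))).
  have neq (s t s' t' x : T) : x \in [set s; t] -> x \notin [set s'; t'] -> [set s; t] != [set s'; t'].
    by move=> h h'; apply: contraNneq h' => <-.
  have n1 : [set a; c] != [set a; d] by apply: (neq _ _ _ _ c); rewrite !inE ?eqxx ?orbT // eq_sym (negPf ac) (negPf cd).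
  have n2 : [set a; c] != [set b; c] by apply: (neq _ _ _ _ a); rewrite !inE ?eqxx ?orbT // (negPf ab) (negPf ac).
  have n3 : [set a; c] != [set b; d] by apply: (neq _ _ _ _ a); rewrite !inE ?eqxx ?orbT // (negPf ab) (negPf ad).
  have n4 : [set a; d] != [set b; c] by apply: (neq _ _ _ _ a); rewrite !inE ?eqxx ?orbT // (negPf ab) (negPf ac).
  have n5 : [set a; d] != [set b; d] by apply: (neq _ _ _ _ a); rewrite !inE ?eqxx ?orbT // (negPf ab) (negPf ad).
  have n6 : [set b; c] != [set b; d] by apply: (neq _ _ _ _ c); rewrite !inE ?eqxx ?orbT // eq_sym (negPf bc) (negPf cd).
  have [[[lac lad] lbc] lbd] := (((card_le_at2_V ac aV cV, card_le_at2_V ad aV dV), card_le_at2_V bc bV cV), card_le_at2_V bd bV dV).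
  case: (boolP (cov a c)) => [k1|/(ncov _ _ ac) k1].
    have [k2 k3 k4] : [/\ ~~ cov a d, ~~ cov b c & ~~ cov b d].
      by split; apply/negP => k; [apply: no2 k1 k|apply: no2 k1 k|apply: no2 k1 k].
    rewrite (cov6 _ _ k1) andbT; move: leC lac (ncov _ _ ad k2) (ncov _ _ bc k3) (ncov _ _ bd k4); card_lia.
  case: (boolP (cov a d)) => [k2|/(ncov _ _ ad) k2].
    have [k3 k4] : ~~ cov b c /\ ~~ cov b d by split; apply/negP => k; apply: no2 k2 k.
    rewrite (cov6 _ _ k2) andbT; move: leC lad k1 (ncov _ _ bc k3) (ncov _ _ bd k4); card_lia.
  case: (boolP (cov b c)) => [k3|/(ncov _ _ bc) k3].
    have k4 : ~~ cov b d by apply/negP => k; apply: no2 k3 k.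
    rewrite (cov6 _ _ k3) andbT; move: leC lbc k1 k2 (ncov _ _ bd k4); card_lia.
  case: (boolP (cov b d)) => [k4|/(ncov _ _ bd) k4].
    rewrite (cov6 _ _ k4) andbT; move: leC lbd k1 k2 k3; card_lia.
  move: leC k1 k2 k3 k4; card_lia.
(* Each vertex is on at most three pairs of [P], so at least [8 - 3 - 3] of them avoid both [s] and
   [t]; the third vertex of an edge through [s] and [t] lies on all of these. *)
move=> P8; have le1 (s t : T) : s != t -> #|at_ (at_ C s) t| <= 1.
  move=> st; have /card_gt1P[g [h]] : 1 < #|off_ (off_ P s) t|.
    have := card_at_off P s; have := card_at_off (off_ P s) t.
    have : #|at_ (off_ P s) t| <= #|at_ P t|.
      by apply/subset_leq_card/subsetP => g; rewrite !inE => /andP[/andP[->]].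
    by have := cover_deg s; have := cover_deg t; move: P8; card_lia.
  rewrite !inE => -[/andP[/andP[gP sg] tg] /andP[/andP[hP sh] th] gh].
  by apply: (card_le_at2_gg st gP hP gh); rewrite meet2 negb_or ?sg ?sh.
by move: leC (le1 _ _ ac) (le1 _ _ ad) (le1 _ _ bc) (le1 _ _ bd); card_lia.
Qed.

End Far.
End Covers.
End CoverTriples.

(** * Pairwise intersecting triple systems *)

Section Intersecting.
Variable T : finType.
Implicit Types (x y s t u v : T) (V W : {set T}) (e f g h : {set T}) (E L P Q : {set {set T}}).

Definition star1 E := exists x, #|off_ E x| <= 1.

Lemma at_pairE E x y : (forall e, e \in E -> (x \in e) || (y \in e)) ->
  #|E| = #|at_ (at_ E x) y| + #|off_ E x| + #|off_ E y|.
Proof.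
move=> Exy; rewrite -(card_at_off E x) -(card_at_off (at_ E x) y) -!addnA; congr (_ + _).
rewrite addnC; congr (_ + _); apply: eq_card => e; rewrite !inE.
by case: (boolP (e \in E)) => //= /Exy; do 2!case: (_ \in e).
Qed.

Lemma link_off_cross E x y : (forall e f, e \in E -> f \in E -> meet e f) ->
  x != y -> cross (link (off_ E x) y) (link (off_ E y) x).
Proof.
move=> EE xy g h; rewrite !inE => /andP[yg /andP[gE xg]] /andP[xh /andP[hE yh]].
have /meetP[z] := EE _ _ gE hE; rewrite !inE => /orP[/eqP->|zg] /orP[/eqP zx|zh].
- by rewrite zx eqxx in xy.
- by rewrite zh orbT in yh.
- by rewrite -zx zg orbT in xg.
by apply/meetP; exists z.
Qed.

Lemma at2_le_V E V x y : E \subset ksub V 3 -> x != y -> x \in V -> y \in V -> #|at_ (at_ E x) y| + 2 <= #|V|.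
Proof.
move=> /subsetP EV xy xV yV.
have sV : [set x; y] \subset V by rewrite subUset !sub1set xV.
have le : #|at_ (at_ E x) y| <= #|V :\: [set x; y]|.
  apply: (at2_le xy) => e; rewrite !inE => /andP[/andP[/EV/ksubP[eV e3] xe] ye]; split=> //.
  have [z] : exists z, z \in e :\: [set x; y].
    by apply/set0Pn; rewrite -card_gt0 cardsD e3 (setIidPr _) ?subUset ?sub1set ?xe // cards2 xy.
  by move=> ze; apply/meetP; exists z => //; move: ze; rewrite !inE => /andP[-> /(subsetP eV)].
move: le; rewrite cardsD (setIidPr sV) cards2 xy; have := subset_leq_card sV; rewrite cards2 xy.
by card_lia.
Qed.

(** Suppose two vertices cover all edges, and each is missed by at least two edges. The links of the
    two sorts of edges are then cross-intersecting families of pairs, so [cover2] gives at most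
    [#|V| - 2] edges of each sort, and at most [#|V| - 2] edges contain both vertices. If no two
    vertices cover, two vertices lie on at most three common edges and a vertex on at most nine;
    adding the degrees along one edge counts this edge three times, whence [27 - 2 = 25]. *)
Lemma intersecting_le E V : 6 <= #|V| -> E \subset ksub V 3 ->
    (forall e f, e \in E -> f \in E -> meet e f) ->
  star1 E \/ #|E| <= maxn 25 (3 * #|V| - 6).
Proof.
move=> V6 EV EE; have [x0 x0V] : exists x, x \in V by apply/set0Pn; rewrite -card_gt0; move: V6; card_lia.
case: (set_0Vmem E) => [->|[e0 e0E]].
  by right; rewrite cards0.
have EsV e : e \in E -> e \subset V by move/(subsetP EV)/ksubP => [].
have E3 e : e \in E -> #|e| = 3 by move/(subsetP EV)/ksubP => [].
case: (boolP [exists x, exists y, (x != y) && [forall e in E, (x \in e) || (y \in e)]]).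
  case/existsP => x /existsP[y /andP[xy /forall_inP Exy]].
  case: (leqP #|off_ E x| 1) => [le|ox]; first by left; exists x.
  case: (leqP #|off_ E y| 1) => [le|oy]; first by left; exists y.
  right; rewrite (at_pairE Exy).
  have inV z w : (forall e, e \in E -> (z \in e) || (w \in e)) -> 1 < #|off_ E z| -> w \in V.
    move=> Ezw oz; have [e] : exists e, e \in off_ E z by apply/set0Pn; rewrite -card_gt0 ltnW.
    rewrite inE => /andP[eE ze]; apply: (subsetP (EsV e eE)).
    by have := Ezw e eE; rewrite (negPf ze).
  have yV := inV x y Exy ox.
  have xV : x \in V by apply: (inV y x) oy => e /Exy; rewrite orbC.
  have both z w : z != w -> z \in V -> w \in V -> (forall e, e \in E -> (z \in e) || (w \in e)) ->
      1 < #|off_ E w| -> #|off_ E z| <= #|V| - 2.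
    move=> zw zV wV Ezw ow.
    have VE : #|V :\ z :\ w| = #|V| - 2.
      have := cardsD1 z V; have := cardsD1 w (V :\ z).
      by rewrite zV in_setD1 eq_sym zw wV; card_lia.
    have atw : at_ (off_ E z) w = off_ E z.
      apply/setP => e; rewrite !inE; case: (boolP (e \in E)) => //= /Ezw.
      by do 2!case: (_ \in e).
    have atz : at_ (off_ E w) z = off_ E w.
      apply/setP => e; rewrite !inE; case: (boolP (e \in E)) => //= /Ezw.
      by do 2!case: (_ \in e).
    have offV u : off_ E u \subset ksub V 3.
      by apply/subsetP => e; rewrite inE => /andP[/(subsetP EV)].
    have : #|link (off_ E z) w| <= maxn 4 #|V :\ z :\ w|.
      have /card_gt1P[g [h [gL hL gh]]] : 1 < #|link (off_ E w) z| by rewrite card_link atz.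
      have lV u v : link (off_ E u) v \subset ksub (V :\ u :\ v) 2.
        apply: link_ksub; apply/subsetP => f fF; apply: ksub_setD1 (_ : u \notin f).
          exact: (subsetP (offV u)).
        by move: fF; rewrite inE => /andP[].
      have Vzw : V :\ w :\ z = V :\ z :\ w by rewrite !setDDl setUC.
      have lW f : f \in link (off_ E w) z -> f \in ksub (V :\ z :\ w) 2.
        by rewrite -Vzw; apply/subsetP: f; exact: lV.
      apply: (cover2 (lW g gL) (lW h hL) gh (lV z w)) => q qL.
      by rewrite !(link_off_cross EE zw).
    rewrite card_link atw VE; move: V6; card_lia.
  have := both x y xy xV yV Exy oy; rewrite eq_sym in xy.
  have := both y x xy yV xV; rewrite ox => /(_ _ isT) le.
  have {}le : #|off_ E y| <= #|V| - 2 by apply: le => e /Exy; rewrite orbC.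
  rewrite eq_sym in xy; have := at2_le_V EV xy xV yV; move: le V6; card_lia.
move=> /existsPn no_pair; right.
have no2 x y : x != y -> exists2 e, e \in E & (x \notin e) && (y \notin e).
  move=> xy; have := no_pair x; rewrite negb_exists => /forallP/(_ y); rewrite xy /=.
  by case/forall_inPn => e eE; rewrite negb_or; exists e.
have no1 x : exists2 e, e \in E & x \notin e.
  have [y xy] : exists y, x != y.
    have [y] : exists y, y \in V :\ x by apply/set0Pn; rewrite -card_gt0; have := cardsD1 x V; move: V6; card_lia.
    by rewrite !inE => /andP[yx _]; exists y; rewrite eq_sym.
  by have [e eE /andP[xe _]] := no2 x y xy; exists e.
have le3 x y : x != y -> #|at_ (at_ E x) y| <= 3.
  move=> xy; have [g gE /andP[xg yg]] := no2 x y xy; rewrite -(E3 g gE).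
  apply: (at2_le xy) => e; rewrite !inE => /andP[/andP[eE xe] ye]; rewrite E3 //; split=> //.
  exact: meet_setD2 (EE _ _ eE gE) xg yg.
have le9 x : #|at_ E x| <= 9.
  have [f fE xf] := no1 x; rewrite -[9]/(3 * 3) -{1}(E3 f fE); apply: hit_le.
    by move=> e; rewrite inE => /andP[eE _]; exact: EE.
  by move=> u uf; apply: le3; apply: contraNneq xf => ->.
have [a [b [c [ab ac bc e0E']]]] := card3P (E3 e0 e0E).
have eU : E = at_ E a :|: at_ E b :|: at_ E c.
  apply/setP => e; rewrite !inE -!andb_orr; case: (boolP (e \in E)) => //= eE.
  by have := EE e e0 eE e0E; rewrite e0E' meetU meet2 => /orP[->|] //; rewrite -[[set c]]setUid meet2 orbb => ->; rewrite orbT.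
have in_ae : e0 \in at_ E a :&: at_ E b by rewrite !inE e0E e0E' !inE !eqxx ?orbT.
have in_ce : e0 \in (at_ E a :|: at_ E b) :&: at_ E c by rewrite !inE e0E e0E' !inE !eqxx ?orbT.
have h1 := cardsUI (at_ E a) (at_ E b); have h2 := cardsUI (at_ E a :|: at_ E b) (at_ E c).
have g1 : 0 < #|at_ E a :&: at_ E b| by apply/card_gt0P; exists e0.
have g2 : 0 < #|(at_ E a :|: at_ E b) :&: at_ E c| by apply/card_gt0P; exists e0.
rewrite {1}eU; move: h1 h2 g1 g2 (le9 a) (le9 b) (le9 c); card_lia.
Qed.

End Intersecting.

Ltac with_bin tac :=
  match goal with
  | _ : context [binomial ?a 2] |- _ => tac a
  | |- context [binomial ?a 2] => tac a
  end.

(* Unifies the binomials ['C(a, 2)] and ['C(b, 2)] when [a = b] is arithmetic. *)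
Ltac bin_lia :=
  repeat match goal with |- context [@card.body ?U ?m] =>
    let k := fresh "k" in set k := (@card.body U m); clearbody k end;
  clear; intros;
  repeat with_bin ltac:(fun a => with_bin ltac:(fun b =>
    tryif constr_eq a b then fail else
      (let H := fresh in
       assert (H : binomial a 2 = binomial b 2) by (apply: (f_equal (binomial^~ 2)); lia);
       rewrite -> H in *; clear H)));
  lia.

(** * Systems with a vertex on all but a few edges *)

(* The second order number is the larger of the two thresholds [5 n - 18] and [C(n - 3, 2) + 7]. *)
Definition small n k := (k + 18 < 5 * n) || (k < 'C(n - 3, 2) + 7).

(** [13 = 9 + 4]: nine pairs joining two disjoint triples, and four edges off the centre. *)
Lemma small_bin4 n k : 9 <= n -> k <= 'C(n - 4, 2) + 13 -> small n k.
Proof.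
rewrite /small => n9 le; case: (leqP 11 n) => n11.
  have := @bin2_sub (n - 3) 1 ltac:(lia); rewrite -subnDA (_ : 3 + 1 = 4) //; lia.
have /orP[/eqP e|/eqP e] : (n == 9) || (n == 10) by lia.
  by move: le; rewrite e (_ : 'C(9 - 4, 2) = 10) //; lia.
by move: le; rewrite e (_ : 'C(10 - 4, 2) = 15) //; lia.
Qed.

Section Star.
Variables (T : finType) (V : {set T}) (E : {set {set T}}) (x : T).
Implicit Types (y s t u v : T) (S : {set T}) (d e f g h : {set T}).
Hypotheses (EV : E \subset ksub V 3) (pE : p4free E) (xV : x \in V) (V9 : 9 <= #|V|).
Let W := V :\ x.
Let G := link E x.
Let D := off_ E x.
Let n := #|V|.

Lemma card_W : #|W| = n - 1. Proof. by rewrite /n (cardsD1 x V) xV add1n subn1. Qed.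

Lemma card_star : #|E| = #|G| + #|D|. Proof. by rewrite card_link card_at_off. Qed.

Lemma G_sub : G \subset ksub W 2. Proof. exact: link_ksub. Qed.

Lemma D_ksub e : e \in D -> e \in ksub W 3.
Proof. by rewrite inE => /andP[/(subsetP EV)]; exact: ksub_setD1. Qed.

Lemma D_sub e : e \in D -> e \subset W. Proof. by case/D_ksub/ksubP. Qed.
Lemma D_card e : e \in D -> #|e| = 3. Proof. by case/D_ksub/ksubP. Qed.

Lemma card_WD e : e \subset W -> #|W :\: e| = n - 1 - #|e|.
Proof. by move=> eW; rewrite cardsD (setIidPr eW) card_W. Qed.

Lemma star_meet e g : e \in D -> meet (x |: g) e = meet g e.
Proof.
rewrite inE => /andP[_ xe]; rewrite meetC meetU; have -> : meet e [set x] = false.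
  by apply/negbTE/meetPn => y ye /set1P yx; rewrite -yx ye in xe.
by rewrite meetC.
Qed.

(** Otherwise [e], [f], [x |: g], [x |: h] is a minimal 4-path. *)
Lemma star_path e f g h : e \in D -> f \in D -> meet e f -> g \in G -> h \in G ->
  meet g f -> ~~ meet g e -> meet h (e :|: f).
Proof.
move=> eD fD ef gG hG gf ge; rewrite meetU; apply: contraT; rewrite negb_or => /andP[he hf]; exfalso.
have [eE fE] : e \in E /\ f \in E by move: eD fD; rewrite !inE => /andP[-> _] /andP[-> _].
have [gE hE] : x |: g \in E /\ x |: h \in E by move: gG hG; rewrite !inE => /andP[_ ->] /andP[_ ->].
have gh : meet (x |: g) (x |: h) by apply/meetP; exists x; exact: setU11.
by apply: (pE eE fE gE hE ef _ gh); rewrite meetC star_meet.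
Qed.

(** Here the path would be [e], [x |: g], [x |: h], [f]. *)
Lemma star_path_disjoint e f g h : e \in D -> f \in D -> ~~ meet e f -> g \in G -> h \in G ->
  meet g e -> ~~ meet g f -> meet h f -> meet h e.
Proof.
move=> eD fD ef gG hG ge gf hf; apply: contraT => he; exfalso.
have [eE fE] : e \in E /\ f \in E by move: eD fD; rewrite !inE => /andP[-> _] /andP[-> _].
have [gE hE] : x |: g \in E /\ x |: h \in E by move: gG hG; rewrite !inE => /andP[_ ->] /andP[_ ->].
have gh : meet (x |: g) (x |: h) by apply/meetP; exists x; exact: setU11.
by apply: (pE eE gE hE fE _ gh); rewrite ?star_meet // meetC star_meet.
Qed.

Lemma star_dichotomy e f : e \in D -> f \in D -> meet e f ->
  (forall g, g \in G -> meet g (e :|: f)) \/ (forall g, g \in G -> meet g e = meet g f).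
Proof.
move=> eD fD ef; case: (boolP [forall g in G, meet g (e :|: f)]) => [/forall_inP|].
  by left.
case/forall_inPn => h hG hef; right=> g gG; apply/idP/idP => gm; apply: contraT => ng.
  by move: hef; rewrite setUC (star_path fD eD _ gG hG gm ng) // meetC.
by move: hef; rewrite (star_path eD fD ef gG hG gm ng).
Qed.

Definition same e f := [set g in ksub W 2 | meet g e == meet g f].
Definition reach e f := [set g in ksub W 2 | meet g (e :|: f)].

Lemma card_same e f : e \in D -> f \in D ->
  #|same e f| + 2 * 'C(n - 4, 2) = 'C(n - 1, 2) + 2 * 'C(n - 1 - #|e :|: f|, 2).
Proof.
move=> eD fD; have eW := D_sub eD; have fW := D_sub fD.
have efW : e :|: f \subset W by rewrite subUset eW.
have := card_hit2 W e f 2; rewrite !card_WD // card_W (D_card eD) (D_card fD).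
have -> : n - 1 - 3 = n - 4 by rewrite -subnDA.
have -> : same e f = [set g in ksub W 2 | meet g e & meet g f] :|: ksub (W :\: (e :|: f)) 2.
  rewrite -missE; apply/setP => g; rewrite !inE meetU negb_or.
  by case: (g \subset W); case: (#|g| == 2); case: (meet g e); case: (meet g f).
rewrite [#|_ :|: ksub _ _|]cardsU card_ksub card_WD //.
have -> : [set g in ksub W 2 | meet g e & meet g f] :&: ksub (W :\: (e :|: f)) 2 = set0.
  apply/setP => g; rewrite -missE !inE meetU negb_or.
  by case: (meet g e); case: (meet g f); rewrite ?andbF.
by rewrite cards0 subn0; card_lia.
Qed.

Lemma card_reach e f : e \in D -> f \in D ->
  #|reach e f| + 'C(n - 1 - #|e :|: f|, 2) = 'C(n - 1, 2).
Proof.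
move=> eD fD; have := card_hit W (e :|: f) 2.
by rewrite card_WD ?subUset ?D_sub // card_W.
Qed.

Lemma pencil_card y S : y \notin S -> #|[set [set y; t] | t in S]| = #|S|.
Proof.
move=> yS; rewrite card_in_imset // => t u tS uS tu.
have : t \in [set y; u] by rewrite -tu !inE eqxx orbT.
by rewrite !inE => /orP[/eqP ty|/eqP//]; rewrite -ty tS in yS.
Qed.

Lemma pencil_sub y S : y \in W -> S \subset W -> y \notin S -> [set [set y; t] | t in S] \subset ksub W 2.
Proof.
move=> yW SW yS; apply/subsetP => g /imsetP[t tS ->]; apply/ksubP.
rewrite subUset !sub1set yW (subsetP SW) // cards2.
by case: eqP => // yt; rewrite yt tS in yS.
Qed.

Lemma lose_le (X L : {set {set T}}) : G \subset X -> L \subset X -> (forall g, g \in L -> g \notin G) ->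
  #|G| + #|L| <= #|X|.
Proof.
move=> GX LX LG; have GL : [disjoint G & L].
  by rewrite disjoint_sym disjoint_subset; apply/subsetP => g /LG.
have := cardsUI G L; rewrite (disjoint_setI0 GL) cards0 addn0 => <-.
by rewrite subset_leq_card // subUset GX.
Qed.

(** By [star_path_disjoint] one of the two edges, say [f], is met only by pairs of [G] that also
    meet [e]. So [G] consists of pairs avoiding [f] and of some of the nine pairs joining [e] to
    [f]. *)
Lemma star_disjoint_small e f : e \in D -> f \in D -> ~~ meet e f -> #|D| <= 4 -> small n #|E|.
Proof.
move=> eD fD ef D4; wlog hef : e f eD fD ef / forall h, h \in G -> meet h f -> meet h e.
  move=> wl; case: (boolP [forall h in G, meet h f ==> meet h e]) => [/forall_inP h|].
    by apply: (wl e f) => // g gG; apply/implyP/h.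
  case/forall_inPn => h hG; rewrite negb_imply => /andP[hf he].
  apply: (wl f e) => // [|g gG ge]; first by rewrite meetC.
  by apply: contraT => gf; rewrite (star_path_disjoint eD fD ef gG hG) in he.
have GX : G \subset ksub (W :\: f) 2 :|: [set g in ksub W 2 | meet g e & meet g f].
  apply/subsetP => g gG; rewrite -missE !inE; have := subsetP G_sub g gG; rewrite inE => ->.
  by case: (boolP (meet g f)) => //= /(hef g gG) ->.
have := leq_trans (subset_leq_card GX) (leq_card_setU _ _).1; rewrite card_ksub.
have := card_hit2 W e f 2.
have efW : e :|: f \subset W by rewrite subUset !D_sub.
have ef6 : #|e :|: f| = 6.
  by have := cardsUI e f; rewrite (eqP (negbNE ef)) cards0 addn0 (D_card eD) (D_card fD).
rewrite (card_WD (D_sub eD)) (card_WD (D_sub fD)) (card_WD efW) card_W ef6 (D_card eD) (D_card fD) => h1 h2.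
apply: small_bin4 => //; rewrite card_star.
have := @bin2_sub (n - 1) 3 ltac:(move: V9; rewrite -/n; lia).
have := @bin2_sub (n - 1) 6 ltac:(move: V9; rewrite -/n; lia).
move: h1 h2 D4 V9; rewrite -/n; move: n => m; bin_lia.
Qed.

Definition SP_shape := exists e f, [/\ D = [set e; f], #|e :&: f| = 1 & G = reach e f].
Definition CB_shape := exists e f, [/\ D = [set e; f], #|e :&: f| = 2 & G = same e f].

Lemma card_DU e f : e \in D -> f \in D -> #|e :|: f| + #|e :&: f| = 6.
Proof. by move=> eD fD; rewrite cardsUI (D_card eD) (D_card fD). Qed.

Lemma D_cap e f : e \in D -> f \in D -> e != f -> meet e f -> (#|e :&: f| == 1) || (#|e :&: f| == 2).
Proof.
move=> eD fD ef; rewrite /meet -card_gt0; suff : #|e :&: f| < 3 by card_lia.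
rewrite ltnNge; apply: contra ef => le3.
have /eqP e1 : e :&: f == e by rewrite eqEcard subsetIl (D_card eD).
by rewrite eqEcard (D_card eD) (D_card fD) andbT -e1 subsetIr.
Qed.

Lemma G_same e f : (forall g, g \in G -> meet g e = meet g f) -> G \subset same e f.
Proof. by move=> h; apply/subsetP => g gG; rewrite inE (subsetP G_sub) //= h. Qed.

Lemma G_reach e f : (forall g, g \in G -> meet g (e :|: f)) -> G \subset reach e f.
Proof. by move=> h; apply/subsetP => g gG; rewrite inE (subsetP G_sub) //= h. Qed.

Lemma star_same1 e f : e \in D -> f \in D -> #|e :&: f| = 1 ->
  (forall g, g \in G -> meet g e = meet g f) -> #|D| <= 4 -> small n #|E|.
Proof.
move=> eD fD c1 /G_same/subset_leq_card leG D4; have := card_DU eD fD; have := card_same eD fD.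
rewrite c1 card_star /small; have := @bin2_sub (n - 1) 3 ltac:(move: V9; rewrite -/n; lia).
have := @bin2_sub (n - 1) 5 ltac:(move: V9; rewrite -/n; lia).
have := @bin2_sub (n - 1) 2 ltac:(move: V9; rewrite -/n; lia).
by move: V9 leG D4; rewrite -/n; move: n => m; bin_lia.
Qed.

Lemma star_reach2 e f : e \in D -> f \in D -> #|e :&: f| = 2 ->
  (forall g, g \in G -> meet g (e :|: f)) -> #|D| <= 4 -> small n #|E|.
Proof.
move=> eD fD c2 /G_reach/subset_leq_card leG D4; have := card_DU eD fD; have := card_reach eD fD.
rewrite c2 card_star /small; have := @bin2_sub (n - 1) 4 ltac:(move: V9; rewrite -/n; lia).
by move: V9 leG D4; rewrite -/n; move: n => m; bin_lia.
Qed.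

Lemma card_same2 e f : e \in D -> f \in D -> #|e :&: f| = 2 -> #|same e f| = 'C(n - 3, 2) + 5.
Proof.
move=> eD fD c2; have := card_DU eD fD; have := card_same eD fD; rewrite c2.
have := @bin2_sub (n - 1) 3 ltac:(move: V9; rewrite -/n; lia).
have := @bin2_sub (n - 1) 4 ltac:(move: V9; rewrite -/n; lia).
have := @bin2_sub (n - 1) 2 ltac:(move: V9; rewrite -/n; lia).
by move: V9; rewrite -/n; move: n => m; bin_lia.
Qed.

Lemma card_reach1 e f : e \in D -> f \in D -> #|e :&: f| = 1 -> #|reach e f| + 20 = 5 * n.
Proof.
move=> eD fD c1; have := card_DU eD fD; have := card_reach eD fD; rewrite c1.
have := @bin2_sub (n - 1) 5 ltac:(move: V9; rewrite -/n; lia).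
by move: V9; rewrite -/n; move: n => m; bin_lia.
Qed.

(* [d] and [e] share two vertices and a third edge [f] meets [e] once: an edge of [G] missing
   [d] and [e] must meet the at most two vertices of [f] outside [d :|: e]. *)
Lemma star_mixed d e f : d \in D -> e \in D -> f \in D -> #|d :&: e| = 2 -> #|e :&: f| = 1 ->
  (forall g, g \in G -> meet g d = meet g e) -> (forall g, g \in G -> meet g (e :|: f)) ->
  #|D| <= 4 -> small n #|E|.
Proof.
move=> dD eD fD cde cef sde ref D4.
pose X := [set g in ksub W 2 | meet g d & meet g e].
pose Y := [set g in ksub (W :\: (d :|: e)) 2 | meet g f].
have deW : d :|: e \subset W by rewrite subUset !D_sub.
have GXY : G \subset X :|: Y.
  apply/subsetP => g gG; have gW := subsetP G_sub g gG; have sg := sde g gG.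
  rewrite in_setU /X in_set gW sg /=; case: (boolP (meet g e)) => ge //=.
  rewrite /Y in_set -missE in_set gW meetU sg (negPf ge) /=.
  by have := ref g gG; rewrite meetU (negPf ge).
have hX := card_hit2 W d e 2; have hY := card_hit (W :\: (d :|: e)) f 2.
rewrite (card_WD (D_sub dD)) (card_WD (D_sub eD)) (card_WD deW) card_W (D_card dD) (D_card eD) in hX.
rewrite (card_WD deW) in hY.
have cde4 := card_DU dD eD; rewrite cde in cde4.
have leZ : n - 1 - 4 - 2 <= #|W :\: (d :|: e) :\: f|.
  have := cardsID f (W :\: (d :|: e)); rewrite (card_WD deW).
  have : #|(W :\: (d :|: e)) :&: f| <= #|f :\: e|.
    by apply/subset_leq_card/subsetP => t; rewrite !inE negb_or => /andP[/andP[/andP[_ ->] _] ->].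
  have := cardsID e f; rewrite setIC cef (D_card fD); move: cde4.
  by move: n => m; card_lia.
have := leq_bin2l 2 leZ; have := leq_trans (subset_leq_card GXY) (leq_card_setU X Y).1.
rewrite card_star /small.
have := @bin2_sub (n - 1) 3 ltac:(move: V9; rewrite -/n; lia).
have := @bin2_sub (n - 1) 4 ltac:(move: V9; rewrite -/n; lia).
have := @bin2_sub (n - 1) 6 ltac:(move: V9; rewrite -/n; lia).
rewrite -/X in hX; rewrite -/Y in hY.
have e4 : #|d :|: e| = 4 by move: cde4; card_lia.
rewrite e4 in hX hY; move: hX hY V9 D4; rewrite -/n; move: n => m.
by bin_lia.
Qed.

(* All edges of [D] pairwise share two vertices, and [G] does not distinguish them: the third edge
   costs [G] at least [n - 6] pairs. *)
Lemma star_all2 d e f : d \in D -> e \in D -> f \in D -> d != f -> e != f -> #|d :&: e| = 2 ->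
  (forall g, g \in G -> meet g d = meet g e) -> (forall g, g \in G -> meet g e = meet g f) ->
  #|D| <= 4 -> small n #|E|.
Proof.
move=> dD eD fD df ef cde sde sef D4.
have leG (L : {set {set T}}) : L \subset same d e -> (forall g, g \in L -> g \notin G) -> n - 6 <= #|L| ->
    small n #|E|.
  move=> Ls LG; have := lose_le (G_same sde) Ls LG; rewrite card_same2 // card_star /small.
  by move: V9 D4; rewrite -/n; move: n => m; bin_lia.
have [dW [eW fW]] : d \subset W /\ e \subset W /\ f \subset W by rewrite !D_sub.
(* Either way a pencil of pairs lies in [same d e] but not in [G], because it separates [e] from
   [f]: [n - 6] pairs at a vertex of [f] outside [d :|: e], or [n - 5] at a vertex of [d :&: e]
   outside [f]. *)
case: (boolP (d :&: e \subset f)) => [sf|/subsetPn[y]].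
  have [v vf vde] : exists2 v, v \in f & v \notin d :|: e.
    apply/exists_inP; apply: contraT => /exists_inPn sub.
    have fde : f \subset d :|: e by apply/subsetP => v /sub /negbNE.
    have /cards1P[v vE] : #|f :\: (d :&: e)| == 1.
      by rewrite cardsD (setIidPr sf) cde (D_card fD).
    have := set11 v; rewrite -vE !inE => /andP[nv vf].
    have inter h : h \in D -> h != f -> d :&: e \subset h -> v \notin h.
      move=> hD hf sh; apply: contra hf => vh; rewrite eqEcard (D_card hD) (D_card fD) andbT.
      have : (d :&: e) :|: [set v] = h.
        apply/eqP; rewrite eqEcard subUset sh sub1set vh /= (D_card hD) setUC cardsU1.
        by rewrite cde !inE nv.
      by move=> <-; rewrite subUset sf sub1set.
    have := subsetP fde v vf; rewrite inE.
    by rewrite (negPf (inter d dD df (subsetIl _ _))) (negPf (inter e eD ef (subsetIr _ _))).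
  pose S := W :\: (d :|: e) :\ v.
  have vW : v \in W by apply: (subsetP fW).
  have vS : v \notin S by rewrite /S !inE eqxx.
  have SW : S \subset W by apply/subsetP => t; rewrite /S in_setD1 in_setD => /and3P[].
  apply: (leG [set [set v; t] | t in S]).
  - apply/subsetP => g gL; rewrite inE (subsetP (pencil_sub vW SW vS)) //=.
    case/imsetP: gL => t; rewrite /S !inE => /andP[_ /andP[tde _]] ->.
    move: vde tde; rewrite !inE !negb_or => /andP[vd ve] /andP[td te].
    by rewrite ![meet [set _; _] _]meetC !meet2 (negPf vd) (negPf ve) (negPf td) (negPf te).
  - move=> g /imsetP[t tS ->]; apply/negP => /sef.
    move: tS; rewrite /S in_setD1 in_setD => /and3P[_ tde _]; move: vde tde; rewrite !inE !negb_or => /andP[vd ve] /andP[td te].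
    by rewrite ![meet [set _; _] _]meetC !meet2 vf (negPf ve) (negPf te).
  rewrite pencil_card //; have := cardsD1 v (W :\: (d :|: e)).
  rewrite inE vde vW (card_WD _) ?subUset ?dW //; have := card_DU dD eD; rewrite cde -/S.
  by move: V9; rewrite -/n; move: n => m; card_lia.
rewrite inE => /andP[yd ye] yf; pose S := W :\: f :\ y.
have yW : y \in W by apply: (subsetP dW).
have yS : y \notin S by rewrite /S !inE eqxx.
have SW : S \subset W by apply/subsetP => t; rewrite /S in_setD1 in_setD => /and3P[].
apply: (leG [set [set y; t] | t in S]).
- apply/subsetP => g gL; rewrite inE (subsetP (pencil_sub yW SW yS)) //=.
  by case/imsetP: gL => t _ ->; rewrite ![meet [set _; _] _]meetC !meet2 yd ye.
- move=> g /imsetP[t tS ->]; apply/negP => /sef.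
  move: tS; rewrite /S in_setD1 in_setD => /and3P[_ tf _].
  by rewrite ![meet [set _; _] _]meetC !meet2 ye (negPf yf) (negPf tf).
rewrite pencil_card //; have := cardsD1 y (W :\: f).
rewrite inE yf yW (card_WD fW) (D_card fD) -/S.
by move: V9; rewrite -/n; move: n => m; card_lia.
Qed.

(** The pairs from a vertex of [e] alone to vertices off [d :|: f] lie in [reach e f] but miss
    [d :|: f], so [G] loses [n - 7] of its [5 n - 20] possible pairs; likewise at a vertex of [f]
    alone. Both pencils count: with four edges off [x], a single one would leave [4 n - 9] edges,
    which is not below [5 n - 18] for [n = 9]. *)
Lemma star_all1 d e f : d \in D -> e \in D -> f \in D -> #|d :&: e| = 1 -> #|d :&: f| = 1 -> #|e :&: f| = 1 ->
  (forall g, g \in G -> [&& meet g (d :|: e), meet g (d :|: f) & meet g (e :|: f)]) ->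
  #|D| <= 4 -> small n #|E|.
Proof.
move=> dD eD fD cde cdf cef hG D4.
have pick (a b c : {set T}) : a \in D -> #|a :&: b| = 1 -> #|a :&: c| = 1 ->
    exists2 u, u \in a & u \notin b :|: c.
  move=> aD ab ac; apply/exists_inP; apply: contraT => /exists_inPn sub.
  have : a \subset (a :&: b) :|: (a :&: c).
    by apply/subsetP => u ua; have := sub u ua; rewrite !inE ua negbK.
  move/subset_leq_card; rewrite (D_card aD) => le; have := leq_trans le (leq_card_setU _ _).1.
  by rewrite ab ac.
have [u ue udf] := pick e d f eD ltac:(by rewrite setIC) cef.
have [v vf vde] := pick f d e fD ltac:(by rewrite setIC) ltac:(by rewrite setIC).
have pencil (a b c : {set T}) (w : T) : a \in D -> b \in D -> c \in D -> w \in b -> w \notin a :|: c ->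
    #|a :&: c| = 1 -> (forall g, g \in G -> meet g (a :|: c)) ->
    exists2 L : {set {set T}}, L \subset [set g in ksub W 2 | meet g b] &
      [/\ forall g, g \in L -> g \notin G, #|L| = n - 7 & forall g, g \in L -> w \in g /\ forall t, t \in g -> t != w -> t \notin a :|: c].
  move=> aD bD cD wb wac cac Gac; pose S := W :\: (a :|: c) :\ w.
  have wW : w \in W by apply: (subsetP (D_sub bD)).
  have wS : w \notin S by rewrite /S !inE eqxx.
  have SW : S \subset W by apply/subsetP => t; rewrite /S in_setD1 in_setD => /and3P[].
  have acW : a :|: c \subset W by rewrite subUset !D_sub.
  exists [set [set w; t] | t in S].
    apply/subsetP => g gL; rewrite inE (subsetP (pencil_sub wW SW wS)) //=.
    by case/imsetP: gL => t _ ->; rewrite meetC meet2 wb.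
  split.
  - move=> g /imsetP[t tS ->]; apply/negP => /Gac.
    move: tS; rewrite /S in_setD1 in_setD => /and3P[_ tac _].
    by rewrite meetC meet2 (negPf wac) (negPf tac).
  - rewrite pencil_card //; have := cardsD1 w (W :\: (a :|: c)); rewrite inE wac wW (card_WD acW).
    by have := card_DU aD cD; rewrite cac -/S; move: V9; rewrite -/n; move: n => m; card_lia.
  move=> g /imsetP[t]; rewrite /S in_setD1 in_setD => /and3P[_ tac _] ->; rewrite in_set2 eqxx; split=> // s.
  by rewrite in_set2 => /orP[/eqP->|/eqP->]; rewrite ?eqxx.
have [|L LX [LG Lc Lw]] := @pencil d e f u dD eD fD ue udf cdf; first by move=> g /hG/and3P[].
have [|M MX [MG Mc Mw]] := @pencil d f e v dD fD eD vf vde cde; first by move=> g /hG/and3P[].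
have Gr : G \subset reach e f by apply: G_reach => g /hG/and3P[].
have LMr : L :|: M \subset reach e f.
  apply/subsetP => g; rewrite inE => /orP[/(subsetP LX)|/(subsetP MX)]; rewrite !inE meetU => /andP[-> ->] //.
  by rewrite orbT.
have LMG g : g \in L :|: M -> g \notin G by rewrite inE => /orP[/LG|/MG].
have LM : L :&: M = set0.
  apply/setP => g; rewrite !inE; apply/negP => /andP[/Lw[ug _] /Mw[vg Mt]].
  have uv : u != v by apply: contraNneq vde => <-; rewrite inE ue orbT.
  by have := Mt u ug uv; rewrite inE ue orbT.
have := lose_le Gr LMr LMG; have := cardsUI L M; rewrite LM cards0 Lc Mc.
have := card_reach1 eD fD cef; rewrite card_star /small.
by move: V9 D4; rewrite -/n; move: n => m; card_lia.
Qed.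

(** With two edges off [x], a system that is not small fills [reach] or [same] completely; with
    three or four, the losses computed above always make it small. *)
Lemma star_small : 2 <= #|D| -> #|D| <= 4 ->
  [\/ small n #|E|, SP_shape /\ #|E| + 18 = 5 * n | CB_shape /\ #|E| = 'C(n - 3, 2) + 7].
Proof.
move=> D2 D4.
case: (boolP [exists e in D, exists f in D, ~~ meet e f]) => [/exists_inP[e eD /exists_inP[f fD ef]]|].
  by apply: Or31; apply: (star_disjoint_small eD fD).
move=> /exists_inPn DD; have Dm e f : e \in D -> f \in D -> meet e f.
  by move=> eD fD; have /exists_inPn/(_ f fD)/negbNE := DD e eD.
case: (boolP (small n #|E|)) => [_|nsm]; first by apply: Or31.
have same2 e f : e \in D -> f \in D -> #|e :&: f| = 2 -> forall g, g \in G -> meet g e = meet g f.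
  move=> eD fD c2; case: (star_dichotomy eD fD (Dm e f eD fD)) => // h.
  by rewrite (star_reach2 eD fD c2 h D4) in nsm.
have reach1 e f : e \in D -> f \in D -> #|e :&: f| = 1 -> forall g, g \in G -> meet g (e :|: f).
  move=> eD fD c1; case: (star_dichotomy eD fD (Dm e f eD fD)) => // h.
  by rewrite (star_same1 eD fD c1 h D4) in nsm.
have [D3|D2'] := leqP 3 #|D|; last first.
  have /card2P[e [f [ef DE]]] : #|D| = 2 by move: D2 D2'; card_lia.
  have [eD fD] : e \in D /\ f \in D by rewrite DE !inE !eqxx orbT.
  have cD : #|D| = 2 by rewrite DE cards2 ef.
  case/orP: (D_cap eD fD ef (Dm e f eD fD)) => /eqP c.
    have Gs := G_reach (reach1 e f eD fD c); have cr := card_reach1 eD fD c.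
    have le := subset_leq_card Gs.
    have eqE : #|E| + 18 = 5 * n by move: le cr nsm; rewrite card_star cD /small; move: n => m; card_lia.
    apply: Or32; split=> //; exists e, f; split=> //; apply/eqP; rewrite eqEcard Gs /=.
    by move: cr eqE; rewrite card_star cD; move: n => m; card_lia.
  have Gs := G_same (same2 e f eD fD c); have cr := card_same2 eD fD c.
  have le := subset_leq_card Gs.
  have eqE : #|E| = 'C(n - 3, 2) + 7 by move: le cr nsm; rewrite card_star cD /small; move: n => m; card_lia.
  apply: Or33; split=> //; exists e, f; split=> //; apply/eqP; rewrite eqEcard Gs /=.
  by move: cr eqE; rewrite card_star cD; move: n => m; card_lia.
exfalso; move/negP: nsm; apply.
have third d e : d \in D -> e \in D -> d != e -> exists2 f, f \in D & (d != f) && (e != f).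
  move=> dD eD de; have [f] : exists f, f \in D :\ d :\ e.
    apply/set0Pn; rewrite -card_gt0; have := cardsD1 d D; have := cardsD1 e (D :\ d).
    by rewrite dD in_setD1 eq_sym de eD; move: D3; card_lia.
  by rewrite !in_setD1 => /and3P[fe fd fD]; exists f; rewrite // eq_sym fd eq_sym fe.
case: (boolP [exists d in D, exists e in D, #|d :&: e| == 2]).
  case/exists_inP => d dD /exists_inP[e eD /eqP cde].
  have de : d != e by apply/negP => /eqP de; move: cde; rewrite de setIid (D_card eD).
  have [f fD /andP[df ef]] := third d e dD eD de.
  have sde := same2 d e dD eD cde.
  case/orP: (D_cap eD fD ef (Dm e f eD fD)) => /eqP cef.
    exact: (star_mixed dD eD fD cde cef sde (reach1 e f eD fD cef)).
  exact: (star_all2 dD eD fD df ef cde sde (same2 e f eD fD cef)).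
move=> /exists_inPn no2; have one d e : d \in D -> e \in D -> d != e -> #|d :&: e| = 1.
  move=> dD eD de; have := D_cap dD eD de (Dm d e dD eD).
  by have /exists_inPn/(_ e eD)/negPf-> := no2 d dD; rewrite orbF => /eqP.
have [d [e [dD eD de]]] : exists d e, [/\ d \in D, e \in D & d != e].
  by apply/card_gt1P; move: D3; card_lia.
have [f fD /andP[df ef]] := third d e dD eD de.
apply: (star_all1 dD eD fD (one _ _ dD eD de) (one _ _ dD fD df) (one _ _ eD fD ef)) => // g gG.
by rewrite !reach1 // one.
Qed.

End Star.

(** * Kernels of the two parts *)

Section Kernel.
Variable T : finType.
Implicit Types (x y s t u v : T) (V : {set T}) (b c d e f g h q : {set T}) (B C D E L P Q : {set {set T}}).

Definition kernel C : {set T} := [set x | [forall c in C, x \in c]].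

Lemma kernelP C x : reflect (forall c, c \in C -> x \in c) (x \in kernel C).
Proof. by rewrite inE; apply: forall_inP. Qed.

Lemma kernel_sub C c : c \in C -> kernel C \subset c.
Proof. by move=> cC; apply/subsetP => x /kernelP; apply. Qed.

Lemma sub_cover C c : c \in C -> c \subset cover C.
Proof. exact: bigcup_sup. Qed.

Definition thin C := forall c, c \in C -> #|c| = 3.

Lemma cover_ksub C : thin C -> C \subset ksub (cover C) 3.
Proof. by move=> C3; apply/subsetP => c cC; apply/ksubP; rewrite sub_cover // C3. Qed.

Lemma kernel0 C : #|kernel C| = 0 -> kernel_free C.
Proof.
move/cards0_eq => K0 x; apply/exists_inP; apply: contraT => /exists_inPn h.
have : x \in kernel C by apply/kernelP => c /h /negbNE.
by rewrite K0 inE.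
Qed.

Lemma kernel_le3 C : thin C -> C != set0 -> #|kernel C| <= 3.
Proof. by move=> C3 /set0Pn[c cC]; rewrite -(C3 c cC) subset_leq_card // kernel_sub. Qed.

Lemma kernel3 C : thin C -> C != set0 -> #|kernel C| = 3 -> C = [set kernel C] /\ cover C = kernel C.
Proof.
move=> C3 C0 K3; have CK c : c \in C -> c = kernel C.
  by move=> cC; apply/esym/eqP; rewrite eqEcard kernel_sub // (C3 c cC) K3.
have CE : C = [set kernel C].
  apply/setP => c; rewrite inE; apply/idP/eqP => [/CK//|->].
  by have /set0Pn[d dC] := C0; rewrite -(CK d dC).
by split=> //; rewrite CE /cover big_set1 -CE.
Qed.

Lemma cover_ge3 C : thin C -> C != set0 -> 3 <= #|cover C|.
Proof. by move=> C3 /set0Pn[c cC]; rewrite -(C3 c cC) subset_leq_card // sub_cover. Qed.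

Lemma cover_ge4 C : thin C -> C != set0 -> #|kernel C| < 3 -> 4 <= #|cover C|.
Proof.
move=> C3 /set0Pn[c0 c0C]; apply: contraTT; rewrite -!leqNgt => le3; rewrite -(C3 c0 c0C).
have Cc c : c \in C -> c = cover C.
  by move=> cC; apply/eqP; rewrite eqEcard sub_cover // (C3 c cC).
by apply/subset_leq_card/subsetP => x xc; apply/kernelP => c /Cc ->; rewrite -(Cc c0 c0C).
Qed.

Lemma kernel2_card C : thin C -> C != set0 -> 2 <= #|kernel C| -> #|C| + 2 <= #|cover C|.
Proof.
move=> C3 C0 /card_gt1P[s [t [/kernelP sC /kernelP tC st]]].
have /set0Pn[c cC] := C0.
have sV : s \in cover C by apply: (subsetP (sub_cover cC)); exact: sC.
have tV : t \in cover C by apply: (subsetP (sub_cover cC)); exact: tC.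
have -> : #|C| = #|at_ (at_ C s) t|; last exact: at2_le_V (cover_ksub C3) st sV tV.
by apply: eq_card => d; rewrite !inE; case: (boolP (d \in C)) => // dC; rewrite sC ?tC.
Qed.

Section Center.
Variables (C : {set {set T}}) (x : T).
Hypotheses (C3 : thin C) (C0 : C != set0) (Kx : kernel C = [set x]).

Lemma center_in c : c \in C -> x \in c.
Proof. by move: c; apply/kernelP; rewrite Kx set11. Qed.

Lemma center_cover : x \in cover C.
Proof. by have /set0Pn[c cC] := C0; apply: (subsetP (sub_cover cC)); exact: center_in. Qed.

Lemma card_center : #|link C x| = #|C|.
Proof.
rewrite card_link; apply: eq_card => c; rewrite !inE; case: (boolP (c \in C)) => // cC.
by rewrite center_in.
Qed.

Lemma link_center : link C x \subset ksub (cover C :\ x) 2.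
Proof. exact/link_ksub/cover_ksub. Qed.

Lemma link_kernel_free : kernel_free (link C x).
Proof.
move=> y; have del c : c \in C -> c :\ x \in link C x.
  by move=> cC; rewrite !inE eqxx setD1K ?center_in.
case: (eqVneq y x) => [->|yx].
  by have /set0Pn[c cC] := C0; exists (c :\ x); rewrite ?del // !inE eqxx.
have : y \notin kernel C by rewrite Kx inE.
rewrite inE => /forall_inPn[c cC yc]; exists (c :\ x); first exact: del.
by rewrite !inE (negPf yc) andbF.
Qed.

End Center.

(** The possible traces on [cover C] of a rest edge that misses the kernel, which is why the pairs
    avoid [kernel C]. *)
Definition pcovers C := [set q in ksub (cover C :\: kernel C) 2 | [forall c in C, meet c q]].

Lemma pcovers_sub C : pcovers C \subset ksub (cover C) 2.
Proof.
apply/subsetP => q; rewrite inE => /andP[/ksubP[qs q2] _]; apply/ksubP; split=> //.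
exact: subset_trans qs (subsetDl _ _).
Qed.

Lemma pcovers_cross C : cross C (pcovers C).
Proof. by move=> c q cC; rewrite inE => /andP[_ /forall_inP]; apply. Qed.

Lemma pcovers_link C x : kernel C = [set x] -> cross (link C x) (pcovers C).
Proof.
move=> Kx l q; rewrite !inE => /andP[_ lC] /andP[/andP[qs _] /forall_inP/(_ _ lC)].
rewrite meetC meetU => /orP[|]; last by rewrite meetC.
rewrite -[[set x]]setUid meet2 orbb => /(subsetP qs); rewrite Kx !inE eqxx.
by [].
Qed.

Definition split_ok V E C D := [/\ E \subset ksub V 3, p4free E, C != set0 /\ D != set0, C :|: D \subset E /\ sep C D
  & forall b c, b \in E -> b \notin C :|: D -> c \in C :|: D -> meet b c].

Lemma split_ok_sym V E C D : split_ok V E C D -> split_ok V E D C.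
Proof. by case=> EV pE [C0 D0] [sE sCD] Bm; split=> //; rewrite 1?sepC 1?setUC. Qed.

Definition rest E C D := E :\: (C :|: D).

Lemma rest_sym E C D : rest E C D = rest E D C.
Proof. by rewrite /rest setUC. Qed.

Section Split.
Variables (V : {set T}) (E C D : {set {set T}}).
Hypothesis ok : split_ok V E C D.
Let B := rest E C D.

Lemma split_subC : C \subset E.
Proof. by case: ok => _ _ _ [sE _] _; apply: subset_trans sE; exact: subsetUl. Qed.

Lemma split_thin : thin C.
Proof. by case: ok => EV _ _ _ _ c /(subsetP split_subC)/(subsetP EV)/ksubP[]. Qed.

Lemma split_coverV : cover C \subset V.
Proof.
apply/bigcupsP => c /(subsetP split_subC) cE; case: ok => EV _ _ _ _.
by have /ksubP[] := subsetP EV c cE.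
Qed.

Lemma split_p4free : p4free C.
Proof. by apply: p4freeS split_subC _; case: ok. Qed.

Lemma split_disjoint : [disjoint cover C & cover D].
Proof.
apply/pred0P => x /=; apply/negP => /andP[/bigcupP[c cC xc] /bigcupP[d dD xd]].
by case: ok => _ _ _ [_ /sepP/(_ c d cC dD)/meetPn/(_ x xc xd)].
Qed.

Lemma rest_thin b : b \in B -> b \subset V /\ #|b| = 3.
Proof. by rewrite !inE => /andP[_ bE]; case: ok => /subsetP/(_ b bE)/ksubP. Qed.

Lemma rest_meet b c : b \in B -> c \in C -> meet b c.
Proof.
by rewrite !inE => /andP[nb bE] cC; case: ok => _ _ _ _; apply; rewrite // !inE // cC.
Qed.

Lemma rest_sub : B \subset E. Proof. exact: subsetDl. Qed.

End Split.

Section Split2.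
Variables (V : {set T}) (E C D : {set {set T}}).
Hypothesis ok : split_ok V E C D.
Let ok' := split_ok_sym ok.
Let B := rest E C D.

Lemma split_card : #|E| = #|C| + #|D| + #|B|.
Proof.
have CD : [disjoint C & D].
  apply/pred0P => c /=; apply/negP => /andP[cC cD].
  have [x xc] : exists x, x \in c by apply/set0Pn; rewrite -card_gt0 (split_thin ok cC).
  have /pred0P/(_ x) /= := split_disjoint ok.
  by rewrite (subsetP (sub_cover cC)) ?(subsetP (sub_cover cD)).
rewrite -(cardsID (C :|: D) E) -/(rest E C D) -/B; congr (_ + _).
case: ok => _ _ _ [sE _] _; rewrite (setIidPr sE).
by rewrite cardsU (disjoint_setI0 CD) cards0 subn0.
Qed.

Lemma split_size : #|cover C| + #|cover D| <= #|V|.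
Proof.
have := cardsUI (cover C) (cover D); rewrite (disjoint_setI0 (split_disjoint ok)) cards0 addn0 => <-.
by rewrite subset_leq_card // subUset (split_coverV ok) (split_coverV ok').
Qed.

Lemma rest_meetD b d : b \in B -> d \in D -> meet b d.
Proof. by rewrite /B rest_sym; exact: (rest_meet ok'). Qed.

Lemma rest_bound : (#|V| <= 8 -> #|B| <= 18) /\ (8 <= #|V| -> #|B| + 6 <= 3 * #|V|).
Proof.
have [EV pE [/set0Pn[c cC] /set0Pn[d dD]] [_ /sepP CD] _] := ok.
have cV := subsetP EV c (subsetP (split_subC ok) c cC).
have dV := subsetP EV d (subsetP (split_subC ok') d dD).
have BV : B \subset ksub V 3 := subset_trans (rest_sub E C D) EV.
have pB : p4free B := p4freeS (rest_sub E C D) pE.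
have Bm b : b \in B -> meet b c /\ meet b d.
  by move=> bB; rewrite (rest_meet ok) // rest_meetD.
by split=> hV; [apply: (cross_bound8 cV dV) | apply: (cross_bound cV dV)] => //; exact: CD.
Qed.

(* An edge of the rest missing the kernel of [C] meets [cover C] in a pair covering [C],
   hence [cover D] in a single vertex, which lies in the kernel of [D]. *)
Lemma rest_shape b : b \in B -> ~~ meet b (kernel C) ->
  exists z q, [/\ z \in kernel D, q \in pcovers C & b = z |: q].
Proof.
move=> bB bK; have [bV b3] := rest_thin ok bB.
have [_ _ [/set0Pn[c0 c0C] /set0Pn[d0 d0D]] _ _] := ok.
have CV c : c \in C -> meet c (b :&: cover C).
  move=> cC; have /meetP[x xb xc] := rest_meet ok bB cC.
  by apply/meetP; exists x; rewrite // inE xb (subsetP (sub_cover cC)).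
have DV d : d \in D -> meet d (b :&: cover D).
  move=> dD; have /meetP[x xb xd] := rest_meetD bB dD.
  by apply/meetP; exists x; rewrite // inE xb (subsetP (sub_cover dD)).
have sum3 : #|b :&: cover C| + #|b :&: cover D| <= 3.
  have := cardsUI (b :&: cover C) (b :&: cover D).
  have -> : b :&: cover C :&: (b :&: cover D) = set0.
    by rewrite setIACA setIid (disjoint_setI0 (split_disjoint ok)) setI0.
  by rewrite cards0 addn0 => <-; rewrite -b3 -setIUr subset_leq_card ?subsetIl.
have D1 : 0 < #|b :&: cover D|.
  by have /meetP[x _ xb] := DV d0 d0D; apply/card_gt0P; exists x.
have C2 : 2 <= #|b :&: cover C|.
  rewrite ltnNge; apply/negP => le1.
  have /eqP/cards1P[y yE] : #|b :&: cover C| = 1.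
    have : 0 < #|b :&: cover C| by have /meetP[x _ xb] := CV c0 c0C; apply/card_gt0P; exists x.
    by move: le1; card_lia.
  have yK : y \in kernel C.
    by apply/kernelP => c /CV; rewrite yE => /meetP[x xc /set1P <-].
  have yb : y \in b by have := set11 y; rewrite -yE inE => /andP[].
  by move/meetP: bK; apply; exists y.
have c2 : #|b :&: cover C| = 2 by move: C2 D1 sum3; card_lia.
have /eqP/cards1P[z zE] : #|b :&: cover D| = 1 by move: C2 D1 sum3; card_lia.
exists z, (b :&: cover C); split.
- by apply/kernelP => d /DV; rewrite zE => /meetP[x xd /set1P <-].
- rewrite inE; apply/andP; split; last by apply/forall_inP.
  apply/ksubP; split=> //; apply/subsetP => x; rewrite !inE => /andP[xb ->]; rewrite andbT.
  by apply/negP => xK; move/meetP: bK; apply; exists x; rewrite // inE.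
have zI : z \in b :&: cover D by rewrite zE set11.
apply/esym/eqP; rewrite eqEcard subUset subsetIl sub1set andbT.
move: zI; rewrite inE => /andP[-> zD] /=; rewrite b3 cardsU1 c2 inE.
have /pred0P/(_ z) /= := split_disjoint ok; rewrite zD andbT => ->.
by rewrite andbF.
Qed.

Lemma rest_miss : #|[set b in B | ~~ meet b (kernel C)]| <= #|kernel D| * #|pcovers C|.
Proof.
rewrite -cardsX; apply: leq_trans (leq_imset_card (fun p : T * {set T} => p.1 |: p.2) _).
apply/subset_leq_card/subsetP => b; rewrite inE => /andP[bB bK].
have [z [q [zD qC ->]]] := rest_shape bB bK.
by apply/imsetP; exists (z, q); rewrite // in_setX zD qC.
Qed.

End Split2.
End Kernel.

(* For [m = 7, 8] these are not the exact maxima, but they suffice. *)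
Definition p4_bound m := if m <= 6 then 'C(m, 3) else if m == 7 then 27 else if m == 8 then 32 else 'C(m.-1, 2) + 1.

(** * Arithmetic of the two thresholds *)

Lemma small_leq n k k' : k' <= k -> small n k -> small n k'.
Proof. by rewrite /small; lia. Qed.

Lemma small_mono n n' k : n <= n' -> small n k -> small n' k.
Proof. by rewrite /small => nn'; have := @leq_bin2l (n - 3) (n' - 3) 2 ltac:(lia); lia. Qed.

Lemma iota_all2 (P : nat -> nat -> bool) i l j k a b :
  all (fun a => all (P a) (iota j k)) (iota i l) -> i <= a < i + l -> j <= b < j + k -> P a b.
Proof.
by move=> /allP h ia jb; have /allP := h a ltac:(by rewrite mem_iota); apply; rewrite mem_iota.
Qed.

Lemma p4_bound_big m : 9 <= m -> p4_bound m = 'C(m.-1, 2) + 1.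
Proof. by move=> m9; rewrite /p4_bound; case: ifP => [|_]; [lia|]; case: eqP => [|_]; [lia|]; case: eqP => //; lia. Qed.

Lemma p4_bound_mid m : 4 <= m -> m <= 8 -> p4_bound m <= 32 /\ p4_bound m + 28 <= 8 * m + 'C(m - 2, 2).
Proof.
move=> m4 m8; have : m \in iota 4 5 by rewrite mem_iota; lia.
by rewrite !inE => /or4P[|||/orP[]] /eqP->.
Qed.

(** The comparison is with ['C(n - 3, 2) + 7], where [n - 3] is at least [a + b]; the constant is
    [7 - 1]. *)
Lemma small_bin a b n k : a + b + 3 <= n -> k <= 'C(b, 2) + a * b + 'C(a, 2) + 6 -> small n k.
Proof.
move=> abn le; apply: (@small_mono (a + b + 3)) => //; rewrite /small.
by rewrite addnK bin2_add; apply/orP; right; lia.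
Qed.

Lemma bin2_pred m : 2 <= m -> 'C(m - 1, 2) = 'C(m - 2, 2) + (m - 2).
Proof. by case: m => [|[|m]] // _; rewrite !subSS !subn0 binS bin1. Qed.

Lemma small_bound_bound a b n : 9 <= n -> 4 <= a -> 4 <= b -> a + b <= n -> small n (p4_bound a + p4_bound b).
Proof.
wlog ab : a b / a <= b.
  by move=> wl n9 a4 b4 abn; case: (leqP a b) => [|/ltnW] h; [|rewrite addnC]; apply: wl => //; rewrite addnC.
move=> n9 a4 b4 abn; have [b8|b9] := leqP b 8.
  (* For given [a] and [b] the least admissible [n] is the hardest, so a finite table suffices. *)
  apply: (@small_mono (maxn 9 (a + b))); first by rewrite geq_max n9.
  by apply: (@iota_all2 (fun a b => small (maxn 9 (a + b)) (p4_bound a + p4_bound b)) 4 5 4 5); [vm_compute|lia..].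
apply: (@small_bin (a - 2) (b - 1)); first lia.
rewrite (p4_bound_big b9) -subn1; have [a8|a9] := leqP a 8.
  by have [_] := p4_bound_mid a4 a8; nia.
rewrite (p4_bound_big a9) -subn1 (@bin2_pred a); [nia|lia].
Qed.

(** In this and the following comparisons the summands bound the two parts and the rest. Here the
    second part has a kernel of one vertex and the first has at most three covering pairs. *)
Lemma small_bound_star m r n : 9 <= n -> 4 <= m -> 4 <= r -> m + r <= n -> small n (p4_bound m + 'C(r - 1, 2) + 3).
Proof.
move=> n9 m4 r4 mrn; have [m8|m9] := leqP m 8.
  have [r8|r9] := leqP r 8.
    apply: (@small_mono (maxn 9 (m + r))); first by rewrite geq_max n9.
    by apply: (@iota_all2 (fun a b => small (maxn 9 (a + b)) (p4_bound a + 'C(b - 1, 2) + 3)) 4 5 4 5); [vm_compute|lia..].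
  apply: (@small_bin (m - 2) (r - 1)); first lia.
  by have [_] := p4_bound_mid m4 m8; nia.
apply: (@small_bin (r - 2) (m - 1)); first lia.
rewrite (p4_bound_big m9) -subn1 (@bin2_pred r); [nia|lia].
Qed.

Lemma small_far_star m r n c : 9 <= n -> 4 <= m -> 4 <= r -> m + r <= n -> c + 12 <= 4 * m ->
  small n (c + 'C(r - 1, 2) + 9).
Proof.
move=> n9 m4 r4 mrn cm; apply: (@small_leq _ (4 * m - 12 + 'C(r - 1, 2) + 9)); first lia.
apply: (@small_bin (m - 2) (r - 1)); first lia.
have : m - 3 <= 'C(m - 2, 2).
  by case: m {mrn cm} m4 => [|[|[|[|m]]]] // _; rewrite !subSS !subn0 binS bin1; lia.
nia.
Qed.

(** [a] and [b] count the vertices of two parts other than their centres, and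
    [n + 6 = (n - 2) + 4 + 4] bounds the rest: the edges through both centres, and those through
    only one of them. *)
Lemma small_stars a b n : 9 <= n -> 3 <= a -> 3 <= b -> a + b + 2 <= n -> small n ('C(a, 2) + 'C(b, 2) + n + 6).
Proof.
wlog ab : a b / a <= b.
  move=> wl n9 a3 b3 abn; case: (leqP a b) => [|/ltnW] h; [|rewrite ['C(a, 2) + _]addnC]; apply: wl => //.
  by rewrite [b + a]addnC.
(* With [t = n - (a + b + 2)], this inequality is what remains of the comparison once
   ['C(b - 1 + t, 2)] is replaced by ['C(b - 1, 2)]. If it fails, then [b <= 6] and [n <= 11], and a
   table decides. *)
move=> n9 a3 b3 abn; have [h|h] := leqP 5 ((a - 2) * (b - 2) + (a - 1) * (n - (a + b + 2))).
  apply: (@small_bin a (n - a - 3)); first lia.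
  have [a' ea] : exists a', a = a' + 2 by exists (a - 2); lia.
  have [b' eb] : exists b', b = b' + 2 by exists (b - 2); lia.
  have [t nt] : exists t, n = a + b + 2 + t by exists (n - (a + b + 2)); lia.
  have -> : n - a - 3 = (b' + 1) + t by lia.
  have := @leq_bin2l (b' + 1) (b' + 1 + t) 2 ltac:(lia).
  have -> : 'C(b, 2) = 'C(b' + 1, 2) + (b' + 1) by rewrite eb addn2 addn1 binS bin1.
  have t1 : n - (a + b + 2) = t by lia.
  have [t2 [t3 t4]] : a - 2 = a' /\ b - 2 = b' /\ a - 1 = a' + 1 by lia.
  by move: h; rewrite t1 t2 t3 t4 nt ea eb; clear; lia.
have b6 : b <= 6 by nia.
have n11 : n <= 11 by nia.
have : all (fun a => all (fun b => all (fun n => [|| n < a + b + 2, n < 9,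
    4 < (a - 2) * (b - 2) + (a - 1) * (n - (a + b + 2)) | small n ('C(a, 2) + 'C(b, 2) + n + 6)])
    (iota 9 3)) (iota 3 4)) (iota 3 4) by vm_compute.
have mem3 c : 3 <= c <= 6 -> c \in iota 3 4 by rewrite mem_iota; lia.
move/allP/(_ a (mem3 a _))/allP/(_ b (mem3 b _))/allP/(_ n); rewrite mem_iota a3 b3 b6 (leq_trans ab b6).
move/(_ isT isT); rewrite n9 => /(_ ltac:(lia)) /or4P[|||//]; lia.
Qed.

(** [s] is the size of a part whose edges share two vertices, and [2 n - 4] bounds the rest edges
    through the centre of the other part. *)
Lemma small_star_book a s n : 3 <= a -> 3 <= s -> a + s + 3 <= n -> small n ('C(a, 2) + s + (2 * n - 4)).
Proof.
move=> a3 s3 asn; apply: (@small_bin a (n - a - 3)); first lia.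
have [u [nu u3]] : exists u, n = a + 3 + u /\ s <= u by exists (n - a - 3); lia.
have -> : n - a - 3 = u by lia.
have : u <= 'C(u, 2).
  have [v ->] : exists v, u = 3 + v by exists (u - 3); lia.
  by rewrite bin2_add (_ : 'C(3, 2) = 3) //; lia.
nia.
Qed.

Lemma p4_boundE : (p4_bound 4 = 4) * (p4_bound 5 = 10) * (p4_bound 6 = 20) * (p4_bound 7 = 27) * (p4_bound 8 = 32).
Proof. by []. Qed.

Lemma binE : ('C(4.-1, 2) = 3) * ('C(5.-1, 2) = 6) * ('C(6.-1, 2) = 10) * ('C(7.-1, 2) = 15) * ('C(8.-1, 2) = 21).
Proof. by []. Qed.

(** The other part has a kernel of two vertices, hence at most [n - m - 2] edges, and three covering
    pairs give at most [2 * 3] rest edges. *)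
Lemma small_bound_book m n : 4 <= m -> m + 4 <= n -> 9 <= n -> small n (p4_bound m + (n - m - 2) + 6).
Proof.
move=> m4 mn n9; have [m8|m9] := leqP m 8.
  have : m \in iota 4 5 by rewrite mem_iota; lia.
  rewrite /small !inE => /or4P[|||/orP[]] /eqP em; rewrite em in mn *;
    clear em; rewrite p4_boundE; apply/orP; left; lia.
apply: (@small_bin (n - m - 2) (m - 1)); first lia.
have : (n - m - 2) * 8 <= (n - m - 2) * (m - 1) by rewrite leq_mul2l; lia.
by rewrite (p4_bound_big m9) -subn1; lia.
Qed.

(** [4 = 1 + 3]: a single edge opposite, and one covering pair joined to each of its vertices. *)
Lemma small_bound_edge m n : 4 <= m -> m + 3 <= n -> 10 <= n -> small n (p4_bound m + 4).
Proof.
move=> m4 mn n9; have [m8|m9] := leqP m 8.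
  have : m \in iota 4 5 by rewrite mem_iota; lia.
  rewrite /small !inE => /or4P[|||/orP[]] /eqP em; rewrite em in mn *;
    clear em; rewrite p4_boundE; apply/orP; left; lia.
apply: (@small_bin (n - m - 2) (m - 1)); first lia.
have : m - 1 <= (n - m - 2) * (m - 1) by rewrite leq_pmull //; lia.
by rewrite (p4_bound_big m9) -subn1; lia.
Qed.

(** [10 = 1 + 3 * 3]: again a single edge opposite, now with three covering pairs. *)
Lemma small_near_edge m n c : 4 <= m -> m + 3 <= n -> 10 <= n -> c <= p4_bound m -> c + 3 <= 'C(m.-1, 2) + m ->
  small n (c + 10).
Proof.
move=> m4 mn n9 cf cm; have [m8|m9] := leqP m 8.
  have : m \in iota 4 5 by rewrite mem_iota; lia.
  rewrite /small !inE => /or4P[|||/orP[]] /eqP em; move: cf cm; rewrite em in mn *;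
    clear em; rewrite binE p4_boundE => cf cm; apply/orP; left; lia.
apply: (@small_bin (n - m - 2) (m - 1)); first lia.
have : m - 1 <= (n - m - 2) * (m - 1) by rewrite leq_pmull //; lia.
by move: cf; rewrite (p4_bound_big m9) -subn1; lia.
Qed.

(** * Classification of the large systems *)

Section Main.
Variable T : finType.
Implicit Types (x y s t u v : T) (V : {set T}) (b c d e f g h q : {set T}) (B C D E L P Q : {set {set T}}).

Definition p4_bound_ok m := forall V E, #|V| = m -> E \subset ksub V 3 -> p4free E -> #|E| <= p4_bound m.

Definition classified V E := [\/ star1 E, small #|V| #|E|,
    exists2 x, x \in V & SP_shape V E x /\ #|E| + 18 = 5 * #|V|
  | exists2 x, x \in V & CB_shape V E x /\ #|E| = 'C(#|V| - 3, 2) + 7].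

Lemma star1_le V E : E \subset ksub V 3 -> star1 E -> #|E| <= 'C(#|V|.-1, 2) + 1.
Proof.
move=> EV [x ox]; rewrite -(card_at_off E x) leq_add //.
case: (boolP (x \in V)) => [xV|xV]; first exact: at_bin.
rewrite (_ : at_ E x = set0) ?cards0 //; apply/setP => e; rewrite !inE.
apply/negP => /andP[/(subsetP EV)/ksubP[/subsetP eV _] xe].
by rewrite (eV x xe) in xV.
Qed.

Lemma split_exists V E : E \subset ksub V 3 -> p4free E ->
  (forall e f, e \in E -> f \in E -> meet e f) \/ exists C D, split_ok V E C D.
Proof.
move=> EV pE; case: (boolP [forall e in E, forall f in E, meet e f]) => [h|].
  by left=> e f eE fE; move/forall_inP: h => /(_ e eE)/forall_inP/(_ f fE).
case/forall_inPn => e eE /forall_inPn[f fE ef]; right.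
have E0 : set0 \notin E by apply: contra (@set0_ksub T V 3 isT) => /(subsetP EV).
have [C [D [C0 D0 sE sCD Bm]]] := p4free_split pE E0 eE fE ef.
by exists C, D; split.
Qed.

(** Up to six vertices all triples are allowed. On seven or eight, a pairwise intersecting system
    has at most 25 edges; otherwise the two parts live on disjoint sets of three to five vertices,
    with at most 18 edges in the rest. *)
Lemma p4_bound_small m : m <= 8 -> p4_bound_ok m.
Proof.
move=> m8 V E Vm EV pE; have [m6|m7] := leqP m 6.
  by rewrite /p4_bound m6 -Vm -card_ksub subset_leq_card.
have fm : 27 <= p4_bound m /\ (m = 8 -> p4_bound m = 32).
  have : m \in [:: 7; 8] by rewrite !inE; lia.
  by rewrite !inE => /orP[] /eqP->.
have [EE|[C [D ok]]] := split_exists EV pE.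
  have [|/(star1_le EV)|] := intersecting_le _ EV EE; rewrite Vm //; first lia.
    have : m \in [:: 7; 8] by rewrite !inE; lia.
    by rewrite !inE => /orP[] /eqP ->; rewrite /p4_bound /= => /leq_trans; apply.
  by move: fm m8; clear; lia.
have le18 := (rest_bound ok).1; rewrite Vm in le18; have {}le18 := le18 m8.
have := split_card ok; have := split_size ok; rewrite Vm.
have [_ _ [C0 D0] _ _] := ok; have ok' := split_ok_sym ok.
have := cover_ge3 (split_thin ok) C0; have := cover_ge3 (split_thin ok') D0.
have := subset_leq_card (cover_ksub (split_thin ok)); rewrite card_ksub.
have := subset_leq_card (cover_ksub (split_thin ok')); rewrite card_ksub.
move: #|cover C| #|cover D| => a b hb ha b3 a3 ab ->.
suff : 'C(b, 3) + 'C(a, 3) + 18 <= p4_bound m by move: hb ha le18; card_lia.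
have : all (fun a => all (fun b : nat => all (fun m => (m < a + b) || ('C(b, 3) + 'C(a, 3) + 18 <= p4_bound m)) [:: 7; 8])
   (iota 3 3)) (iota 3 3) by vm_compute.
have mem3 (c : nat) : 3 <= c <= 5 -> c \in iota 3 3 by rewrite mem_iota; lia.
have m78 : m \in [:: 7; 8] by rewrite !inE; lia.
have ha' : 3 <= a <= 5 by lia.
have hb' : 3 <= b <= 5 by lia.
by move/allP/(_ a (mem3 a ha'))/allP/(_ b (mem3 b hb'))/allP/(_ m m78); lia.
Qed.

Lemma classified_le V E : 9 <= #|V| -> E \subset ksub V 3 -> classified V E -> #|E| <= p4_bound #|V|.
Proof.
move=> V9 EV; rewrite p4_bound_big //; have [t nt] : exists t : nat, #|V| = 9 + t by exists (#|V| - 9); lia.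
have -> : #|V|.-1 = 8 + t by rewrite nt; lia.
have e3 : #|V| - 3 = 6 + t by rewrite nt; lia.
have := bin2_add 8 t; have := bin2_add 6 t; rewrite (_ : 'C(8, 2) = 28) // (_ : 'C(6, 2) = 15) // => e6 e8.
case=> [/(star1_le EV)||[x xV [_]]|[x xV [_ ->]]].
- by rewrite nt.
- by rewrite /small e3 nt; move: e6 e8; card_lia.
- by rewrite nt; move: e6 e8; card_lia.
by rewrite e3; move: e6 e8; card_lia.
Qed.

(** * Splits with an empty kernel or with two large ones *)

Section Step.
Variables (V : {set T}) (E C D : {set {set T}}).
Hypotheses (V9 : 9 <= #|V|) (ok : split_ok V E C D).
Hypothesis IH : forall m, m < #|V| -> p4_bound_ok m.
Let B := rest E C D.
Let n := #|V|.
Let ok' : split_ok V E D C := split_ok_sym ok.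
Let C3 : thin C := split_thin ok.
Let D3 : thin D := split_thin ok'.
Let C0 : C != set0. Proof. by case: ok => _ _ []. Qed.
Let D0 : D != set0. Proof. by case: ok => _ _ []. Qed.

Lemma rest_le : #|B| + 6 <= 3 * n.
Proof. by apply: (rest_bound ok).2; apply: leq_trans V9. Qed.

Lemma card_leC : #|C| <= p4_bound #|cover C|.
Proof.
apply: IH (cover_ksub C3) (split_p4free ok) => //.
have := split_size ok; have := cover_ge3 D3 D0; card_lia.
Qed.

(** At most [n - 4] edges in the two parts and [3 n - 6] in the rest make [4 n - 10], which is below
    [5 n - 18] from nine vertices on. *)
Lemma small_kernels22 : 2 <= #|kernel C| -> 2 <= #|kernel D| -> small n #|E|.
Proof.
move=> /(kernel2_card C3 C0) kC /(kernel2_card D3 D0) kD.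
have := rest_le; have := split_card ok; have := split_size ok; rewrite /small -/B -/n.
by move: V9 kC kD; rewrite -/n; move: n => m; card_lia.
Qed.

Lemma rest_all_miss : #|kernel C| = 0 -> #|B| <= #|kernel D| * #|pcovers C|.
Proof.
move=> k0; have <- : #|[set b in B | ~~ meet b (kernel C)]| = #|B|; last exact: (rest_miss ok).
apply: eq_card => b; rewrite inE; case: (b \in B) => //=.
by apply/meetPn => x _; rewrite (cards0_eq k0) inE.
Qed.

(** A rest edge would contain a vertex of the kernel of [D], so the rest is empty. *)
Lemma small_kernels00 : #|kernel C| = 0 -> #|kernel D| = 0 -> small n #|E|.
Proof.
move=> kC kD; have := rest_all_miss kC; rewrite kD mul0n leqn0 => /eqP B0.
rewrite (split_card ok) -/B B0 addn0; have C4 := cover_ge4 C3 C0; have D4 := cover_ge4 D3 D0.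
have fD : #|D| <= p4_bound #|cover D|.
  apply: IH (cover_ksub D3) (split_p4free ok') => //.
  have := split_size ok; have := cover_ge3 C3 C0; card_lia.
apply: (small_leq (leq_add card_leC fD)); apply: small_bound_bound => //; last exact: (split_size ok).
  by apply: C4; rewrite kC.
by apply: D4; rewrite kD.
Qed.

Lemma kernel0_cases : #|kernel C| = 0 ->
  [\/ #|pcovers C| <= 1,
      #|pcovers C| <= 3 /\ #|C| + 3 <= 'C(#|cover C|.-1, 2) + #|cover C|
    | [/\ #|C| + 12 <= 4 * #|cover C|,
          5 <= #|pcovers C| -> (#|C| <= 8) || (#|C| <= #|cover C| + 4) && (#|pcovers C| <= 6),
          8 <= #|pcovers C| -> #|C| <= 4 & #|pcovers C| <= 9]].
Proof.
move=> k0; have CV := cover_ksub C3; have PV := pcovers_sub C.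
have CP := @pcovers_cross T C; have kf := kernel0 k0.
case: (boolP [exists p in pcovers C, exists q in pcovers C, ~~ meet p q]).
  case/exists_inP => p pP /exists_inP[q qP pq]; apply: Or33.
  by have [h1 h2 h3] := far_covers CV PV CP kf pP qP pq; split=> //; exact: (cover_le9 CV PV CP kf).
move=> /exists_inPn h; have PP p q : p \in pcovers C -> q \in pcovers C -> meet p q.
  by move=> pP qP; have /exists_inPn/(_ q qP)/negbNE := h p pP.
have [p3 h2] := near_covers CV PV CP kf PP.
by case: (leqP 2 #|pcovers C|) => [/h2 h2'|p1]; [apply: Or32|apply: Or31].
Qed.

Lemma small_kernels01 : #|kernel C| = 0 -> #|kernel D| = 1 -> small n #|E|.
Proof.
move=> kC kD; have := rest_all_miss kC; rewrite kD mul1n => leB.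
have C4 : 4 <= #|cover C| by apply: cover_ge4; rewrite ?kC.
have D4 : 4 <= #|cover D| by apply: cover_ge4; rewrite ?kD.
have /cards1P[x Kx] : #|kernel D| == 1 by rewrite kD.
have cD : #|D| <= 'C(#|cover D| - 1, 2).
  rewrite -(card_center Kx) (leq_trans (subset_leq_card (link_center x D3))) // card_ksub.
  by rewrite (cardsD1 x (cover D)) (center_cover D0 Kx) add1n subn1.
rewrite (split_card ok) -/B; have fC := card_leC; have sz := split_size ok.
have near : #|pcovers C| <= 3 -> small n (#|C| + #|D| + #|B|).
  move=> p3; apply: (small_leq _ (small_bound_star V9 C4 D4 sz)).
  by move: leB p3 fC cD; card_lia.
case: (kernel0_cases kC) => [p1|[p3 _]|[far _ _ p9]]; [|exact: near|].
  by apply: near; apply: leq_trans p1 _.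
by apply: (small_leq _ (small_far_star V9 C4 D4 sz far)); move: leB p9 cD; card_lia.
Qed.

Lemma small_kernels02 : #|kernel C| = 0 -> #|kernel D| = 2 -> small n #|E|.
Proof.
move=> kC kD; have := rest_all_miss kC; rewrite kD => leB.
have C4 : 4 <= #|cover C| by apply: cover_ge4; rewrite ?kC.
have D4 : 4 <= #|cover D| by apply: cover_ge4; rewrite ?kD.
have cD : #|D| + 2 <= #|cover D| by apply: kernel2_card; rewrite ?kD.
rewrite (split_card ok) -/B; have fC := card_leC; have sz := split_size ok.
have near : #|pcovers C| <= 3 -> small n (#|C| + #|D| + #|B|).
  move=> p3; apply: (small_leq _ (@small_bound_book #|cover C| n C4 _ V9)).
    by move: leB p3 fC cD sz; rewrite -/n; move: n => k; card_lia.
  by move: D4 sz; rewrite -/n; move: n => k; card_lia.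
case: (kernel0_cases kC) => [p1|[p3 _]|[far h5 h8 p9]]; [|exact: near|].
  by apply: near; apply: leq_trans p1 _.
(* The three ranges of [#|pcovers C|] give totals of at most [n + 16], [n + 16] and [4 n - 18]. *)
rewrite /small; apply/orP; left.
have [p8|p8] := leqP 8 #|pcovers C|.
  by move: (h8 p8) leB p9 cD sz C4 V9; rewrite -/n; move: n => k; card_lia.
have [p5|p5] := leqP 5 #|pcovers C|.
  by move: (h5 p5) p8 leB cD sz C4 D4 V9; rewrite -/n; move: n => k; card_lia.
by move: far p5 leB cD sz D4 V9; rewrite -/n; move: n => k; card_lia.
Qed.

Lemma small_kernels03 : #|kernel C| = 0 -> #|kernel D| = 3 -> small n #|E|.
Proof.
move=> kC kD; have := rest_all_miss kC; rewrite kD => leB; have leB' := rest_le.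
have C4 : 4 <= #|cover C| by apply: cover_ge4; rewrite ?kC.
have [DE VD] := kernel3 D3 D0 kD.
have cD : #|D| = 1 by rewrite DE cards1.
have sz := split_size ok; rewrite VD kD in sz.
rewrite (split_card ok) -/B cD; have fC := card_leC.
(* With five to seven covering pairs the general bounds only give [8 + 1 + 21] edges, too many for
   nine vertices; there [cover_six] treats the six vertices off [D]. *)
have [n10|n9] := leqP 10 n; last first.
  have nE : n = 9 by move: n9 V9; rewrite -/n; move: n => k; card_lia.
  have DV : cover D \subset V := split_coverV ok'.
  have A6 : #|V :\: cover D| = 6 by rewrite cardsD (setIidPr DV) VD kD -/n nE.
  have CA : cover C \subset V :\: cover D.
    by rewrite subsetD (split_coverV ok) (split_disjoint ok).
  have up k (F : {set {set T}}) : F \subset ksub (cover C) k -> F \subset ksub (V :\: cover D) k.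
    move=> /subsetP FC; apply/subsetP => c /FC/ksubP[cC ck]; apply/ksubP; split=> //.
    exact: subset_trans CA.
  have := cover_six A6 (up 3 _ (cover_ksub C3)) (up 2 _ (pcovers_sub C)) (@pcovers_cross T C) (kernel0 kC).
  by rewrite /small nE; move: leB leB'; rewrite nE; card_lia.
have mn : #|cover C| + 3 <= n by [].
case: (kernel0_cases kC) => [p1|[p3 near]|[far h5 h8 p9]].
- by apply: (small_leq _ (small_bound_edge C4 mn n10)); move: leB p1 fC; card_lia.
- by apply: (small_leq _ (small_near_edge C4 mn n10 fC near)); move: leB p3; card_lia.
rewrite /small; apply/orP; left.
have [p8|p8] := leqP 8 #|pcovers C|.
  by move: (h8 p8) leB' n10; move: n => k; card_lia.
have [p5|p5] := leqP 5 #|pcovers C|.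
  by move: (h5 p5) p8 leB n10 mn; move: n => k; card_lia.
by move: far p5 leB mn n10; move: n => k; card_lia.
Qed.

End Step.
End Main.

(** * A part whose kernel is a single vertex *)

Section OneCenter.
Variable T : finType.
Implicit Types (s t u v : T) (b c d e f g h q : {set T}) (L P Q : {set {set T}}).
Variables (V : {set T}) (E C D : {set {set T}}) (x : T).
Hypotheses (V9 : 9 <= #|V|) (ok : split_ok V E C D) (Kx : kernel C = [set x]).
Let B := rest E C D.
Let n := #|V|.
Let L := link C x.
Let Q := pcovers C.
Let ok' : split_ok V E D C := split_ok_sym ok.
Let C3 : thin C := split_thin ok.
Let D3 : thin D := split_thin ok'.
Let C0 : C != set0. Proof. by case: ok => _ _ []. Qed.
Let D0 : D != set0. Proof. by case: ok => _ _ []. Qed.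
Let EV : E \subset ksub V 3. Proof. by case: ok. Qed.
Let pE : p4free E. Proof. by case: ok. Qed.
Let xC : x \in cover C. Proof. exact: center_cover. Qed.
Let xV : x \in V. Proof. exact: (subsetP (split_coverV ok)). Qed.
Let cardL : #|L| = #|C|. Proof. exact: card_center. Qed.
Let L_free : kernel_free L. Proof. exact: link_kernel_free. Qed.
Let LQ : cross L Q. Proof. exact: pcovers_link. Qed.
Let LW : L \subset ksub (cover C :\ x) 2. Proof. exact: link_center. Qed.

Let QW : Q \subset ksub (cover C :\ x) 2.
Proof. by apply/subsetP => q; rewrite inE Kx => /andP[]. Qed.

Let L2 : pairwise2 L. Proof. by move=> l /(subsetP LW)/ksubP[]. Qed.
Let Q2 : pairwise2 Q. Proof. by move=> l /(subsetP QW)/ksubP[]. Qed.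
Let Q4 : #|Q| <= 4. Proof. exact: cross_le4 L2 Q2 LQ L_free. Qed.

Let card_coverx : #|cover C :\ x| + 1 = #|cover C|.
Proof. by rewrite (cardsD1 x (cover C)) xC addnC. Qed.

Let cover4 : 4 <= #|cover C|. Proof. by apply: cover_ge4; rewrite // Kx cards1. Qed.

Let xD : x \notin cover D.
Proof. by have /pred0P/(_ x) /= := split_disjoint ok; rewrite xC /= => ->. Qed.

Lemma card_L : #|L| <= 'C(#|cover C| - 1, 2).
Proof.
by rewrite -card_coverx addnK -card_ksub subset_leq_card.
Qed.

Lemma off_center : #|off_ E x| = #|D| + #|off_ B x|.
Proof.
have -> : off_ E x = D :|: off_ B x.
  apply/setP => b; rewrite !inE; case: (boolP (b \in D)) => bD; rewrite ?orbT ?orbF /=.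
    rewrite (subsetP (split_subC ok')) //=.
    by apply: contra xD => /(subsetP (sub_cover bD)).
  case: (boolP (b \in C)) => // bC.
  by rewrite (center_in Kx bC) !andbF.
rewrite cardsU (_ : D :&: off_ B x = set0) ?cards0 ?subn0 //.
by apply/setP => b; rewrite !inE; case: (b \in D); rewrite ?orbT //= andbF.
Qed.

Let missx b : ~~ meet b (kernel C) = (x \notin b).
Proof. by rewrite Kx -[[set x]]setUid meet2 orbb. Qed.

Lemma off_rest : #|off_ B x| <= #|kernel D| * #|Q|.
Proof.
apply: leq_trans (rest_miss ok); apply/subset_leq_card/subsetP => b.
by rewrite !inE missx => /andP[-> ->].
Qed.

Lemma few_off : 2 <= #|off_ E x| -> #|off_ E x| <= 4 -> classified V E.
Proof.
move=> o2 o4; case: (star_small EV pE xV V9 o2 o4) => [||].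
- exact: Or42.
- by move=> h; apply: Or43; exists x.
by move=> h; apply: Or44; exists x.
Qed.

(** * Nine vertices, with a single edge opposite five edges *)

Section Nine.
Variable e : {set T}.
Hypotheses (DE : D = [set e]) (De : cover D = e) (e3 : #|e| = 3) (n9 : n = 9) (L5 : #|L| = 5).
Let G := link E x.
Let X := [set g in ksub (V :\ x) 2 | meet g e].
Let Z q := [set u in e | u |: q \in B].

Let cardW : #|V :\ x| = 8.
Proof. by have := cardsD1 x V; rewrite xV -/n n9; card_lia. Qed.

Let eW : e \subset V :\ x.
Proof. by rewrite subsetD1 -De (split_coverV ok') xD. Qed.

(** Of the 28 pairs off [x], 18 meet [e], and [L] adds at most five. *)
Let cardX : #|X :|: L| <= 23.
Proof.
have := card_hit (V :\ x) e 2; rewrite cardW cardsD cardW (setIidPr eW) e3.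
rewrite -/X (_ : 'C(8 - 3, 2) = 10) // (_ : 'C(8, 2) = 28) // => hX.
by have := cardsU X L; move: hX; rewrite L5; card_lia.
Qed.

Let GX : G \subset X :|: L.
Proof.
apply/subsetP => g gG; have gW := subsetP (link_ksub x EV) g gG.
move: (gG); rewrite !inE => /andP[xg gE]; move: gW; rewrite inE => ->; rewrite xg /=.
case: (boolP (x |: g \in C)) => gC; first by rewrite orbT.
rewrite orbF; have xe : x \notin e by rewrite -De.
have gD : x |: g \notin D by rewrite DE inE; apply: contra xe => /eqP<-; rewrite setU11.
have eD : e \in D by rewrite DE set11.
have gB : x |: g \in B by rewrite !inE negb_or gC gD.
have := rest_meetD ok gB eD; rewrite meetC meetU -[[set x]]setUid meet2 orbb (negPf xe) /=.
by rewrite meetC.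
Qed.

Let q_out q u : q \in Q -> u \in e -> [/\ u \notin q, q \subset V :\ x & [disjoint q & e]].
Proof.
move=> qQ ue; have /ksubP[qC q2] := subsetP QW q qQ.
have dis : [disjoint q & e].
  rewrite -De; apply: disjointWl (split_disjoint ok).
  by apply: subset_trans qC (subD1set _ _).
split=> //; last by apply: subset_trans qC (setSD _ (split_coverV ok)).
by apply: contraTN dis => uq; apply/pred0Pn; exists u; rewrite /= uq ue.
Qed.

Let S q := (V :\ x) :\: (e :|: q).

Let S_card q : q \in Q -> #|S q| = 3.
Proof.
move=> qQ; have [u ue] : exists u, u \in e by apply/set0Pn; rewrite -card_gt0 e3.
have [_ qW qe] := q_out qQ ue; rewrite cardsD cardW (setIidPr _) ?subUset ?eW //.
by rewrite cardsU setIC (disjoint_setI0 qe) cards0 subn0 e3 Q2.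
Qed.

Let S_out q u : u \in e -> u \notin S q.
Proof. by move=> ue; rewrite 3!inE ue. Qed.

Let pencil_X u (R : {set T}) : u \in e -> R \subset V :\ x -> u \notin R -> [set [set u; t] | t in R] \subset X :|: L.
Proof.
move=> ue RW uR; apply: subset_trans (subsetUl _ _); apply/subsetP => g gR.
rewrite inE (subsetP (pencil_sub (subsetP eW u ue) RW uR)) //=.
by case/imsetP: gR => t _ ->; rewrite meetC meet2 ue.
Qed.

(** The edges [u |: q] and [v |: q] miss [x] and meet, so [star_dichotomy] applies. If the pairs of
    [G] cannot tell them apart, [G] contains none of the four pairs joining [u] to a vertex outside
    [u], [v] and [q]: [23 - 4 = 19]. *)
Lemma nine_alt q u v : q \in Q -> u \in Z q -> v \in Z q -> u != v ->
  #|G| <= 19 \/ forall g, g \in G -> meet g [set u; v] || meet g q.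
Proof.
move=> qQ; rewrite inE => /andP[ue uB]; rewrite inE => /andP[ve vB] uv.
have [uq qW qe] := q_out qQ ue; have [vq _ _] := q_out qQ ve.
have inD w : w \in e -> w |: q \in B -> w |: q \in off_ E x.
  move=> we wB; rewrite inE (subsetP (rest_sub E C D)) //= !inE negb_or.
  have := subsetP eW w we; rewrite !inE eq_sym => /andP[-> _] /=.
  by move: qW; rewrite subsetD1 => /andP[].
have [y yq] : exists y, y \in q by apply/set0Pn; rewrite -card_gt0 Q2.
have mt : meet (u |: q) (v |: q) by apply/meetP; exists y; rewrite !inE yq orbT.
have [h|h] := star_dichotomy pE (inD u ue uB) (inD v ve vB) mt; [right=> g gG|left].
  by have := h g gG; rewrite setUACA setUid meetU.
pose R := (V :\ x) :\: (u |: (v |: q)).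
have uR : u \notin R by rewrite !inE eqxx.
have R4 : #|R| = 4.
  rewrite cardsD cardW (setIidPr _); last by rewrite !subUset !sub1set qW !(subsetP eW).
  by rewrite !cardsU1 !inE (negPf uv) (negPf uq) (negPf vq) Q2.
have lose := lose_le GX (pencil_X ue (subsetDl _ _) uR).
rewrite (pencil_card uR) R4 in lose; suff : #|G| + 4 <= #|X :|: L| by move: cardX; card_lia.
apply: lose => g /imsetP[t]; rewrite inE => /andP[tn _] ->; apply/negP => /h.
rewrite meetC meet2 setU11 /= meetC meet2 !inE (negPf uv) (negPf uq) /=.
by move: tn; rewrite !inE !negb_or => /and3P[_ /negPf -> /negPf ->].
Qed.

(** In the second alternative of [nine_alt], the third vertex [w] of [e] is joined in [G] to none of
    the three vertices off [x], [e] and [q]: [23 - 3 = 20]. If [Z q] is all of [e], a second choice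
    of two vertices removes three more pairs. *)
Lemma nine_two q : q \in Q -> 2 <= #|Z q| -> #|G| <= 20 /\ (3 <= #|Z q| -> #|G| <= 19).
Proof.
move=> qQ /card_gt1P[u [v [uZ vZ uv]]].
have ue : u \in e by move: uZ; rewrite inE => /andP[].
have ve : v \in e by move: vZ; rewrite inE => /andP[].
have lost a a' w : a \in Z q -> a' \in Z q -> w \in e -> a != a' -> a != w -> a' != w ->
  #|G| <= 19 \/ forall g, g \in [set [set w; t] | t in S q] -> g \notin G.
  move=> aZ bZ we ab aw bw; have ae : a \in e by move: aZ; rewrite inE => /andP[].
  have be : a' \in e by move: bZ; rewrite inE => /andP[].
  have [wq _ _] := q_out qQ we.
  have [|h] := nine_alt qQ aZ bZ ab; [by left|right=> g /imsetP[t]].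
  rewrite in_setD in_setU negb_or => /andP[/andP[te tq] _] ->; apply/negP => gG; have := h _ gG.
  rewrite [meet _ q]meetC !meet2 !inE (negPf wq) (negPf tq) (negPf aw) (negPf bw) !orbF /=.
  by apply/negP; rewrite negb_or; apply/andP; split; apply: contraNneq te => <-.
have [w we] : exists w : T, w \in e :\: [set u; v].
  apply/set0Pn; rewrite -card_gt0 cardsD e3 (setIidPr _) ?subUset ?sub1set ?ue //.
  by rewrite cards2 uv.
move: we; rewrite !inE negb_or ![w == _]eq_sym => /andP[/andP[uw vw] we].
have [|h1] := lost u v w uZ vZ we uv uw vw.
  by move=> le; split=> //; apply: leq_trans le _.
have := lose_le GX (pencil_X we (subsetDl _ _) (S_out q we)) h1.
rewrite pencil_card ?S_out // S_card // => le20; split; first by move: le20 cardX; card_lia.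
move=> Z3; have ZE : Z q = e.
  by apply/eqP; rewrite eqEcard e3 Z3 andbT; apply/subsetP => y; rewrite inE => /andP[].
have wZ : w \in Z q by rewrite ZE.
have wv : w != v by rewrite eq_sym.
have [//|h2] := lost u w v uZ wZ ve uw uv wv.
pose M := [set [set w; t] | t in S q] :|: [set [set v; t] | t in S q].
have MX : M \subset X :|: L by rewrite subUset !pencil_X ?S_out ?subsetDl.
have MG g : g \in M -> g \notin G by rewrite inE => /orP[]; [exact: h1|exact: h2].
have := lose_le GX MX MG; rewrite cardsU !pencil_card ?S_out // S_card //.
rewrite (_ : _ :&: _ = set0) ?cards0; first by move: cardX; card_lia.
apply/setP => g; rewrite [RHS]inE; apply/negP; rewrite inE.
move=> /andP[/imsetP[t tS ->] /imsetP[t' t'S] wv'].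
have : v \in [set w; t] by rewrite wv' set21.
rewrite !inE (negPf vw) /= => /eqP vt.
by move: (S_out q ve); rewrite vt tS.
Qed.

(** The edges off [x] are [e] and some formed by a vertex of [e] and one of the two pairs of [Q]. If
    the larger set [Z q1] has size three, the total is at most [19 + 1 + 6]; if it has size two, at
    most [20 + 1 + 4]. *)
Lemma nine_le : #|Q| = 2 -> 5 <= #|off_ E x| -> #|G| + #|off_ E x| <= 26.
Proof.
move=> /eqP/cards2P[q1 [q2 [q12 QE]]]; rewrite off_center DE cards1 => o5.
have le12 : #|off_ B x| <= #|Z q1| + #|Z q2|.
  have sub : off_ B x \subset [set u |: q1 | u in Z q1] :|: [set u |: q2 | u in Z q2].
    apply/subsetP => b; rewrite inE -missx => /andP[bB bm].
    have [z [q [zD qQ bE]]] := rest_shape ok bB bm.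
    have ze : z \in e by move: zD => /kernelP; apply; rewrite DE set11.
    have : q \in Q by []; rewrite QE !inE => /orP[]/eqP qE; apply/orP; [left|right];
      by apply/imsetP; exists z; rewrite ?bE ?qE // inE ze -qE -bE.
  apply: leq_trans (subset_leq_card sub) _; rewrite cardsU.
  apply: leq_trans (leq_subr _ _) _; exact: leq_add (leq_imset_card _ _) (leq_imset_card _ _).
have Z3 q : #|Z q| <= 3.
  by rewrite -e3 subset_leq_card //; apply/subsetP => y; rewrite inE => /andP[].
wlog Z21 : q1 q2 q12 QE le12 / #|Z q2| <= #|Z q1|.
  move=> wl; case: (leqP #|Z q2| #|Z q1|) => [|/ltnW]; first exact: wl q12 QE le12.
  by apply: wl; rewrite 1?eq_sym // ?QE 1?setUC // addnC.
have q1Q : q1 \in Q by rewrite QE set21.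
have Z1 : 2 <= #|Z q1| by move: le12 Z21 o5; card_lia.
have [g20 g19] := nine_two q1Q Z1.
have [/g19|z2] := leqP 3 #|Z q1|.
  by have := Z3 q1; move: Z21 le12; rewrite -/G; card_lia.
by move: g20 z2 Z21 le12; rewrite -/G; card_lia.
Qed.

End Nine.

(** The number of covering pairs decides. None or one leaves few edges off [x], and three or more
    force [L] to be tiny. With two, the bound [4 n - 9] is below [5 n - 18] except for [n = 9];
    there [#|L| = 5], and [nine_le] saves the missing edge. *)
Lemma classified_kernels13 : #|kernel D| = 3 -> classified V E.
Proof.
move=> kD; have [DE VD] := kernel3 D3 D0 kD; set e := kernel D in DE VD kD.
have D1 : #|D| = 1 by rewrite DE cards1.
have sz := split_size ok; rewrite VD kD -/n in sz.
have off := off_center; rewrite D1 in off.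
have offB : #|off_ B x| <= 3 * #|Q| by rewrite -kD; exact: off_rest.
have Bn := rest_le V9 ok; rewrite -/B -/n in Bn.
have Ec := split_card ok; rewrite -/B D1 -cardL in Ec.
have small_L : #|L| <= 4 -> classified V E.
  move=> L4; apply: Or42; apply/orP; left; move: Ec Bn V9 L4; rewrite -/n; move: n => k; card_lia.
have [q0|q1] := leqP #|Q| 0; first by apply: Or41; exists x; move: off offB q0; card_lia.
have [q1'|q2] := leqP #|Q| 1.
  have [o1|o2] := leqP #|off_ E x| 1; first by apply: Or41; exists x.
  by apply: few_off => //; move: off offB q1'; card_lia.
have [q2'|q3] := leqP #|Q| 2; last first.
  by apply: small_L; have := cross_ge3 L2 Q2 LQ L_free q3; card_lia.
have {}q2 : #|Q| = 2 by move: q2 q2'; card_lia.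
have leL : #|L| <= maxn 4 #|cover C :\ x|.
  have /eqP/cards2P[l1 [l2 [l12 QE]]] := q2.
  have l1Q : l1 \in Q by rewrite QE !inE eqxx.
  have l2Q : l2 \in Q by rewrite QE !inE eqxx orbT.
  apply: (cover2 (subsetP QW _ l1Q) (subsetP QW _ l2Q) l12 LW) => l lL.
  by rewrite !LQ.
have [L4|L5] := leqP #|L| 4; first exact: small_L.
have [n10|n9] := leqP 10 n.
  apply: Or42; apply/orP; left; move: Ec Bn V9 L5 leL n10 sz card_coverx; rewrite -/n; move: n => k; card_lia.
have nE : n = 9 by move: n9 V9; rewrite -/n; move: n => k; card_lia.
have LE : #|L| = 5 by move: L5 leL sz card_coverx; rewrite nE; card_lia.
have [o4|o5] := leqP #|off_ E x| 4.
  have [o1|o2] := leqP #|off_ E x| 1; [by apply: Or41; exists x | exact: few_off].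
apply: Or42; apply/orP; left; rewrite -/n nE (card_star E x).
by have := nine_le DE VD kD nE LE q2 o5; card_lia.
Qed.

Lemma classified_kernels12 : #|kernel D| = 2 -> classified V E.
Proof.
move=> kD; have D2 : #|D| + 2 <= #|cover D| by apply: kernel2_card; rewrite ?kD.
have D4 : 4 <= #|cover D| by apply: cover_ge4; rewrite ?kD.
have [z [z' [zz' KE]]] := card2P kD.
have KV : kernel D \subset V :\ x.
  apply/subsetP => y yK; have /set0Pn[d dD] := D0; have yd := subsetP (kernel_sub dD) y yK.
  rewrite !inE (subsetP (split_coverV ok')) ?(subsetP (sub_cover dD)) // andbT.
  by apply: contraNneq xD => <-; apply: (subsetP (sub_cover dD)).
have Dgt1 : 1 < #|D|.
  rewrite ltnNge; apply/negP => D1; have /set0Pn[d dD] := D0.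
  suff : 3 <= #|kernel D| by rewrite kD.
  rewrite -(D3 dD); apply/subset_leq_card/subsetP => y yd; apply/kernelP => d' d'D.
  by have /card_le1_eqP/(_ d d' dD d'D) -> := D1.
(* The edges of [D] are the kernel plus one vertex each, so a covering pair off the kernel contains
   all these vertices. *)
have P1 : #|pcovers D| <= 1.
  rewrite -(cards1 (cover D :\: kernel D)); apply/subset_leq_card/subsetP => q.
  rewrite in_set1 inE => /andP[/ksubP[qV _] /forall_inP qD]; rewrite eqEsubset qV /=.
  apply/subsetP => y; rewrite inE => /andP[yK /bigcupP[d dD yd]].
  have dE : d = y |: kernel D.
    apply/esym/eqP; rewrite eqEcard subUset sub1set yd kernel_sub //= (D3 dD).
    by rewrite cardsU1 yK kD.
  have := qD d dD; rewrite dE meetC meetU -[[set y]]setUid meet2 orbb.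
  case/orP => // /meetP[u /(subsetP qV)]; rewrite inE => /andP[/negP uK _] uK'.
  by case: uK.
(* At most [2 (n - 1) - 3] pairs off [x] meet the kernel of [D], and at most one rest edge misses
   that kernel. *)
have center_le : #|at_ B x| <= 2 * n - 4.
  pose B1 := [set b in B | meet b (kernel D)].
  have B1V : B1 \subset ksub V 3.
    by apply/subsetP => b; rewrite inE => /andP[/(subsetP (rest_sub E C D))/(subsetP EV)].
  have KW : kernel D \in ksub (V :\ x) 2 by apply/ksubP.
  have xK : x \notin kernel D by apply: contraTN KV => xK; apply/subsetPn; exists x; rewrite // !inE eqxx.
  have := cover1 KW (link_ksub x B1V) _; rewrite card_link => le1.
  have {}le1 : #|at_ B1 x| + 3 <= 2 * #|V :\ x|.
    apply: le1 => g; rewrite inE => /andP[xg]; rewrite inE => /andP[_].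
    by rewrite meetC meetU -[[set x]]setUid meet2 orbb (negPf xK) /= meetC.
  have le2 := rest_miss ok'; rewrite Kx cards1 mul1n rest_sym -/B in le2.
  have sub : at_ B x \subset at_ B1 x :|: [set b in B | ~~ meet b (kernel D)].
    apply/subsetP => b; rewrite !inE => /andP[-> ->].
    by case: (meet b (kernel D)).
  have := subset_leq_card sub; have := cardsU (at_ B1 x) [set b in B | ~~ meet b (kernel D)].
  have := cardsD1 x V; rewrite xV -/n.
  by move: le1 le2 P1; move: n => k; card_lia.
have offB : #|off_ B x| <= 2 * #|Q| by rewrite -kD; exact: off_rest.
have off := off_center.
have Bn := rest_le V9 ok; rewrite -/B -/n in Bn.
have sz := split_size ok; rewrite -/n in sz.
have Bc := card_at_off B x.
have Ec := split_card ok; rewrite -/B -cardL in Ec.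
have Lb := card_L.
have [q0|q1] := leqP #|Q| 0.
  have [s2|s3] := leqP #|D| 2.
    by apply: few_off; move: offB off q0 s2 Dgt1; card_lia.
  apply: Or42; apply: small_leq (@small_star_book (#|cover C| - 1) #|D| n _ s3 _).
  - by move: Ec Bc Lb center_le offB q0; move: n => k; card_lia.
  - by move: cover4; card_lia.
  by move: sz D2 cover4; move: n => k; card_lia.
have [q2|q3] := leqP #|Q| 2.
  have /card_gt0P[q qQ] := q1.
  have := cover1 (subsetP QW q qQ) LW _; rewrite -(leq_add2r 2) => /(_ (fun l lL => LQ lL qQ)) hL.
  apply: Or42; apply/orP; left; rewrite -/n.
  by move: Ec Bc hL sz D2 D4 center_le offB q2 card_coverx V9; rewrite -/n; move: n => k; card_lia.
have L3 := cross_ge3 L2 Q2 LQ L_free q3.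
have Q3 : 3 <= #|L| -> #|Q| <= 3 by exact: cross_le3 L2 Q2 LQ L_free.
apply: Or42; apply/orP; left; rewrite -/n.
have [c5|c4] := leqP 5 #|cover C|.
  by move: Ec L3 c5 sz D2 Bn V9; rewrite -/n; move: n => k; card_lia.
have [L3'|L2'] := leqP 3 #|L|.
  by move: Ec Bc L3 (Q3 L3') offB center_le cover4 sz D2 V9; rewrite -/n; move: n => k; card_lia.
by move: Ec Bn L2' cover4 sz D2 V9; rewrite -/n; move: n => k; card_lia.
Qed.

(** Every rest edge contains [x] or [y], since one missing [x] has the form [z |: q] with [z] in the
    kernel of [D]. So the rest has at most [n - 2] edges through both centres and at most four
    through each alone. *)
Lemma classified_kernels11 y : kernel D = [set y] -> classified V E.
Proof.
move=> Ky; apply: Or42; have D4 : 4 <= #|cover D| by apply: cover_ge4; rewrite // Ky cards1.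
have sz := split_size ok; rewrite -/n in sz.
have yD : y \in cover D := center_cover D0 Ky.
have yV := subsetP (split_coverV ok') y yD.
have xy : x != y by apply: contraNneq xD => ->.
have missy b : ~~ meet b (kernel D) = (y \notin b) by rewrite Ky -[[set y]]setUid meet2 orbb.
have Bxy b : b \in B -> (x \in b) || (y \in b).
  move=> bB; case: (boolP (x \in b)) => //= xb; have bm : ~~ meet b (kernel C) by rewrite missx.
  by have [z [q [zD _ ->]]] := rest_shape ok bB bm; move: zD; rewrite Ky inE => /eqP->; rewrite setU11.
have BV : B \subset ksub V 3 := subset_trans (rest_sub E C D) EV.
have := at2_le_V BV xy xV yV; rewrite -/n => le2.
have offx : #|off_ B x| <= #|Q| by rewrite -(mul1n #|Q|) -(cards1 y) -Ky; exact: off_rest.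
have offy : #|off_ B y| <= #|pcovers D|.
  rewrite -(mul1n #|pcovers D|) -(cards1 x) -Kx; apply: leq_trans (rest_miss ok').
  apply/subset_leq_card/subsetP => b; rewrite inE [in X in _ -> X]inE missy rest_sym -/B.
  by case/andP => -> ->.
have yLW := link_center y D3.
have QyW : pcovers D \subset ksub (cover D :\ y) 2.
  by apply/subsetP => q; rewrite inE Ky => /andP[].
have Qy4 : #|pcovers D| <= 4.
  apply: (@cross_le4 _ (link D y)) (pcovers_link Ky) _; last exact: link_kernel_free.
    by move=> l /(subsetP yLW)/ksubP[].
  by move=> l /(subsetP QyW)/ksubP[].
have cD : #|D| <= 'C(#|cover D| - 1, 2).
  rewrite -(card_center Ky) (leq_trans (subset_leq_card yLW)) // card_ksub.
  by rewrite (cardsD1 y (cover D)) yD add1n subn1.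
apply: (small_leq _ (@small_stars (#|cover C| - 1) (#|cover D| - 1) n V9 _ _ _)).
- rewrite (split_card ok) -/B (at_pairE Bxy) -cardL.
  by move: le2 offx offy Q4 Qy4 cD card_L V9; rewrite -/n; move: n => k; card_lia.
- by move: cover4; card_lia.
- by move: D4; card_lia.
by move: sz D4 cover4; move: n => k; card_lia.
Qed.

End OneCenter.

(** * Induction on the number of vertices *)

Section Induction.
Variable T : finType.
Implicit Types (V : {set T}) (E C D : {set {set T}}).

Lemma split_classified V E C D : 9 <= #|V| -> split_ok V E C D ->
  (forall m : nat, m < #|V| -> @p4_bound_ok T m) -> #|kernel C| <= #|kernel D| -> classified V E.
Proof.
move=> V9 ok IH kCD; have ok' := split_ok_sym ok; have [_ _ [C0 D0] _ _] := ok.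
have kD3 := kernel_le3 (split_thin ok') D0.
have sm : small #|V| #|E| -> classified V E by move=> h; exact: Or42.
have [kC2|kC1] := leqP 2 #|kernel C|.
  exact/sm/(small_kernels22 V9 ok kC2)/(leq_trans kC2).
have [kC0|kC1'] := leqP #|kernel C| 0.
  have kC : #|kernel C| = 0 by move: kC0; card_lia.
  have : #|kernel D| \in iota 0 4 by rewrite mem_iota.
  rewrite !inE => /or4P[]/eqP kD; apply: sm.
  - exact: small_kernels00 V9 ok IH kC kD.
  - exact: small_kernels01 V9 ok IH kC kD.
  - exact: small_kernels02 V9 ok IH kC kD.
  exact: small_kernels03 V9 ok IH kC kD.
have /cards1P[x Kx] : #|kernel C| == 1 by move: kC1 kC1'; card_lia.
have : #|kernel D| \in iota 1 3 by rewrite mem_iota; move: kD3 kCD kC1'; card_lia.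
rewrite !inE => /or3P[]/eqP kD.
- by have /eqP/cards1P[y Ky] := kD; exact: (classified_kernels11 V9 ok Kx Ky).
- exact: (classified_kernels12 V9 ok Kx kD).
exact: (classified_kernels13 V9 ok Kx kD).
Qed.

Theorem classification V E : 9 <= #|V| -> E \subset ksub V 3 -> p4free E -> classified V E.
Proof.
have [m] := ubnP #|V|; elim: m V E => // m IH V E Vm V9 EV pE.
have ok1 k : k < #|V| -> @p4_bound_ok T k.
  move=> kV; have [/p4_bound_small//|k9] := leqP k 8; move=> V' E' Vk EV' pE'.
  have V9' : 9 <= #|V'| by rewrite Vk.
  rewrite -Vk; apply: classified_le => //; apply: IH => //.
  by rewrite Vk; apply: leq_trans kV _.
have [EE|[C [D ok]]] := split_exists EV pE.
  have [| |le] := intersecting_le _ EV EE; first by move: V9; card_lia.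
    by move=> s1; exact: Or41.
  by apply/Or42/orP; left; move: le V9; card_lia.
have [kCD|/ltnW kDC] := leqP #|kernel C| #|kernel D|; first exact: (split_classified V9 ok ok1 kCD).
exact: (split_classified V9 (split_ok_sym ok) ok1 kDC).
Qed.

End Induction.

(** * The extremal 3-graphs *)

Section Models.
Variable T : finType.
Implicit Types (x y z v p : T) (e f g h : {set T}) (E F : {set {set T}}).

Lemma off_link_inj E F x : off_ E x = off_ F x -> link E x = link F x -> E = F.
Proof.
move=> oEF lEF; apply/setP => e; case: (boolP (x \in e)) => xe.
  by move/setP/(_ (e :\ x)): lEF; rewrite !inE eqxx setD1K.
by move/setP/(_ e): oEF; rewrite !inE xe !andbT.
Qed.

Lemma pair_eq g x y : x != y -> #|g| = 2 -> (g == [set x; y]) = (x \in g) && (y \in g).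
Proof.
move=> xy g2; rewrite eq_sym eqEcard subUset !sub1set g2 cards2 xy andbT.
by [].
Qed.

Lemma setU1_eq x g h : x \notin g -> x \notin h -> (x |: g == x |: h) = (g == h).
Proof.
move=> xg xh; apply/eqP/eqP => [gh|-> //].
by rewrite -(setU1K xg) gh setU1K.
Qed.

Lemma meet_add x g h : x \notin h -> meet (x |: g) h = meet g h.
Proof. by move=> xh; rewrite meetC meetU -[[set x]]setUid meet2 orbb (negPf xh) /= meetC. Qed.

Lemma meet3 g x y z : meet g [set x; y; z] = [|| x \in g, y \in g | z \in g].
Proof. by rewrite meetU meet2 -[[set z]]setUid meet2 orbb orbA. Qed.

Lemma SP_edges_shape p0 p1 p2 p3 p4 v (E := SP_edges p0 p1 p2 p3 p4 v)
    (e := [set p0; p1; p2]) (f := [set p2; p3; p4]) : uniq [:: p0; p1; p2; p3; p4; v] ->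
  [/\ off_ E v = [set e; f], #|e :&: f| = 1 & link E v = reach setT v e f].
Proof.
rewrite /= !inE !negb_or -!andbA => /and5P[n01 n02 n03 n04 /and5P[n0v n12 n13 n14 /and5P[n1v n23 n24 n2v]]].
move=> /and4P[n34 n3v n4v _].
have ve : v \notin e by rewrite !inE !negb_or ![v == _]eq_sym n0v n1v n2v.
have vf : v \notin f by rewrite !inE !negb_or ![v == _]eq_sym n2v n3v n4v.
split.
- apply/setP => g; rewrite !inE -/e -/f; case: (eqVneq g e) => [->|_] /=; first by rewrite ve.
  case: (eqVneq g f) => [->|_] /=; first by rewrite vf.
  by case: (v \in g); rewrite ?andbF.
- apply/eqP/cards1P; exists p2; apply/setP => y; rewrite !inE.
  case: (eqVneq y p2) => [->|y2]; first by rewrite !orbT.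
  rewrite orbF /=; case: (eqVneq y p0) => [->|_]; first by rewrite (negPf n03) (negPf n04).
  by case: (eqVneq y p1) => [->|_] //; rewrite (negPf n13) (negPf n14).
have PE : [set p0; p1; p2; p3; p4] = e :|: f.
  by apply/setP => y; rewrite !inE; do 5!case: (y == _).
have vef : v \notin e :|: f by rewrite in_setU negb_or ve.
apply/setP => g; rewrite !inE -/e -/f PE.
rewrite subsetD1; case: (boolP (v \in g)) => vg; first by rewrite andbF.
rewrite -[_ :&: _ != set0]/(meet _ _) meet_add // cardsU1 vg eqxx !subsetT /= add1n eqSS andbT.
have nv h : v \notin h -> (v |: g == h) = false by apply: contraNF => /eqP <-; rewrite setU11.
by rewrite !nv.
Qed.

Lemma CB_edges_shape x y1 y2 z1 z2 (E := CB_edges x y1 y2 z1 z2)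
    (e := [set y1; y2; z1]) (f := [set y1; y2; z2]) : uniq [:: x; y1; y2; z1; z2] ->
  [/\ off_ E x = [set e; f], #|e :&: f| = 2 & link E x = same setT x e f].
Proof.
rewrite /= !inE !negb_or -!andbA => /and5P[xy1 xy2 xz1 xz2 /and5P[y12 yz11 yz12 yz21 /and3P[yz22 z12 _]]].
have xe : x \notin e by rewrite !inE !negb_or xy1 xy2 xz1.
have xf : x \notin f by rewrite !inE !negb_or xy1 xy2 xz2.
split.
- apply/setP => g; rewrite !inE -/e -/f; case: (eqVneq g e) => [->|_] /=; first by rewrite xe !orbT.
  case: (eqVneq g f) => [->|_] /=; first by rewrite xf !orbT.
  have n3 s t : (g == [set x; s; t]) && (x \notin g) = false.
    by case: eqP => // ->; rewrite !inE eqxx.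
  by rewrite !andb_orl !n3 -!andbA andbN !andbF.
- have -> : e :&: f = [set y1; y2]; last by rewrite cards2 y12.
  apply/setP => y; rewrite !inE; case: (eqVneq y z1) => [->|_].
    by rewrite ![z1 == _]eq_sym (negPf yz11) (negPf yz21) eq_sym (negPf z12).
  by rewrite orbF; case: (_ || _).
apply/setP => g; rewrite !inE -/e -/f subsetD1 subsetT /=.
case: (boolP (x \in g)) => //= xg.
rewrite cardsU1 xg add1n eqSS eqxx /=; case: (eqVneq #|g| 2) => [g2|g2] /=.
  rewrite andbT.
  have nx h : x \notin h -> (x |: g == h) = false by apply: contraNF => /eqP <-; rewrite setU11.
  have px s t : x != s -> x != t -> s != t -> (x |: g == [set x; s; t]) = (s \in g) && (t \in g).
    move=> xs xt st; rewrite -setUA setU1_eq ?pair_eq // !inE negb_or xs xt. by [].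
  rewrite (nx e) // (nx f) // !px // subUset sub1set !inE negb_or xz1 xz2 /=.
  have -> : (g \subset ~: [set z1; z2]) = (z1 \notin g) && (z2 \notin g).
    by rewrite -disjoints_subset -setI_eq0 -[_ == _]negbK -/(meet _ _) meet2 negb_or.
  rewrite /e /f !meet3.
  by do 4!case: (_ \in g).
have n3 h : #|h| = 3 -> (x |: g == h) = false.
  by move=> h3; apply/eqP => gh; move: h3; rewrite -gh cardsU1 xg add1n => -[/eqP]; rewrite (negPf g2).
have c3 s t u : s != t -> s != u -> t != u -> #|[set s; t; u]| = 3.
  by move=> st su tu; rewrite -setUA !cardsU1 cards1 !inE negb_or st su tu.
by rewrite !n3 // ?c3.
Qed.

Lemma SP_shapeE E x : E \subset ksub setT 3 -> SP_shape setT E x ->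
  exists p0 p1 p2 p3 p4, uniq [:: p0; p1; p2; p3; p4; x] /\ E = SP_edges p0 p1 p2 p3 p4 x.
Proof.
move=> ET [e [f [oE ef lE]]].
have [[e3 xe] [f3 xf]] : (#|e| = 3 /\ x \notin e) /\ (#|f| = 3 /\ x \notin f).
  have De : e \in off_ E x by rewrite oE !inE eqxx.
  have Df : f \in off_ E x by rewrite oE !inE eqxx orbT.
  move: De Df; rewrite !inE => /andP[/(subsetP ET)/ksubP[_ ->] ->] /andP[/(subsetP ET)/ksubP[_ ->] ->].
  by [].
have /eqP/cards1P[p2 p2E] := ef.
have /setIP[p2e p2f] : p2 \in e :&: f by rewrite p2E set11.
have /card2P[p0 [p1 [n01 E01]]] : #|e :\ p2| = 2 by have := cardsD1 p2 e; rewrite p2e e3 => -[].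
have /card2P[p3 [p4 [n34 E34]]] : #|f :\ p2| = 2 by have := cardsD1 p2 f; rewrite p2f f3 => -[].
have eE : e = [set p0; p1; p2] by rewrite -(setD1K p2e) E01 setUC.
have fE : f = [set p2; p3; p4] by rewrite -(setD1K p2f) E34 setUA.
have [n0 n1] : (p0 != p2) /\ (p1 != p2).
  have : p0 \in e :\ p2 by rewrite E01 set21.
  have : p1 \in e :\ p2 by rewrite E01 set22.
  by rewrite !inE => /andP[-> _] /andP[-> _].
have [n3 n4] : (p2 != p3) /\ (p2 != p4).
  have : p3 \in f :\ p2 by rewrite E34 set21.
  have : p4 \in f :\ p2 by rewrite E34 set22.
  by rewrite !inE ![p2 == _]eq_sym => /andP[-> _] /andP[-> _].
have out y z : y \in e -> y != p2 -> z \in f -> y != z.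
  move=> ye yp zf; apply: contraNneq yp => yz; have : y \in e :&: f by rewrite inE ye yz.
  by rewrite p2E inE.
have un : uniq [:: p0; p1; p2; p3; p4; x].
  have [i0 i1] : p0 \in e /\ p1 \in e by rewrite eE !inE !eqxx orbT.
  have [i3 i4] : p3 \in f /\ p4 \in f by rewrite fE !inE !eqxx !orbT.
  have [o3 o3'] := (out _ _ i0 n0 i3, out _ _ i1 n1 i3).
  have [o4 o4'] := (out _ _ i0 n0 i4, out _ _ i1 n1 i4).
  move: xe xf; rewrite eE fE /= !inE !negb_or ![x == _]eq_sym n01 n0 n1 n3 n4 n34 o3 o3' o4 o4' /=.
  by move=> /andP[/andP[-> ->] ->] /andP[/andP[_ ->] ->].
exists p0, p1, p2, p3, p4; split=> //.
have [oS _ lS] := SP_edges_shape un; apply: (@off_link_inj _ _ x).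
  by rewrite oS -eE -fE.
by rewrite lS -eE -fE.
Qed.

Lemma CB_shapeE E x : E \subset ksub setT 3 -> CB_shape setT E x ->
  exists y1 y2 z1 z2, uniq [:: x; y1; y2; z1; z2] /\ E = CB_edges x y1 y2 z1 z2.
Proof.
move=> ET [e [f [oE ef lE]]].
have [[e3 xe] [f3 xf]] : (#|e| = 3 /\ x \notin e) /\ (#|f| = 3 /\ x \notin f).
  have De : e \in off_ E x by rewrite oE !inE eqxx.
  have Df : f \in off_ E x by rewrite oE !inE eqxx orbT.
  move: De Df; rewrite !inE => /andP[/(subsetP ET)/ksubP[_ ->] ->] /andP[/(subsetP ET)/ksubP[_ ->] ->].
  by [].
have /card2P[y1 [y2 [y12 Ey]]] := ef.
have /eqP/cards1P[z1 Ez1] : #|e :\: f| = 1 by rewrite cardsD ef e3.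
have /eqP/cards1P[z2 Ez2] : #|f :\: e| = 1 by rewrite cardsD setIC ef f3.
have eE : e = [set y1; y2; z1] by rewrite -(setID e f) Ey Ez1.
have fE : f = [set y1; y2; z2] by rewrite -(setID f e) setIC Ey Ez2.
have /setDP[z1e z1f] : z1 \in e :\: f by rewrite Ez1 set11.
have /setDP[z2f z2e] : z2 \in f :\: e by rewrite Ez2 set11.
have un : uniq [:: x; y1; y2; z1; z2].
  move: xe xf z1f z2e; rewrite /= !inE eE fE !inE !negb_or y12 ![z1 == _]eq_sym ![z2 == _]eq_sym.
  move=> /andP[/andP[-> ->] ->] /andP[_ ->] /andP[/andP[-> ->] n12] /andP[/andP[-> ->] _].
  by rewrite n12.
exists y1, y2, z1, z2; split=> //.
have [oS _ lS] := CB_edges_shape un; apply: (@off_link_inj _ _ x).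
  by rewrite oS -eE -fE.
by rewrite lS -eE -fE.
Qed.

(** In a minimal 4-path some two of the four edges miss [x], because [a], [c] and [a], [d] and [b],
    [d] are disjoint. These two then coincide, although another edge of the path meets only one of
    them. *)
Lemma star1_p4free E : star1 E -> p4free E.
Proof.
move=> [x /card_le1_eqP o1] a b c d aE bE cE dE ab bc cd /meetPn ac /meetPn ad /meetPn bd.
have off1 g h : g \in E -> h \in E -> x \notin g -> x \notin h -> g = h.
  by move=> gE hE xg xh; apply: o1; rewrite inE ?gE ?hE.
case: (boolP (x \in a)) => xa.
  have xc : x \notin c by apply/negP => /(ac x xa).
  have xd : x \notin d by apply/negP => /(ad x xa).
  by have /meetP[y yb yc] := bc; case: (bd y yb); rewrite -(off1 c d).
case: (boolP (x \in b)) => xb.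
  have xd : x \notin d by apply/negP => /(bd x xb).
  by have /meetP[y yc yd] := cd; case: (ac y _ yc); rewrite (off1 a d).
by have /meetP[y yb yc] := bc; case: (ac y _ yc); rewrite (off1 a b).
Qed.

(* In a minimal 4-path [a, b, c, d] each of the disjoint pairs [a, c], [a, d], [b, d]
   has a member missing [x]. *)
Lemma two_off_p4free E x e f : off_ E x = [set e; f] -> meet e f ->
    (forall h, h \in E -> x \in h -> meet h (e :|: f)) \/
    (forall h, h \in E -> x \in h -> meet h e = meet h f) ->
  p4free E.
Proof.
move=> oE ef hE; suff no a b c d : a \in E -> b \in E -> c \in E -> d \in E ->
    meet a b -> meet b c -> ~~ meet a c -> ~~ meet a d -> ~~ meet b d -> x \notin a -> False.
  move=> a b c d aE bE cE dE ab bc cd ac ad bd.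
  case: (boolP (x \in a)) => xa; last exact: (no a b c d).
  have xd : x \notin d by move/meetPn: ad => ad; apply/negP => /(ad x xa).
  by apply: (no d c b a) => //; rewrite meetC.
move=> aE bE cE dE ab bc ac ad bd xa.
have ef_cases g : g \in E -> x \notin g -> g = e \/ g = f.
  move=> gE xg; have : g \in off_ E x by rewrite inE gE.
  by rewrite oE => /set2P.
have fe : meet f e by rewrite meetC.
have e3 : meet e e /\ meet f f.
  by case/meetP: ef => y ye yf; split; apply/meetP; exists y.
have offm g h : g \in E -> h \in E -> x \notin g -> x \notin h -> meet g h.
  by move=> gE hE' xg xh; case: (ef_cases g gE xg) => ->; case: (ef_cases h hE' xh) => ->; case: e3.
have xd : x \in d by apply: contraT => xd; rewrite (offm a d) in ad.
have xc : x \in c by apply: contraT => xc; rewrite (offm a c) in ac.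
have xb : x \notin b by move/meetPn: bd => bd; apply/negP => xb; exact: (bd x).
have neq : a <> b by move=> ba; rewrite ba bc in ac.
have abE : (a = e /\ b = f) \/ (a = f /\ b = e).
  by case: (ef_cases a aE xa) neq => ->; case: (ef_cases b bE xb) => -> neq; [case: neq|left|right|case: neq].
case: hE => h.
  have := h d dE xd; rewrite meetU ![meet d _]meetC.
  by case: abE ad bd => -[-> ->] /negPf -> /negPf ->.
have := h c cE xc; rewrite ![meet c _]meetC.
by case: abE ac bc => -[-> ->] /negPf -> ->.
Qed.

(** If [y] were such a vertex, it would differ from [x], and the edges would number at most
    [2 + 1 + (#|V| - 2)]: two missing [x], one through [x] missing [y], and those through both. *)
Lemma two_off_nstar1 (V : {set T}) E x : 2 <= #|V| -> E \subset ksub V 3 -> x \in V -> #|off_ E x| = 2 -> #|V| + 1 < #|E| -> ~ star1 E.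
Proof.
move=> V2 EV xV o2 nE [y oy]; have xy : x != y by apply: contraTneq oy => <-; rewrite o2.
have oxy : #|off_ (at_ E x) y| <= 1.
  apply: leq_trans oy; apply/subset_leq_card/subsetP => e.
  by rewrite !inE => /andP[/andP[-> _] ->].
have := card_at_off E x; have := card_at_off (at_ E x) y.
case: (boolP (y \in V)) => yV.
  by have := at2_le_V EV xy xV yV; move: o2 nE oxy; card_lia.
have -> : at_ (at_ E x) y = set0.
  apply/setP => e; rewrite !inE; apply/negP => /andP[/andP[/(subsetP EV)/ksubP[/subsetP eV _] _] ye].
  by rewrite (eV y ye) in yV.
by rewrite cards0; move: V2 o2 nE oxy; card_lia.
Qed.

End Models.

(** * Containment, isomorphism and transport of edge sets *)

Lemma contained_trans F G H : contained F G -> contained G H -> contained F H.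
Proof.
move=> [f f_inj fE] [g g_inj gE]; exists (g \o f); first exact: inj_comp.
by move=> e /fE/gE; rewrite imset_comp.
Qed.

Lemma contained_card G H : contained G H -> #|edges G| <= #|edges H|.
Proof.
move=> [f f_inj fE]; rewrite -(card_imset _ (imset_inj f_inj)).
by apply/subset_leq_card/subsetP => _ /imsetP[e eG ->]; exact: fE.
Qed.

Lemma isomorphic_contained G H : isomorphic G H ->
  [/\ contained G H, contained H G & #|G| = #|H|].
Proof.
move=> [f f_bij fE]; have f_inj := bij_inj f_bij; split; last exact: bij_eq_card f_bij.
  by exists f => // e; rewrite fE.
have [g fg gf] := f_bij; exists g; first exact: can_inj gf.
move=> e eH; rewrite fE -imset_comp (eq_imset (g := id)) ?imset_id //.
Qed.

Lemma isomorphic_card G H : isomorphic G H -> #|edges G| = #|edges H|.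
Proof.
by move=> /isomorphic_contained[GH HG _]; apply/eqP; rewrite eqn_leq !contained_card.
Qed.

Lemma isomorphic_admissible F n (L : graph3 -> Prop) G H :
  isomorphic G H -> admissible F n L H -> admissible F n L G.
Proof.
move=> /isomorphic_contained[GH HG cGH] [Hn Hfree HL]; split; first by rewrite cGH.
  by move=> K FK KG; apply: (Hfree K FK); exact: contained_trans KG GH.
by move=> K LK GK; apply: (HL K LK); exact: contained_trans HG GK.
Qed.

(** Both sequences are completed to enumerations of their types, and [f] matches equal positions. *)
Lemma bijection_of_seq (T T' : finType) (y0 : T') (s : seq T) (s' : seq T') :
    uniq s -> uniq s' -> size s = size s' -> #|T| = #|T'| ->
  exists2 f : T -> T', bijective f & map f s = s'.
Proof.
move=> us us' ss' TT'.
pose full (U : finType) (t : seq U) := t ++ [seq x <- enum U | x \notin t].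
have fullP (U : finType) (t : seq U) : uniq t -> uniq (full U t) /\ forall x, x \in full U t.
  move=> ut; split; last by move=> x; rewrite mem_cat mem_filter mem_enum andbT orbN.
  rewrite cat_uniq ut filter_uniq ?enum_uniq // andbT; apply/hasPn => x.
  by rewrite mem_filter => /andP[].
have [[ur memr] [ur' memr']] := (fullP T s us, fullP T' s' us').
have sz (U : finType) (t : seq U) : uniq t -> size (full U t) = #|U|.
  by move=> /fullP[uf mf]; rewrite cardE; apply/perm_size/uniq_perm; rewrite ?enum_uniq // => x; rewrite mf mem_enum.
pose f x := nth y0 (full T' s') (index x (full T s)).
have f_inj : injective f.
  move=> x y; rewrite /f => /eqP; rewrite nth_uniq ?sz // -?TT' -?(sz T s) // ?index_mem //.
  move=> /eqP ixy; have := nth_index x (memr x); rewrite ixy.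
  by rewrite (set_nth_default y) ?index_mem // nth_index.
exists f; first by apply: inj_card_bij => //; rewrite TT'.
apply: (@eq_from_nth _ y0); rewrite size_map // => i is'.
have [x0 _] : exists x, x \in s by case: (s) is' => // a l _; exists a; rewrite mem_head.
rewrite (nth_map x0) // /f index_cat mem_nth // index_uniq // nth_cat -ss' is'.
by [].
Qed.

Section Images.
Variables (T T' : finType) (f : T -> T').
Hypothesis f_inj : injective f.
Implicit Types (e S : {set T}).

Lemma imset3_eq e a b c : (f @: e == [set f a; f b; f c]) = (e == [set a; b; c]).
Proof. by rewrite -(inj_eq (imset_inj f_inj)) !imsetU !imset_set1. Qed.

Lemma SP_edges_imset e p0 p1 p2 p3 p4 v :
  (f @: e \in SP_edges (f p0) (f p1) (f p2) (f p3) (f p4) (f v)) = (e \in SP_edges p0 p1 p2 p3 p4 v).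
Proof.
rewrite !inE !imset3_eq card_imset // !subsetT mem_imset //.
by rewrite -(imset_eq0 f (e :&: _)) (imsetI (in2W f_inj)) !imsetU !imset_set1.
Qed.

Lemma CB_edges_imset e x y1 y2 z1 z2 :
  (f @: e \in CB_edges (f x) (f y1) (f y2) (f z1) (f z2)) = (e \in CB_edges x y1 y2 z1 z2).
Proof.
rewrite !inE !imset3_eq card_imset // mem_imset //.
rewrite -!disjoints_subset -!setI_eq0 -(imset_eq0 f (e :&: _)) (imsetI (in2W f_inj)).
by rewrite !imsetU !imset_set1.
Qed.

End Images.

Lemma edges_ksub (H : graph3) : edges H \subset ksub setT 3.
Proof. by apply/subsetP => e /edges_card3 e3; apply/ksubP; rewrite subsetT. Qed.

(** * Freeness as a condition on four edges *)

Section Path.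
Variables (T : finType) (a b c d : {set T}).
Hypotheses (a3 : #|a| = 3) (b3 : #|b| = 3) (c3 : #|c| = 3) (d3 : #|d| = 3).
(** Restricting the vertex type to the union of the four edges leaves no isolated vertices, as
    [minimal_4path] demands. *)
Let U := {x : T | x \in a :|: b :|: c :|: d}.
Let F := [set e : {set U} | val @: e \in [set a; b; c; d]].

Lemma path_card3 e : e \in F -> #|e| = 3.
Proof.
rewrite inE -(card_imset _ val_inj) !inE.
by case/orP => [/orP[/orP[]|]|] /eqP ->.
Qed.

Definition path_graph := Graph3 path_card3.

Definition path_edge (i : 'I_4) : {set T} := nth a [:: a; b; c; d] i.

Lemma path_edge_sub i x : x \in path_edge i -> x \in a :|: b :|: c :|: d.
Proof.
by rewrite !inE /path_edge; case: i => -[|[|[|[|]]]] //= _ ->; rewrite ?orbT.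
Qed.

Lemma path_edgeE e : (e \in [set a; b; c; d]) = [exists i, e == path_edge i].
Proof.
apply/idP/existsP => [|[[i i4] /eqP ->]].
  rewrite !inE => /orP[/orP[/orP[]|]|] /eqP ->.
  - by exists ord0.
  - by exists (inord 1); rewrite /path_edge inordK.
  - by exists (inord 2); rewrite /path_edge inordK.
  by exists (inord 3); rewrite /path_edge inordK.
by rewrite /path_edge /=; case: i i4 => [|[|[|[|]]]] //= _; rewrite !inE eqxx ?orbT.
Qed.

Definition path_lift i : {set U} := [set u | val u \in path_edge i].

Lemma val_path_lift i : val @: path_lift i = path_edge i.
Proof.
apply/setP => x; apply/imsetP/idP => [[u]|xi]; first by rewrite inE => ui ->.
by exists (Sub x (path_edge_sub xi)); rewrite ?inE ?SubK.
Qed.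

Lemma path_minimal : meet a b -> meet b c -> meet c d -> ~~ meet a c -> ~~ meet a d -> ~~ meet b d ->
  minimal_4path path_graph.
Proof.
move=> ab bc cd ac ad bd; split.
  move=> u; have : val u \in a :|: b :|: c :|: d by exact: valP u.
  have mem e : e \in [set a; b; c; d] -> val u \in e -> exists2 e', e' \in edges path_graph & u \in e'.
    rewrite path_edgeE => /existsP[i /eqP ->] ui; exists (path_lift i); last by rewrite inE.
    by rewrite inE val_path_lift path_edgeE; apply/existsP; exists i.
  by rewrite !inE => /orP[/orP[/orP[]|]|]; apply: mem; rewrite !inE eqxx ?orbT.
exists path_lift.
  apply/setP => e; rewrite inE path_edgeE; apply/existsP/imsetP => [[i /eqP ei]|[i _ ->]].
    by exists i => //; apply: (imset_inj val_inj); rewrite ei val_path_lift.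
  by exists i; rewrite val_path_lift.
have self (e : {set T}) : #|e| = 3 -> meet e e by rewrite /meet setIid -card_gt0 => ->.
move=> i j; rewrite -(imset_eq0 val) (imsetI (in2W val_inj)) !val_path_lift.
rewrite -/(meet _ _); suff -> : meet (path_edge i) (path_edge j) = (i <= j.+1) && (j <= i.+1) by [].
rewrite /path_edge; case: i j => -[|[|[|[|]]]] //= _ [[|[|[|[|]]]] //= _]; rewrite ?self //;
  by rewrite ?ab ?bc ?cd ?(negPf ac) ?(negPf ad) ?(negPf bd) // meetC
    ?ab ?bc ?cd ?(negPf ac) ?(negPf ad) ?(negPf bd).
Qed.

End Path.

(** The combinatorial part of the proof speaks of edge sets only; this equivalence ties it to the
    definition by embeddings. [path_graph] turns four edges of [H] into a forbidden 3-graph. *)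
Lemma free_p4free (H : graph3) : is_free minimal_4path H <-> p4free (edges H).
Proof.
split=> [Hfree a b c d aE bE cE dE ab bc cd ac ad bd|pE G [_ [a GE aP]] [f f_inj fE]].
  have [a3 b3 c3 d3] : [/\ #|a| = 3, #|b| = 3, #|c| = 3 & #|d| = 3] by rewrite !(@edges_card3 H).
  apply: (Hfree (path_graph a3 b3 c3 d3)); first exact: path_minimal.
  exists val; first exact: val_inj.
  by move=> e; rewrite inE !inE => /orP[/orP[/orP[]|]|] /eqP ->.
have aE i : f @: a i \in edges H by apply: fE; rewrite GE imset_f.
have fm i j : meet (f @: a i) (f @: a j) = (i <= j.+1) && (j <= i.+1).
  by rewrite /meet -(imsetI (in2W f_inj)) imset_eq0; apply/idP/idP; apply aP.
have val4 i : i < 4 -> (inord i : 'I_4) = i :> nat by exact: inordK.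
by apply: (pE _ _ _ _ (aE (inord 0)) (aE (inord 1)) (aE (inord 2)) (aE (inord 3))); rewrite fm !val4.
Qed.

(** Equal orders make the embedding a bijection, so the special vertex of [H] has a preimage. *)
Lemma contained_star1 G H : contained G H -> #|G| = #|H| -> star1 (edges H) -> star1 (edges G).
Proof.
move=> [f f_inj fE] GH [y oy]; have [g fg gf] := inj_card_bij f_inj (eq_leq (esym GH)).
exists (g y); apply: leq_trans oy; rewrite -(card_imset _ (imset_inj f_inj)).
apply/subset_leq_card/subsetP => d /imsetP[e]; rewrite inE => /andP[eG ge] ->.
rewrite inE fE //; apply: contra ge => /imsetP[x xe yx].
by rewrite yx fg.
Qed.

(** * Full stars with one extra edge *)

Section FullStar.
Variables (T : finType) (x : T) (e0 : {set T}).
Hypotheses (e3 : #|e0| = 3) (xe : x \notin e0).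
Let E := star_edges setT x :|: [set e0].

Lemma star_edge_card3 e : e \in E -> #|e| = 3.
Proof. by rewrite !inE => /orP[/andP[/eqP]|/eqP->]. Qed.

Definition star_edge_graph := Graph3 star_edge_card3.

Lemma star_edge_star1 : star1 E.
Proof.
exists x; rewrite -(cards1 e0); apply/subset_leq_card/subsetP => e.
by rewrite !inE => /andP[/orP[/and3P[_ _ ->]|]].
Qed.

Lemma star_edge_card : #|E| = 'C(#|T|.-1, 2) + 1.
Proof.
rewrite -(card_at_off E x); congr (_ + _).
  rewrite -card_link; have -> : link E x = ksub (setT :\ x) 2.
    apply/setP => g; rewrite !inE subsetD1 !subsetT eqxx /= cardsU1.
    case: (boolP (x \in g)) => xg //=; rewrite add1n eqSS andbT.
    by rewrite (_ : (x |: g == e0) = false) ?orbF //; apply: contraNF xe => /eqP <-; rewrite setU11.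
  by rewrite card_ksub -cardsT (cardsD1 x setT) inE.
apply/eqP/cards1P; exists e0; apply/setP => e; rewrite !inE.
case: (eqVneq e e0) => [->|_]; first by rewrite xe orbT.
by rewrite orbF; case: (x \in e); rewrite ?andbF.
Qed.

End FullStar.

(** * First and second order *)

Section Orders.
Variable n : nat.
Hypothesis n9 : 9 <= n.

Lemma star1_max (H : graph3) : #|H| = n -> p4free (edges H) ->
  star1 (edges H) \/ #|edges H| < 'C(n.-1, 2) + 1.
Proof.
move=> Hn pE; have V9 : 9 <= #|[set: H]| by rewrite cardsT Hn.
have := classification V9 (edges_ksub H) pE; rewrite /classified cardsT Hn.
have [t nt] : exists t : nat, n = 9 + t by exists (n - 9); move: n9; card_lia.
have -> : n.-1 = 8 + t by rewrite nt.
have e3 : n - 3 = 6 + t by rewrite nt; card_lia.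
have := bin2_add 8 t; have := bin2_add 6 t; rewrite (_ : 'C(8, 2) = 28) // (_ : 'C(6, 2) = 15) // => e6 e8.
case=> [s1|sm|[x xV [_ h]]|[x xV [_ ->]]]; [by left|right|right|right].
- by move: sm; rewrite /small e3 nt; move: e6 e8; card_lia.
- by move: h; rewrite nt; move: e6 e8; card_lia.
by rewrite e3; move: e6 e8; card_lia.
Qed.

Lemma star1_bound (H : graph3) : #|H| = n -> p4free (edges H) -> #|edges H| <= 'C(n.-1, 2) + 1.
Proof.
move=> Hn pE; case: (star1_max Hn pE) => [s1|/ltnW //].
by have := star1_le (edges_ksub H) s1; rewrite cardsT Hn.
Qed.

Local Notation upto := (extremal_upto minimal_4path n).

Lemma admissible1 H : admissible minimal_4path n (upto 0) H <-> #|H| = n /\ p4free (edges H).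
Proof. by split=> [[Hn /free_p4free]|[Hn /free_p4free]]. Qed.

Lemma extremal1_star1 H : extremal minimal_4path n (upto 0) H -> #|H| = n /\ star1 (edges H).
Proof.
move=> [/admissible1[Hn pE] [_ max]]; split=> //; case: (star1_max Hn pE) => // lt.
have [x _] : exists x : H, x \in [set: H] by apply/set0Pn; rewrite -card_gt0 cardsT Hn (leq_trans _ n9).
have : 0 < #|ksub ([set: H] :\ x) 3|.
  by rewrite card_ksub bin_gt0; have := cardsD1 x [set: H]; rewrite inE cardsT Hn; move: n9; card_lia.
case/card_gt0P => e0 /ksubP[]; rewrite subsetD1 => /andP[_ xe] e3.
have le : #|edges (star_edge_graph x e3)| <= #|edges H|.
  by apply: max; apply/admissible1; split=> //; apply: star1_p4free; exact: star_edge_star1.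
by move: le; rewrite (star_edge_card xe) Hn leqNgt lt.
Qed.

Lemma star1_extremal1 (H : graph3) : #|H| = n -> star1 (edges H) ->
  exists2 K, extremal minimal_4path n (upto 0) K & contained H K.
Proof.
move=> Hn [x ox].
(* When all edges contain [x], any triple off [x] serves as the extra edge. *)
have [e0 [e3 xe oe]] : exists e0 : {set H}, [/\ #|e0| = 3, x \notin e0 & off_ (edges H) x \subset [set e0]].
  case: (set_0Vmem (off_ (edges H) x)) => [->|[e0 e0o]].
    have : 0 < #|ksub ([set: H] :\ x) 3|.
      by rewrite card_ksub bin_gt0; have := cardsD1 x [set: H]; rewrite inE cardsT Hn; move: n9; card_lia.
    case/card_gt0P => e0 /ksubP[]; rewrite subsetD1 => /andP[_ xe] e3.
    by exists e0; rewrite sub0set.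
  exists e0; move: (e0o); rewrite inE => /andP[/edges_card3 -> ->]; split=> //.
  by apply/subsetP => e eo; rewrite inE; apply/eqP; move/card_le1_eqP: ox; apply.
exists (star_edge_graph x e3).
  have adm : admissible minimal_4path n (upto 0) (star_edge_graph x e3).
    by apply/admissible1; split=> //; apply: star1_p4free; exact: star_edge_star1.
  split=> //; split; first by exists (star_edge_graph x e3).
  by move=> K /admissible1[Kn pK]; rewrite (star_edge_card xe) Hn; exact: star1_bound.
exists id => // e eH; rewrite imset_id !inE.
case: (boolP (x \in e)) => xe'; first by rewrite (edges_card3 eH) subsetT eqxx.
have : e \in [set e0] by apply: (subsetP oe); rewrite inE eH.
by rewrite inE => ->; rewrite orbT.
Qed.

Lemma admissible2 H : admissible minimal_4path n (upto 1) H <->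
  [/\ #|H| = n, p4free (edges H) & ~ star1 (edges H)].
Proof.
split=> [[Hn /free_p4free pE no]|[Hn /free_p4free pE no]]; split=> //.
  by move=> /(star1_extremal1 Hn)[K eK HK]; apply: (no K) => //; right.
move=> K [//|/extremal1_star1[Kn sK]] HK; apply: no.
by apply: contained_star1 HK _ sK; rewrite Kn.
Qed.

Lemma admissible2_cases H : admissible minimal_4path n (upto 1) H ->
  [\/ small n #|edges H|,
      (exists p0 p1 p2 p3 p4 v, uniq [:: p0; p1; p2; p3; p4; v] /\ edges H = SP_edges p0 p1 p2 p3 p4 v)
        /\ #|edges H| + 18 = 5 * n
    | (exists x y1 y2 z1 z2, uniq [:: x; y1; y2; z1; z2] /\ edges H = CB_edges x y1 y2 z1 z2)
        /\ #|edges H| = 'C(n - 3, 2) + 7].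
Proof.
move=> /admissible2[Hn pE ns]; have V9 : 9 <= #|[set: H]| by rewrite cardsT Hn.
have := classification V9 (edges_ksub H) pE; rewrite /classified cardsT Hn.
case=> [//|sm|[x _ [/(SP_shapeE (edges_ksub H)) sh cE]]|[x _ [/(CB_shapeE (edges_ksub H)) sh cE]]].
- exact: Or31.
- apply: Or32; split=> //; have [p0 [p1 [p2 [p3 [p4 shE]]]]] := sh.
  by exists p0, p1, p2, p3, p4, x.
apply: Or33; split=> //; have [y1 [y2 [z1 [z2 shE]]]] := sh.
by exists x, y1, y2, z1, z2.
Qed.

Lemma SP_edges_admissible (H : graph3) p0 p1 p2 p3 p4 v : #|H| = n ->
    uniq [:: p0; p1; p2; p3; p4; v] -> edges H = SP_edges p0 p1 p2 p3 p4 v ->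
  admissible minimal_4path n (upto 1) H /\ #|edges H| + 18 = 5 * n.
Proof.
move=> Hn un HE; have [oE ef lE] := SP_edges_shape un; rewrite -HE in oE lE.
have V9 : 9 <= #|[set: H]| by rewrite cardsT Hn.
move: oE ef lE; set e := [set p0; p1; p2]; set f := [set p2; p3; p4] => oE ef lE.
have [De Df] : e \in off_ (edges H) v /\ f \in off_ (edges H) v by rewrite oE !inE !eqxx orbT.
have cE := card_reach1 (edges_ksub H) (in_setT v) V9 De Df ef.
have o2 : #|off_ (edges H) v| = 2.
  rewrite oE cards2; case: eqP => // fe; move: ef; rewrite -fe setIid.
  by move: De; rewrite inE => /andP[/edges_card3 ->].
rewrite (card_star _ v) lE o2; have cS := card_star (edges H) v; rewrite lE o2 in cS.
move: cE; rewrite cardsT Hn => cE; split; last by move: cE; card_lia.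
apply/admissible2; split=> //.
  apply: (two_off_p4free oE); first by rewrite /meet -card_gt0 ef.
  left=> h hE xh; have : h :\ v \in reach setT v e f by rewrite -lE !inE eqxx setD1K.
  rewrite inE => /andP[_]; rewrite -(@meet_add _ v) ?setD1K // inE negb_or.
  by move: De Df; rewrite !inE => /andP[_ ->] /andP[_ ->].
apply: two_off_nstar1 (edges_ksub H) (in_setT v) o2 _; rewrite cardsT Hn; first exact: leq_trans n9.
by rewrite cS; move: cE n9; card_lia.
Qed.

Lemma CB_edges_admissible (H : graph3) x y1 y2 z1 z2 : #|H| = n ->
    uniq [:: x; y1; y2; z1; z2] -> edges H = CB_edges x y1 y2 z1 z2 ->
  admissible minimal_4path n (upto 1) H /\ #|edges H| = 'C(n - 3, 2) + 7.
Proof.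
move=> Hn un HE; have [oE ef lE] := CB_edges_shape un; rewrite -HE in oE lE.
have V9 : 9 <= #|[set: H]| by rewrite cardsT Hn.
move: oE ef lE; set e := [set y1; y2; z1]; set f := [set y1; y2; z2] => oE ef lE.
have [De Df] : e \in off_ (edges H) x /\ f \in off_ (edges H) x by rewrite oE !inE !eqxx orbT.
have cE := card_same2 (edges_ksub H) (in_setT x) V9 De Df ef.
have o2 : #|off_ (edges H) x| = 2.
  rewrite oE cards2; case: eqP => // fe; move: ef; rewrite -fe setIid.
  by move: De; rewrite inE => /andP[/edges_card3 ->].
rewrite (card_star _ x) lE o2; have cS := card_star (edges H) x; rewrite lE o2 in cS.
move: cE; rewrite cardsT Hn => cE; split; last by rewrite cE -addnA.
apply/admissible2; split=> //.
  apply: (two_off_p4free oE); first by rewrite /meet -card_gt0 ef.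
  right=> h hE xh; have : h :\ x \in same setT x e f by rewrite -lE !inE eqxx setD1K.
  rewrite inE => /andP[_ /eqP].
  have [xe xf] : x \notin e /\ x \notin f.
    by move: De Df; rewrite [_ \in off_ _ _]inE => /andP[_ ->]; rewrite inE => /andP[_ ->].
  by rewrite -(meet_add _ xe) -(meet_add _ xf) setD1K.
apply: two_off_nstar1 (edges_ksub H) (in_setT x) o2 _; rewrite cardsT Hn; first exact: leq_trans n9.
have [t nt] : exists t : nat, n = 9 + t by exists (n - 9); move: n9; card_lia.
have e3 : n - 3 = 6 + t by rewrite nt; card_lia.
rewrite cS; have := bin2_add 6 t; rewrite (_ : 'C(6, 2) = 15) // => e6.
by move: cE; rewrite e3 nt; move: e6; card_lia.
Qed.

(** An upper bound with its equality case gives both the value and uniqueness; conversely, every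
    isomorphic copy of [K] is extremal because admissibility and edge numbers are invariant. *)
Lemma second_order (K : graph3) m : admissible minimal_4path n (upto 1) K -> #|edges K| = m ->
    (forall H, admissible minimal_4path n (upto 1) H ->
       #|edges H| <= m /\ (#|edges H| = m -> isomorphic H K)) ->
  turan_number minimal_4path n 2 m /\
  (forall H, turan_family minimal_4path n 2 H <-> isomorphic H K).
Proof.
move=> aK Km max; split; first by split=> [|H /max[]//]; exists K.
move=> H; split=> [[aH [_ maxH]]|HK].
  by have [le iso] := max H aH; apply/iso/eqP; rewrite eqn_leq le -Km maxH.
split; first exact: isomorphic_admissible HK aK.
rewrite (isomorphic_card HK); split; first by exists K.
by rewrite Km => G /max[].
Qed.

Lemma SP_uniq : uniq [:: inord 0; inord 1; inord 2; inord 3; inord 4; inord 5 : SP n].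
Proof. by rewrite /= !inE -!val_eqE /= !inordK. Qed.

Lemma CB_uniq : uniq [:: inord 0; inord 1; inord 2; inord 3; inord 4 : CB n].
Proof. by rewrite /= !inE -!val_eqE /= !inordK. Qed.

Lemma card_SP : #|SP n| = n.
Proof. by rewrite card_ord; move: n9; card_lia. Qed.

Lemma card_CB : #|CB n| = n.
Proof. by rewrite card_ord; move: n9; card_lia. Qed.

Lemma SP_isomorphic (H : graph3) p0 p1 p2 p3 p4 v : #|H| = n ->
    uniq [:: p0; p1; p2; p3; p4; v] -> edges H = SP_edges p0 p1 p2 p3 p4 v -> isomorphic H (SP n).
Proof.
move=> Hn un HE; have cc : #|H| = #|SP n| by rewrite Hn card_SP.
have [f f_bij [f0 f1 f2 f3 f4 f5]] := bijection_of_seq (inord 0) un SP_uniq erefl cc.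
exists f => // e; rewrite HE -(SP_edges_imset (bij_inj f_bij)).
by rewrite f0 f1 f2 f3 f4 f5.
Qed.

Lemma CB_isomorphic (H : graph3) x y1 y2 z1 z2 : #|H| = n ->
    uniq [:: x; y1; y2; z1; z2] -> edges H = CB_edges x y1 y2 z1 z2 -> isomorphic H (CB n).
Proof.
move=> Hn un HE; have cc : #|H| = #|CB n| by rewrite Hn card_CB.
have [f f_bij [f0 f1 f2 f3 f4]] := bijection_of_seq (inord 0) un CB_uniq erefl cc.
exists f => // e; rewrite HE -(CB_edges_imset (bij_inj f_bij)).
by rewrite f0 f1 f2 f3 f4.
Qed.

End Orders.

Theorem theorem1p4 (n : nat) (hn : 9 <= n) :
  (n <= 11 ->
     turan_number minimal_4path n 2 (5 * n - 18) /\
     (forall H : graph3,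
        turan_family minimal_4path n 2 H <-> isomorphic H (SP n))) /\
  (12 <= n ->
     turan_number minimal_4path n 2 ('C(n - 3, 2) + 7) /\
     (forall H : graph3,
        turan_family minimal_4path n 2 H <-> isomorphic H (CB n))).
Proof.
have [aS cS] := SP_edges_admissible hn (card_SP hn) (SP_uniq n) erefl.
have [aC cC] := CB_edges_admissible hn (card_CB hn) (CB_uniq n) erefl.
split=> h.
  (* The thresholds cross between 11 and 12: at [n = 11] they are [35 < 37], at [n = 12] they are
     [43 > 42]. *)
  have lt : 'C(n - 3, 2) + 7 + 18 < 5 * n.
    have : n \in [:: 9; 10; 11] by rewrite !inE; lia.
    by rewrite !inE => /or3P[] /eqP ->.
  apply: second_order aS _ _; first by lia.
  move=> H aH; have [Hn _ _] := (admissible2 hn H).1 aH.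
  case: (admissible2_cases hn aH) => [|[[p0 [p1 [p2 [p3 [p4 [v [un HE]]]]]]] cH]|[_ cH]].
  - by rewrite /small => sm; split=> [|cH]; move: sm lt; try (rewrite cH); card_lia.
  - by split=> [|_]; [move: cH; card_lia | exact: SP_isomorphic un HE].
  by split=> [|cH']; move: cH lt; try (rewrite cH'); card_lia.
have lt : 5 * n < 'C(n - 3, 2) + 7 + 18.
  have [t nt] : exists t : nat, n = 12 + t by exists (n - 12); lia.
  have e3 : n - 3 = 9 + t by lia.
  have := bin2_add 9 t; rewrite (_ : 'C(9, 2) = 36) // => e9.
  by rewrite e3 nt; move: e9; card_lia.
apply: second_order aC cC _ => H aH; have [Hn _ _] := (admissible2 hn H).1 aH.
case: (admissible2_cases hn aH) => [|[_ cH]|[[x [y1 [y2 [z1 [z2 [un HE]]]]]] cH]].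
- by rewrite /small => sm; split=> [|cH]; move: sm lt; try (rewrite cH); card_lia.
- by split=> [|cH']; move: cH lt; try (rewrite cH'); card_lia.
by split=> [|_]; [rewrite cH | exact: CB_isomorphic un HE].
Qed.
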